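(* Let $N\ge2$ be an integer, let $m_0,m_0'\in L^\infty(\mathbb{T})$ be non-singular, and let $\varphi,\varphi'\in L^2(\mathbb{R})$ be cyclic vectors for the wavelet representation of $\mathfrak{A}_N$ on $L^2(\mathbb{R})$ satisfying the scaling equations $U\varphi=\pi(m_0)\varphi$ and $U\varphi'=\pi(m_0')\varphi'$. Suppose the following conditions are satisfied: (i) $\widehat{\varphi}(0)\ne0\ne\widehat{\varphi'}(0)$. (ii) The integer translates of $\varphi$ form a Riesz basis for their closed linear span, and likewise the integer translates of $\varphi'$. (iii) $\widehat\varphi$ and $\widehat{\varphi'}$ are continuous at $0$, and $$\sum_{k\ne0}|\widehat\varphi|^2(x+2k\pi)\to0,\qquad \sum_{k\neq0}|\widehat{\varphi'}|^2(x+2k\pi)\to0\qquad\text{as }x\to0.$$ (iv) $\varphi$ and $\varphi'$ are biorthogonal, or equivalently $$\sum_{k\in\mathbb{Z}}\overline{\widehat\varphi}(x+2k\pi)\,\widehat{\varphi'}(x+2k\pi)=1\quad\text{a.e. on }\mathbb{R}.$$ Then there exists exactly one (up to a constant multiple) solution $h_0\in L^\infty(\mathbb{T})$ of $$R_{m_0,m_0'}h_0=h_0$$ which is continuous at $z=1$; the solution is the constant function $h_0=1$.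
   Context: $\mathbb{T}$ is the unit circle with normalized Haar measure; functions on $\mathbb{T}$ are identified with $2\pi$-periodic functions on $\mathbb{R}$ via $z=e^{-i\omega}$. Functions are identified when equal a.e.; continuity at a point refers to a suitable representative. A function $m\in L^\infty(\mathbb{T})$ is non-singular if it does not vanish on a subset of $\mathbb{T}$ of positive measure. The Fourier transform is $\widehat\psi(x)=\int_{\mathbb{R}}\psi(t)e^{-itx}\,dt$ (extended to $L^2(\mathbb{R})$). Ruelle transfer operator on $L^1(\mathbb{T})$: $R_{m_0,m_0'}f(z)=\frac1N\sum_{w^N=z}\overline{m_0(w)}\,m_0'(w)f(w)$. $\mathfrak{A}_N$ is the $C^*$-algebra generated by two unitaries $U,V$ with $UVU^{-1}=V^N$. Its wavelet representation on $L^2(\mathbb{R})$ is given by $U\psi(x)=\frac1{\sqrt N}\psi\left(\frac xN\right)$ and $V\psi(x)=\psi(x-1)$; $V=\pi(z)$, where $\pi$ is the representation of $L^\infty(\mathbb{T})$ on $L^2(\mathbb{R})$ given by $\widehat{\pi(f)\psi}=f\widehat\psi$ ($f$ viewed as a $2\pi$-periodic function). The scaling equation $U\varphi=\pi(m_0)\varphi$ is equivalent to $\widehat\varphi(\omega)=\frac{1}{\sqrt N}m_0\left(\frac{\omega}{N}\right)\widehat\varphi\left(\frac\omega N\right)$. A vector $\varphi$ is cyclic if $\{U^{-n}\pi(f)\varphi: n\in\mathbb{N}, f\in L^\infty(\mathbb{T})\}$ is dense in $L^2(\mathbb{R})$. Biorthogonality of $\varphi,\varphi'$ means $\langle\varphi(\cdot-k),\varphi'(\cdot-l)\rangle=\delta_{kl}$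 for $k,l\in\mathbb{Z}$. *)

(* Defs.v *)
From HB Require Import structures.
From mathcomp Require Import all_boot all_order all_algebra finmap.
From mathcomp Require Import all_classical all_reals all_analysis.
From mathcomp Require Import complex.

Set Implicit Arguments.
Unset Strict Implicit.
Unset Printing Implicit Defensive.

Import Order.TTheory GRing.Theory Num.Theory numFieldNormedType.Exports.

Local Open Scope classical_set_scope.
Local Open Scope ring_scope.
Local Open Scope complex_scope.

Local Notation normc := Normc.normc.
Local Notation leb := lebesgue_measure.

(* The libraries give neither a sigma-algebra on [R[i]] nor complex-valued
   integrals, so both are taken componentwise. *)
Definition cmeasurable_fun {R : realType} (f : R -> R[i]) : Prop :=
  measurable_fun [set: R] (fun x => complex.Re (f x)) /\
  measurable_fun [set: R] (fun x => complex.Im (f x)).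

(* Only meaningful for [f] integrable on [D]. *)
Definition integralC {R : realType} (D : set R) (f : R -> R[i]) : R[i] :=
  (\int[leb]_(x in D) complex.Re (f x)) +i* (\int[leb]_(x in D) complex.Im (f x)).

Definition LnormC {R : realType} (p : \bar R) (f : R -> R[i]) : \bar R :=
  Lnorm leb p (fun x => (normc (f x))%:E).

Definition LpC {R : realType} (p : \bar R) : set (R -> R[i]) :=
  [set f | cmeasurable_fun f /\ (LnormC p f < +oo)%E].

Definition L2norm {R : realType} (f : R -> R[i]) : \bar R := LnormC 2%:E f.

Definition L2 {R : realType} : set (R -> R[i]) := LpC 2%:E.

Definition inner {R : realType} (f g : R -> R[i]) : R[i] :=
  integralC setT (fun x => (f x)^* * g x).

Definition expi {R : realType} (t : R) : R[i] := cos t +i* sin t.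

(* [g] represents the Fourier transform of [psi]: the unitary (up to a scalar)
   extension of the integral formula to L^2(R) is the L^2-limit of the transforms
   of the truncations of [psi] to [-n, n], which lie in L^1 and L^2. *)
Definition fourier_trunc {R : realType} (n : nat) (psi : R -> R[i]) (x : R)
  : R[i] :=
  integralC `[- n%:R, n%:R] (fun t => psi t * expi (- (t * x))).

Definition is_fourier {R : realType} (psi g : R -> R[i]) : Prop :=
  [/\ L2 psi, L2 g &
      L2norm (fun x => g x - fourier_trunc n psi x) @[n --> \oo] --> 0%E].

(* Functions on the unit circle are maps [R[i] -> R[i]], of which only the
   values on the circle are used, and are transported to the real line along
   omega |-> exp (- i omega).  A subset of the circle is null for Haar measure
   iff its preimage under this map is Lebesgue null. *)
Definition circle {R : realType} : set R[i] := [set z | normc z = 1].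

Definition circ {R : realType} (w : R) : R[i] := expi (- w).

Definition ae_eqT {R : realType} (f g : R[i] -> R[i]) : Prop :=
  \forall w \ae leb, f (circ (w : R)) = g (circ w).

Definition LinftyT {R : realType} : set (R[i] -> R[i]) :=
  [set f | LpC +oo%E (fun w : R => f (circ w))].

Definition nonsingular {R : realType} (m : R[i] -> R[i]) : Prop :=
  ~ exists E : set R, [/\ measurable E, (0 < leb E)%E &
      forall w, E w -> m (circ w) = 0].

Definition continuous_at1T {R : realType} (f : R[i] -> R[i]) : Prop :=
  exists g : R[i]^o -> R[i]^o, ae_eqT g f /\
    g z @[z --> within circle (nbhs (1 : R[i]^o))] --> g 1.

Definition ruelle {R : realType} (N : nat) (m0 m0' f : R[i] -> R[i]) (z : R[i])
  : R[i] :=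
  N%:R^-1 * \sum_(w \in [set w | w ^+ N = z]) ((m0 w)^* * m0' w * f w).

Definition dilation {R : realType} (N : nat) (psi : R -> R[i]) (x : R) : R[i] :=
  (Num.sqrt N%:R)^-1%:C * psi (x / N%:R).

Definition dilation_inv {R : realType} (N : nat) (psi : R -> R[i]) (x : R)
  : R[i] :=
  (Num.sqrt N%:R)%:C * psi (N%:R * x).

Definition translate {R : realType} (k : int) (psi : R -> R[i]) (x : R) : R[i] :=
  psi (x - k%:~R).

(* [mult_rep f psi eta] says that [eta] represents the class of pi(f) psi. *)
Definition mult_rep {R : realType} (f : R[i] -> R[i]) (psi eta : R -> R[i])
  : Prop :=
  exists2 g, is_fourier psi g & is_fourier eta (fun w => f (circ w) * g w).

Definition cyclic_vector {R : realType} (N : nat) (phi : R -> R[i]) : Prop :=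
  forall psi (e : R), L2 psi -> 0 < e ->
  exists (n : nat) (f : R[i] -> R[i]) (eta : R -> R[i]),
    [/\ LinftyT f, mult_rep f phi eta &
        (L2norm (fun x => psi x - iter n (dilation_inv N) eta x)%R < e%:E)%E].

(* Completeness in the closed linear span is automatic, so that the Riesz basis
   property amounts to the two-sided bound on finite linear combinations. *)
Definition riesz_translates {R : realType} (phi : R -> R[i]) : Prop :=
  exists A B : R, [/\ 0 < A, 0 < B &
    forall (J : {fset int}) (c : int -> R[i]),
      ((A * \sum_(k <- J) normc (c k) ^+ 2)%:E
         <= (L2norm (fun x => \sum_(k <- J) c k * translate k phi x)%R) ^+ 2
         <= (B * \sum_(k <- J) normc (c k) ^+ 2)%:E)%E].

Definition biorthogonal {R : realType} (phi phi' : R -> R[i]) : Prop :=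
  forall k l : int, inner (translate k phi) (translate l phi') = (k == l)%:R.

Definition vanishing_tails {R : realType} (g : R -> R[i]) : Prop :=
  (\esum_(k in [set k : int | k != 0%R])
     (normc (g (x + 2 * k%:~R * pi)) ^+ 2)%:E)%E @[x --> (0 : R)^'] --> 0%E.

(* Absolutely convergent sum over the integers; the symmetric partial sums
   range over [-n, n]. *)
Definition sumZ_is {R : realType} (u : int -> R[i]) (s : R[i]) : Prop :=
  summable [set: int] (fun k => (normc (u k))%:E) /\
  (\sum_(k < n.*2.+1) u (k%:Z - n%:Z) : R[i]^o) @[n --> \oo] --> (s : R[i]^o).

Definition periodized_product_is1 {R : realType} (g g' : R -> R[i]) : Prop :=
  \forall x \ae leb, sumZ_is
    (fun k => (g (x + 2 * k%:~R * pi))^* * g' (x + 2 * k%:~R * pi)) 1.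

Definition ruelle_solution {R : realType} (N : nat) (m0 m0' h : R[i] -> R[i])
  : Prop :=
  [/\ LinftyT h, ae_eqT (ruelle N m0 m0' h) h & continuous_at1T h].

(* Main.v *)
From HB Require Import structures.
Require Import Defs.
From mathcomp Require Import all_boot all_order all_algebra.
From mathcomp Require Import all_classical all_reals all_analysis.
From mathcomp Require Import measurable_realfun ess_sup_inf.
From mathcomp Require Import complex ring lra zify.

(** Let P be the product of the conjugate of phihat with phihat', an integrable
function on the line.

Biorthogonality.  By Plancherel, the inner product of the translates by k and
l is 1 / (2 pi) times the integral of P(x) e^(i (k - l) x).  Cutting the line
into periods turns this integral into a Fourier coefficient of the
periodization of P, and an integrable function on a period is determined by
its Fourier coefficients [fourier_uniqueness].  So the translates are
biorthogonal if and only if the periodization is 1 almost everywhere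
[orbit_sum_eq1P, biorthogonal_orbit_sum].

The operator.  On the Fourier side the scaling equations combine into
N P(N w) = M(w) P(w), where M is the 2 pi-periodic function given by the
product of the conjugate of m0 with m0'.  Suppose that the sum over k of
P(x + 2 pi k) G(x + 2 pi k) is E(x), with E periodic.  In the sum of
P(x + 2 pi k) G((x + 2 pi k) / N), collect the k of each residue j modulo N:
the scaling relation identifies each class with M E at (x + 2 pi j) / N, up to
the factor 1 / N, so that the whole sum is the operator applied to E
[csum_refine, ruelle_circ].  With G = E = 1 this shows that 1 is a fixed point.
If h is a fixed point, then starting from h itself and iterating gives, for
every n and almost every x,
  h(z) = sum over k of P(x + 2 pi k) h(exp (- i (x + 2 pi k) / N^n)),
where z = exp (- i x) [csum_fixed_point].  Now let n tend to infinity.  Each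
point exp (- i (x + 2 pi k) / N^n) tends to 1, where h is continuous; since h
is bounded and the sum of the P(x + 2 pi k) converges absolutely to 1, the
right-hand side tends to the value of h at 1 by dominated convergence
[csum_tannery].  Hence h is constant [fixed_point_constant].

The Fourier analysis behind these steps is developed along a short route.
Uniqueness of Fourier coefficients and density of trigonometric polynomials
both come from one measure-theoretic fact: the sets whose indicators an
algebra of measurable functions approximates in weighted mean form a
sigma-algebra [sigma_algebra_approximable], and for trigonometric polynomials
it contains the half-lines.  Parseval then follows from the explicit formula
for the mean square error [bessel_identity].  For a function supported in one
period, the values of its Fourier integral along a progression are the
Fourier coefficients of a modulation of it; Parseval sums them and integrating
over the starting point gives Plancherel [plancherel_period].  The pairs of
functions that are limits of such test functions together with their Fourier
integrals [transform_pair] carry this over to all of L^2. *)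

Set Implicit Arguments.
Unset Strict Implicit.
Unset Printing Implicit Defensive.

Import Order.TTheory GRing.Theory Num.Theory numFieldNormedType.Exports.

Local Open Scope classical_set_scope.
Local Open Scope ring_scope.
Local Open Scope complex_scope.

Local Notation normc := Normc.normc.
Local Notation Re := complex.Re.
Local Notation Im := complex.Im.

(** * Complex numbers and the circle *)

Section complex_facts.
Context {R : realType}.
Implicit Types (z w : R[i]) (a b x : R).

Lemma sqr_normcE z : normc z ^+ 2 = Re z ^+ 2 + Im z ^+ 2.
Proof. by case: z => a b /=; rewrite sqr_sqrtr// addr_ge0 ?sqr_ge0. Qed.

Lemma normc_ge0 z : 0 <= normc z.
Proof. by case: z => a b; exact: sqrtr_ge0. Qed.

Lemma normr_normc z : `|z| = (normc z)%:C.
Proof. by case: z. Qed.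

Lemma normc_conj z : normc z^* = normc z.
Proof. by case: z => a b /=; rewrite sqrrN. Qed.

Lemma normc_real x : normc x%:C = `|x|.
Proof. by rewrite /= expr0n addr0 sqrtr_sqr. Qed.

Lemma normc_Re z : `|Re z| <= normc z.
Proof.
rewrite -(@ler_pXn2r _ 2)// ?nnegrE ?normc_ge0// sqr_normcE real_normK ?num_real//.
by rewrite lerDl sqr_ge0.
Qed.

Lemma normc_Im z : `|Im z| <= normc z.
Proof.
rewrite -(@ler_pXn2r _ 2)// ?nnegrE ?normc_ge0// sqr_normcE real_normK ?num_real//.
by rewrite lerDr sqr_ge0.
Qed.

Lemma normc_le_ReIm z : normc z <= `|Re z| + `|Im z|.
Proof.
rewrite -(@ler_pXn2r _ 2)// ?nnegrE ?normc_ge0 ?addr_ge0// sqr_normcE.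
by rewrite sqrrD !real_normK ?num_real// -addrA lerD2l lerDr mulrn_wge0// mulr_ge0.
Qed.

Lemma complex_eq z w : Re z = Re w -> Im z = Im w -> z = w.
Proof. by case: z => a b; case: w => c d /= -> ->. Qed.

Lemma Re_mulc z w : Re (z * w) = Re z * Re w - Im z * Im w.
Proof. by case: z => a b; case: w. Qed.

Lemma Im_mulc z w : Im (z * w) = Re z * Im w + Im z * Re w.
Proof. by case: z => a b; case: w. Qed.

Lemma Re_addc z w : Re (z + w) = Re z + Re w.
Proof. by case: z => a b; case: w. Qed.

Lemma Im_addc z w : Im (z + w) = Im z + Im w.
Proof. by case: z => a b; case: w. Qed.

Lemma Re_oppc z : Re (- z) = - Re z. Proof. by case: z. Qed.
Lemma Im_oppc z : Im (- z) = - Im z. Proof. by case: z. Qed.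
Lemma Re_subc z w : Re (z - w) = Re z - Re w. Proof. by rewrite Re_addc Re_oppc. Qed.
Lemma Im_subc z w : Im (z - w) = Im z - Im w. Proof. by rewrite Im_addc Im_oppc. Qed.
Lemma Re_conjc z : Re z^* = Re z. Proof. by case: z. Qed.
Lemma Im_conjc z : Im z^* = - Im z. Proof. by case: z. Qed.

Definition ReImE := (Re_mulc, Im_mulc, Re_addc, Im_addc, Re_oppc, Im_oppc, Re_conjc, Im_conjc).

Lemma expiD a b : expi (a + b) = expi a * expi b :> R[i].
Proof. by rewrite /expi cosD sinD; apply: complex_eq => /=; ring. Qed.

Lemma expi0 : expi 0 = 1 :> R[i].
Proof. by rewrite /expi cos0 sin0. Qed.

Lemma conj_expi a : (expi a)^* = expi (- a) :> R[i].
Proof. by rewrite /expi cosN sinN. Qed.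

Lemma normc_expi a : normc (expi a) = 1 :> R.
Proof. by rewrite /= cos2Dsin2 sqrtr1. Qed.

Lemma expiN a : expi (- a) * expi a = 1 :> R[i].
Proof. by rewrite -expiD addNr expi0. Qed.

Lemma expi_2pin (n : nat) : expi (2 * n%:R * pi) = 1 :> R[i].
Proof.
elim: n => [|n IH]; first by rewrite mulr0 mul0r expi0.
have -> : 2 * n.+1%:R * pi = 2 * n%:R * pi + pi *+ 2 :> R by rewrite -natr1; ring.
by rewrite expiD IH mul1r /expi cos2pi sin2pi.
Qed.

Lemma expi_2pi (k : int) : expi (2 * k%:~R * pi) = 1 :> R[i].
Proof.
case: k => n; first exact: expi_2pin.
have := expiN (2 * n.+1%:R * pi : R); rewrite expi_2pin mulr1 => <-.
by congr expi; rewrite NegzE mulrNz; ring.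
Qed.

End complex_facts.

(** * Lebesgue measure under translations and dilations *)

Section lebesgue_affine.
Context {R : realType}.
Local Notation mu := (@lebesgue_measure R).

Lemma measurable_shift (a : R) :
  measurable_fun setT ((fun x => x + a) : measurableTypeR R -> measurableTypeR R).
Proof. exact: measurable_funD. Qed.

Lemma measurable_mulr (a : R) :
  measurable_fun setT ((fun x => a * x) : measurableTypeR R -> measurableTypeR R).
Proof. exact: mulrl_measurable. Qed.

Lemma lebesgue_measure_shift (a : R) (A : set R) : measurable A ->
  pushforward mu ((fun x => x + a) : measurableTypeR R -> measurableTypeR R) A = mu A.
Proof.
move=> mA; pose f := (fun x => x + a) : measurableTypeR R -> measurableTypeR R.
pose mf := isMeasurableFun.Build _ _ _ _ f (measurable_shift a).
pose F : {mfun measurableTypeR R >-> measurableTypeR R} := HB.pack f mf.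
apply/esym.
apply: (@lebesgue_measure_unique R (pushforward mu F)) => //= _ [[b c]] _ <-.
rewrite /pushforward [X in _ = mu X](_ : _ = `]b - a, c - a]%classic); last first.
  by apply/seteqP; split => x /=; rewrite !in_itv/= /F/=/f ltrBlDr lerBrDr.
rewrite !lebesgue_measure_itv/= !lte_fin ltrD2r.
by case: ifPn => // _; rewrite -!EFinB; congr EFin; ring.
Qed.

Lemma lebesgue_measure_scale (a : {nonneg R}) (A : set R) : 0 < a%:num ->
  measurable A ->
  (a%:num%:E * mu ((fun x : R => a%:num * x)%R @^-1` A) = mu A)%E.
Proof.
move=> a0 mA; pose f := (fun x => a%:num * x) : measurableTypeR R -> measurableTypeR R.
pose mf := isMeasurableFun.Build _ _ _ _ f (measurable_mulr a%:num).
pose F : {mfun measurableTypeR R >-> measurableTypeR R} := HB.pack f mf.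
apply/esym.
apply: (@lebesgue_measure_unique R (mscale a (pushforward mu F))) => //= _ [[b c]] _ <-.
rewrite /mscale /= /pushforward /F /= /f.
rewrite [X in _ = (_ * mu X)%E](_ : _ = `]b / a%:num, c / a%:num]%classic); last first.
  by apply/seteqP; split => x /=; rewrite !in_itv/= ltr_pdivrMr// ler_pdivlMr// ![x * _]mulrC.
rewrite !lebesgue_measure_itv/= !lte_fin ltr_pM2r ?invr_gt0//.
case: ifPn => // _; last by rewrite mule0.
by rewrite -!EFinB -EFinM; congr EFin; field; rewrite gt_eqF.
Qed.

(** Both sides integrate f against a translate of Lebesgue measure, which is
Lebesgue measure again. *)
Lemma ge0_integral_shift (a : R) (f : R -> \bar R) :
  measurable_fun setT f -> (forall x, 0 <= f x)%E ->
  (\int[mu]_x f (x + a)%R = \int[mu]_x f x)%E.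
Proof.
move=> mf f0.
rewrite -(@ge0_integral_pushforward _ _ (measurableTypeR R) (measurableTypeR R) R _ (measurable_shift a) mu setT f)//.
apply: eq_measure_integral => [|? A mA _]; first exact: measurable_shift.
exact: lebesgue_measure_shift.
Qed.

Lemma ge0_integral_scale (a : R) (f : R -> \bar R) : 0 < a ->
  measurable_fun setT f -> (forall x, 0 <= f x)%E ->
  (a%:E * \int[mu]_x f (a * x)%R = \int[mu]_x f x)%E.
Proof.
move=> a0 mf f0; pose b := NngNum (ltW a0).
pose g := (fun x => a * x) : measurableTypeR R -> measurableTypeR R.
pose mg := isMeasurableFun.Build _ _ _ _ g (measurable_mulr a).
pose G : {mfun measurableTypeR R >-> measurableTypeR R} := HB.pack g mg.
rewrite -(@ge0_integral_pushforward _ _ (measurableTypeR R) (measurableTypeR R) R _ (measurable_mulr a) mu setT f)//.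
rewrite -(@ge0_integral_mscale _ _ R (pushforward mu G) setT measurableT b f)//.
apply: eq_measure_integral => A mA _.
exact: (@lebesgue_measure_scale b).
Qed.

Lemma integral_shift (a : R) (f : R -> \bar R) : measurable_fun setT f ->
  (\int[mu]_x f (x + a)%R = \int[mu]_x f x)%E.
Proof.
move=> mf; rewrite [LHS]integralE [RHS]integralE.
rewrite -(ge0_integral_shift a (measurable_funepos mf) (fun x => funepos_ge0 f x)).
rewrite -(ge0_integral_shift a (measurable_funeneg mf) (fun x => funeneg_ge0 f x)).
congr (_ - _)%E; apply: eq_integral => x _; rewrite ?funeposE ?funenegE//.
Qed.

(** The case analysis at the end covers infinite integrals of the positive and
negative parts. *)
Lemma integral_scale (a : R) (f : R -> \bar R) : 0 < a -> measurable_fun setT f ->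
  (a%:E * \int[mu]_x f (a * x)%R = \int[mu]_x f x)%E.
Proof.
move=> a0 mf; rewrite [X in (_ * X)%E]integralE [RHS]integralE.
rewrite -(ge0_integral_scale a0 (measurable_funepos mf) (fun x => funepos_ge0 f x)).
rewrite -(ge0_integral_scale a0 (measurable_funeneg mf) (fun x => funeneg_ge0 f x)).
transitivity (a%:E * (\int[mu]_x (f^\+ (a * x)%R) - \int[mu]_x (f^\- (a * x)%R)))%E.
  by congr (_ * (_ - _))%E; apply: eq_integral => x _; rewrite ?funeposE ?funenegE.
have : (0 <= \int[mu]_x (f^\+ (a * x)%R))%E by exact: integral_ge0.
have : (0 <= \int[mu]_x (f^\- (a * x)%R))%E by exact: integral_ge0.
move: (integral _ _ _) (integral _ _ _) => [r| |] [s| |]// _ _.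
- by rewrite -EFinB -!EFinM -EFinB mulrBr.
- by rewrite /= gt0_muley// gt0_muleNy.
- by rewrite /= gt0_muley.
- by rewrite /= gt0_muley// gt0_muleNy.
Qed.

End lebesgue_affine.

(** * Complex-valued functions and the L2 norm *)

Section measurable_complex.
Context {R : realType}.
Implicit Types f g : R -> R[i].

Lemma cmeasurable_cst (c : R[i]) : cmeasurable_fun (fun _ : R => c).
Proof. by split; exact: measurable_cst. Qed.

Lemma cmeasurableD f g : cmeasurable_fun f -> cmeasurable_fun g ->
  cmeasurable_fun (fun x => f x + g x).
Proof.
move=> [rf jf] [rg jg]; split.
  by under eq_fun do rewrite Re_addc; exact: measurable_funD.
by under eq_fun do rewrite Im_addc; exact: measurable_funD.
Qed.

Lemma cmeasurableM f g : cmeasurable_fun f -> cmeasurable_fun g ->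
  cmeasurable_fun (fun x => f x * g x).
Proof.
move=> [rf jf] [rg jg]; split.
  by under eq_fun do rewrite Re_mulc; apply: measurable_funB; exact: measurable_funM.
by under eq_fun do rewrite Im_mulc; apply: measurable_funD; exact: measurable_funM.
Qed.

Lemma cmeasurableN f : cmeasurable_fun f -> cmeasurable_fun (fun x => - f x).
Proof.
move=> [rf jf]; split.
  by under eq_fun do rewrite Re_oppc; exact: measurable_funN.
by under eq_fun do rewrite Im_oppc; exact: measurable_funN.
Qed.

Lemma cmeasurableB f g : cmeasurable_fun f -> cmeasurable_fun g ->
  cmeasurable_fun (fun x => f x - g x).
Proof. by move=> mf mg; apply: cmeasurableD => //; exact: cmeasurableN. Qed.

Lemma cmeasurableJ f : cmeasurable_fun f -> cmeasurable_fun (fun x => (f x)^*).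
Proof.
move=> [rf jf]; split.
  by under eq_fun do rewrite Re_conjc.
by under eq_fun do rewrite Im_conjc; exact: measurable_funN.
Qed.

Lemma cmeasurable_comp f (k : R -> R) : measurable_fun setT k ->
  cmeasurable_fun f -> cmeasurable_fun (fun x => f (k x)).
Proof.
move=> mk [rf jf]; split.
  exact: (measurableT_comp rf mk).
exact: (measurableT_comp jf mk).
Qed.

Lemma cmeasurable_real (k : R -> R) : measurable_fun setT k ->
  cmeasurable_fun (fun x => (k x)%:C).
Proof. by move=> mk; split => //=; exact: measurable_cst. Qed.

Lemma cmeasurable_expi (k : R -> R) : measurable_fun setT k ->
  cmeasurable_fun (fun x => expi (k x)).
Proof.
move=> mk; split; (apply: measurableT_comp => //; apply: continuous_measurable_fun).
  exact: continuous_cos.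
exact: continuous_sin.
Qed.

Lemma cmeasurable_modulation (a : R) : cmeasurable_fun (fun x => expi (- (a * x)) : R[i]).
Proof. by apply: cmeasurable_expi; apply: measurable_funN; exact: mulrl_measurable. Qed.

Lemma cmeasurable_phase (x : R) : cmeasurable_fun (fun t => expi (- (t * x)) : R[i]).
Proof. by apply: cmeasurable_expi; apply: measurable_funN; exact: mulrr_measurable. Qed.

Lemma measurable_sqr_normc f : cmeasurable_fun f ->
  measurable_fun setT (fun x => normc (f x) ^+ 2).
Proof.
move=> [rf jf]; under eq_fun do rewrite sqr_normcE.
by apply: measurable_funD; apply: measurable_funX.
Qed.

Lemma measurable_normc f : cmeasurable_fun f ->
  measurable_fun setT (fun x => normc (f x)).
Proof.
move=> mf.
have -> : (fun x => normc (f x)) = (fun x => Num.sqrt (normc (f x) ^+ 2)).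
  by apply/funext => x; rewrite sqrtr_sqr ger0_norm// normc_ge0.
apply: measurableT_comp; last exact: measurable_sqr_normc.
by apply: continuous_measurable_fun; exact: sqrt_continuous.
Qed.

End measurable_complex.

#[local] Hint Resolve cmeasurable_modulation cmeasurable_phase : core.

Section L2_theory.
Context {R : realType}.
Implicit Types f g : R -> R[i].
Local Notation mu := (@lebesgue_measure R).
Local Open Scope ereal_scope.

(** The square of the L2 norm, without the root: it scales linearly under the
changes of variable and is a plain integral. *)
Definition energy f : \bar R := \int[mu]_x (normc (f x) ^+ 2)%:E.

Lemma energy_ge0 f : 0 <= energy f.
Proof. by apply: integral_ge0 => x _; rewrite lee_fin sqr_ge0. Qed.

Lemma L2normE f : L2norm f = energy f `^ 2^-1.
Proof.
rewrite /L2norm /LnormC unlock; congr (_ `^ _); apply: eq_integral => x _ /=.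
by rewrite ger0_norm ?normc_ge0// powR_mulrn ?normc_ge0.
Qed.

Lemma energyE f : energy f = L2norm f `^ 2.
Proof. by rewrite L2normE -poweRrM mulVf// poweRe1 ?energy_ge0. Qed.

Lemma L2norm_ge0 f : 0 <= L2norm f.
Proof. exact: Lnorm_ge0. Qed.

Lemma L2P f : L2 f <-> cmeasurable_fun f /\ energy f < +oo.
Proof.
split=> -[mf h]; split => //.
  by rewrite energyE poweR_lty.
by rewrite -/(L2norm f) L2normE poweR_lty.
Qed.

Lemma L2norm_le f g : cmeasurable_fun f -> cmeasurable_fun g ->
  (forall x, normc (f x) <= normc (g x))%R -> L2norm f <= L2norm g.
Proof.
move=> mf mg fg; rewrite !L2normE gt0_ler_poweR ?in_itv/= ?leey ?energy_ge0//.
apply: ge0_le_integral => //.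
- by move=> x _; rewrite lee_fin sqr_ge0.
- by apply/measurable_EFinP; exact: measurable_sqr_normc.
- by apply/measurable_EFinP; exact: measurable_sqr_normc.
- by move=> x _; rewrite lee_fin ler_pXn2r ?nnegrE ?normc_ge0.
Qed.

Lemma L2norm_ext f g : (forall x, normc (f x) = normc (g x)) -> L2norm f = L2norm g.
Proof. by move=> fg; rewrite !L2normE /energy; under eq_integral do rewrite fg. Qed.

Lemma L2normD f g : cmeasurable_fun f -> cmeasurable_fun g ->
  L2norm (fun x => f x + g x)%R <= L2norm f + L2norm g.
Proof.
move=> mf mg.
have mn := measurable_normc.
apply: (@le_trans _ _ (Lnorm mu 2%:E (EFin \o ((fun x => normc (f x)) \+ (fun x => normc (g x)))%R))).
  rewrite (_ : Lnorm _ _ _ = L2norm (fun x => (normc (f x) + normc (g x))%:C)); last first.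
    apply: eq_Lnorm => x /=.
    by rewrite expr0n addr0 sqrtr_sqr ger0_norm// addr_ge0 ?normc_ge0.
  apply: L2norm_le => //; first exact: cmeasurableD.
    by apply: cmeasurable_real; apply: measurable_funD; exact: mn.
  move=> x; rewrite normc_real ger0_norm ?addr_ge0 ?normc_ge0//.
  exact: le_normcD.
by apply: minkowski_EFin; [exact: mn|exact: mn|rewrite ler1n].
Qed.

Lemma L2normN f : L2norm (fun x => - f x)%R = L2norm f.
Proof. by apply: L2norm_ext => x; rewrite normcN. Qed.

Lemma L2normB f g : cmeasurable_fun f -> cmeasurable_fun g ->
  L2norm (fun x => f x - g x)%R <= L2norm f + L2norm g.
Proof.
by move=> mf mg; rewrite -(L2normN g); apply: L2normD => //; exact: cmeasurableN.
Qed.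

Lemma energyZ (c : R[i]) f : cmeasurable_fun f ->
  energy (fun x => c * f x)%R = (normc c ^+ 2)%:E * energy f.
Proof.
move=> mf; rewrite /energy -ge0_integralZl_EFin ?sqr_ge0//.
- by apply: eq_integral => x _; rewrite Normc.normcM exprMn EFinM.
- by move=> x _; rewrite lee_fin sqr_ge0.
- by apply/measurable_EFinP; exact: measurable_sqr_normc.
Qed.

Lemma L2normZ (c : R[i]) f : cmeasurable_fun f ->
  L2norm (fun x => c * f x)%R = (normc c)%:E * L2norm f.
Proof.
move=> mf; rewrite !L2normE energyZ// poweRM ?energy_ge0 ?lee_fin ?sqr_ge0//.
congr (_ * _); rewrite poweR_EFin -powR_mulrn ?normc_ge0//.
by rewrite -powRrM mulfV// powRr1 ?normc_ge0.
Qed.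

Lemma L2D f g : L2 f -> L2 g -> L2 (fun x => f x + g x)%R.
Proof.
move=> [mf ff] [mg gg]; split; first exact: cmeasurableD.
by apply: le_lt_trans (L2normD mf mg) _; exact: lte_add_pinfty.
Qed.

Lemma L2Z (c : R[i]) f : L2 f -> L2 (fun x => c * f x)%R.
Proof.
move=> [mf ff]; split; first by apply: cmeasurableM => //; exact: cmeasurable_cst.
rewrite -/(L2norm _) L2normZ// lte_mul_pinfty// ?lee_fin ?normc_ge0//.
Qed.

Lemma L2N f : L2 f -> L2 (fun x => - f x)%R.
Proof.
by move=> [mf ff]; split; [exact: cmeasurableN|rewrite -/(L2norm _) L2normN].
Qed.

Lemma L2B f g : L2 f -> L2 g -> L2 (fun x => f x - g x)%R.
Proof. by move=> Lf Lg; apply: L2D => //; exact: L2N. Qed.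

Lemma L2norm0_ae f : cmeasurable_fun f -> L2norm f = 0 ->
  \forall x \ae mu, f x = 0%R.
Proof.
move=> mf; move/Lnorm_eq0_eq0 => h; have := h _ _.
have mn : measurable_fun [set: R] (fun x => (normc (f x))%:E).
  by apply/measurable_EFinP; exact: measurable_normc.
move=> /(_ mn)/(_ (lte0n 2)); apply: filterS => x /(_ I) [].
exact: Normc.eq0_normc.
Qed.

End L2_theory.

(** * Approximation of sets by an algebra of functions *)

Section polynomial_steps.
Context {R : realType}.
Implicit Types x u : R.

Lemma bernoulli_ineq u n : -1 <= u -> 1 + n%:R * u <= (1 + u) ^+ n.
Proof.
move=> u1; elim: n => [|n IH]; first by rewrite mul0r addr0 expr0.
rewrite exprS; apply: (@le_trans _ _ ((1 + u) * (1 + n%:R * u))); last first.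
  by rewrite ler_wpM2l// addrC -lerBlDr sub0r.
rewrite -natr1 -subr_ge0.
rewrite (_ : _ - _ = n%:R * u ^+ 2); last by ring.
by rewrite mulr_ge0 ?sqr_ge0.
Qed.

(** A polynomial that converges on [0, 1] to the indicator of x < 1/2.  With
u = x ^ (2 n) and exponent K = n 4 ^ n, the product K u equals n (2 x) ^ (2 n),
which tends to 0 on one side of 1/2 and is at least n on the other. *)
Definition step_poly (n : nat) x : R := (1 - x ^+ (2 * n)) ^+ (n * 4 ^ n).

Lemma step_poly01 n x : 0 <= x <= 1 -> 0 <= step_poly n x <= 1.
Proof.
move=> /andP[x0 x1]; have u0 : 0 <= x ^+ (2 * n) by exact: exprn_ge0.
have u1 : x ^+ (2 * n) <= 1 by exact: exprn_ile1.
by rewrite exprn_ge0 ?subr_ge0//= exprn_ile1 ?subr_ge0// lerBlDr lerDl.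
Qed.

Lemma step_exponent x n :
  (n * 4 ^ n)%:R * x ^+ (2 * n) = n%:R * (2 * x) ^+ n * (2 * x) ^+ n :> R.
Proof.
rewrite exprM natrM natrX -!mulrA -!exprMn; congr (_ * _ ^+ _).
by rewrite expr2; ring.
Qed.

(** Bernoulli's inequality bounds the power below by 1 - n (2 x) ^ (2 n), and a
geometric factor beats n. *)
Lemma step_poly_lt x : 0 <= x -> x < 2^-1 -> step_poly n x @[n --> \oo] --> (1 : R).
Proof.
move=> x0 x2; pose z := 2 * x.
have z0 : 0 <= z by rewrite mulr_ge0.
have z1 : z < 1 by rewrite /z mulrC -ltr_pdivlMr// div1r.
pose C := (1 - z)^-1.
have C0 : 0 < C by rewrite invr_gt0 subr_gt0.
have nz n : n%:R * z ^+ n <= C.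
  rewrite -[leRHS]mul1r ler_pdivlMr ?subr_gt0//.
  suff : n%:R * z ^+ n * (1 - z) <= 1 - z ^+ n.
    by move/le_trans; apply; rewrite lerBlDr lerDl exprn_ge0.
  elim: n => [|n IH]; first by rewrite mul0r mul0r expr0 subrr.
  apply: (@le_trans _ _ (n.+1%:R * z ^+ n * (1 - z))).
    by rewrite ler_wpM2r ?subr_ge0 ?(ltW z1)// ler_wpM2l// exprS ler_piMl ?exprn_ge0// ltW.
  rewrite -natr1 exprS; move: IH; set y := z ^+ n => IH.
  by rewrite (_ : 1 - z * y = 1 - y + y * (1 - z)); [rewrite !mulrDl mul1r lerD2r|ring].
have K n : (n * 4 ^ n)%:R * x ^+ (2 * n) <= C * z ^+ n.
  by rewrite step_exponent ler_wpM2r ?exprn_ge0.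
have x1 : x <= 1 by rewrite (le_trans (ltW x2))// invf_le1// ler1n.
have x01 : 0 <= x <= 1 by rewrite x0.
apply: (@squeeze_cvgr _ _ _ _ (fun n => 1 - C * z ^+ n) (fun=> 1)).
- apply: nearW => n; apply/andP; split; last first.
    by have /andP[] := step_poly01 n x01.
  apply: (@le_trans _ _ (1 - (n * 4 ^ n)%:R * x ^+ (2 * n))); first by rewrite lerB.
  rewrite -mulrN; apply: bernoulli_ineq.
  by rewrite lerN2 exprn_ile1.
- rewrite -[X in _ --> X]subr0; apply: cvgB; first exact: cvg_cst.
  by apply: cvg_geometric; rewrite ger0_norm.
- exact: cvg_cst.
Qed.

(** From (1 - u) (1 + u) <= 1 and Bernoulli's inequality for 1 + u, the value is
at most the inverse of 1 + K u >= n + 1. *)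
Lemma step_poly_ge x : 2^-1 <= x <= 1 -> step_poly n x @[n --> \oo] --> (0 : R).
Proof.
move=> /andP[x2 x1].
have x0 : 0 <= x by rewrite (le_trans _ x2)// invr_ge0.
have z1 : 1 <= 2 * x by rewrite mulrC -ler_pdivrMr// div1r.
have x01 : 0 <= x <= 1 by rewrite x0.
apply: (@squeeze_cvgr _ _ _ _ (fun=> 0) (fun n => (n.+1%:R)^-1)).
- apply: nearW => n; have /andP[p0 p1] := step_poly01 n x01.
  rewrite p0/=; set u := x ^+ (2 * n); set K := (n * 4 ^ n)%N.
  have u0 : 0 <= u by exact: exprn_ge0.
  have h : n.+1%:R <= (1 + u) ^+ K.
    apply: (@le_trans _ _ (1 + K%:R * u)).
      rewrite -natr1 addrC lerD2l /K /u step_exponent -mulrA ler_peMr//.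
      by rewrite -exprMn -expr2 exprn_ege1// exprn_ege1.
    by apply: bernoulli_ineq; rewrite (le_trans _ u0)// lerN10.
  rewrite -[leRHS]mul1r ler_pdivlMr//.
  apply: (@le_trans _ _ ((1 - u) ^+ K * (1 + u) ^+ K)).
    by rewrite ler_wpM2l.
  rewrite -exprMn exprn_ile1//.
    by apply: mulr_ge0; [rewrite subr_ge0 exprn_ile1|rewrite addr_ge0].
  by rewrite -subr_sqr expr1n lerBlDr lerDl sqr_ge0.
- exact: cvg_cst.
- exact: cvg_harmonic.
Qed.

End polynomial_steps.

Section approximation_by_algebra.
Context d (T : measurableType d) (R : realType).
Variables (mu : {measure set T -> \bar R}) (D : set T) (w : T -> R).

Definition function_algebra (A : set (T -> R)) :=
  [/\ forall p, A p -> measurable_fun setT p, forall c, A (fun=> c),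
      forall p q, A p -> A q -> A (fun x => p x + q x) &
      forall p q, A p -> A q -> A (fun x => p x * q x)].

(** The weight w makes the same notion serve both uniqueness of Fourier
coefficients, with w the absolute value of the function tested, and density,
with w = 1. *)
Definition approximable (A : set (T -> R)) : set (set T) := [set E | measurable E /\
  forall e : R, 0 < e -> exists p, [/\ A p, forall x, 0 <= p x <= 1 &
    (\int[mu]_(x in D) (`|\1_E x - p x| * w x)%:E < e%:E)%E]].

Hypotheses (mD : measurable D) (w0 : forall x, 0 <= w x).
Hypothesis iw : mu.-integrable D (EFin \o w).

Lemma weighted_bounded_cvg (f : T -> R) (p : (T -> R)^nat) (C : R) :
  measurable_fun setT f -> (forall n, measurable_fun setT (p n)) ->
  (forall n x, `|f x - p n x| <= C) ->
  (forall x, p n x @[n --> \oo] --> f x) ->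
  (\int[mu]_(x in D) (`|f x - p n x| * w x)%:E)%E @[n --> \oo] --> 0%E.
Proof.
move=> mf mp bp pf.
have mw : measurable_fun D w by exact/measurable_EFinP/(measurable_int mu iw).
have mn n : measurable_fun D (fun x => (`|f x - p n x| * w x)%:E).
  apply/measurable_EFinP/measurable_funM => //.
  apply: measurableT_comp => //; apply: measurable_funB; exact: measurable_funTS.
have [|||||] := @dominated_convergence _ _ _ mu D mD
   (fun n x => (`|f x - p n x| * w x)%:E) (cst 0%E) (fun x => (C%:E * (w x)%:E)%E).
- exact: mn.
- exact: measurable_cst.
- apply: aeW => x Dx; apply: cvg_EFin; first by apply: nearW.
  rewrite [X in X @ _ --> _](_ : _ = (fun n => `|f x - p n x| * w x)) //.
  rewrite -[X in _ --> X](mul0r (w x)); apply: cvgMl; rewrite -(normr0 R).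
  apply: cvg_norm; rewrite -(subrr (f x)); apply: cvgB; first exact: cvg_cst.
  exact: pf.
- exact: integrableZl.
- apply: aeW => x n Dx; rewrite -EFinM abse_EFin lee_fin normrM normr_id.
  by rewrite (ger0_norm (w0 x)) ler_wpM2r.
by move=> _ _; rewrite integral0.
Qed.

Lemma weighted_bounded_lt (f : T -> R) (p : (T -> R)^nat) (C e : R) :
  measurable_fun setT f -> (forall n, measurable_fun setT (p n)) ->
  (forall n x, `|f x - p n x| <= C) ->
  (forall x, p n x @[n --> \oo] --> f x) -> 0 < e ->
  exists n, (\int[mu]_(x in D) (`|f x - p n x| * w x)%:E < e%:E)%E.
Proof.
move=> mf mp bp pf e0.
have /fine_cvgP[fin /cvgrPdist_lt /(_ _ e0) h] := weighted_bounded_cvg mf mp bp pf.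
near \oo => n; exists n.
have fn : (\int[mu]_(x in D) (`|f x - p n x| * w x)%:E)%E \is a fin_num by near: n.
rewrite -(fineK fn) lte_fin.
have : `|0 - fine (\int[mu]_(x in D) (`|f x - p n x| * w x)%:E)%E| < e by near: n.
rewrite sub0r normrN ger0_norm// fine_ge0// integral_ge0// => x _.
by rewrite lee_fin mulr_ge0.
Unshelve. all: by end_near. Qed.

Lemma approximable_cvg A E (p : (T -> R)^nat) :
  function_algebra A -> measurable E -> (forall n, A (p n)) ->
  (forall n x, 0 <= p n x <= 1) ->
  (forall x, p n x @[n --> \oo] --> (\1_E x : R)) ->
  approximable A E.
Proof.
move=> [Am _ _ _] mE Ap p01 pE; split=> // e e0.
have mi : measurable_fun setT (\1_E : T -> R) by exact: measurable_indic.
have b n x : `|\1_E x - p n x| <= 1.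
  have /andP[a c] := p01 n x; rewrite indicE; case: (x \in E) => /=.
    by rewrite ger0_norm ?subr_ge0// lerBlDr lerDl.
  by rewrite sub0r normrN ger0_norm.
by have [n ?] := weighted_bounded_lt mi (fun n => Am _ (Ap n)) b pE e0; exists (p n).
Qed.

Let measurable_err (f g : T -> R) : measurable_fun setT f -> measurable_fun setT g ->
  measurable_fun D (fun x => (`|f x - g x| * w x)%:E).
Proof.
move=> mf mg; apply/measurable_EFinP/measurable_funM.
  apply: measurableT_comp => //; apply: measurable_funB; exact: measurable_funTS.
exact/measurable_EFinP/(measurable_int mu iw).
Qed.

Lemma integral_err_triangle (f g h a b : T -> R) (e1 e2 : R) :
  measurable_fun setT f -> measurable_fun setT g -> measurable_fun setT h ->
  measurable_fun setT a -> measurable_fun setT b ->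
  (forall x, `|f x - g x| <= `|f x - h x| + `|a x - b x|) ->
  (\int[mu]_(x in D) (`|f x - h x| * w x)%:E < e1%:E)%E ->
  (\int[mu]_(x in D) (`|a x - b x| * w x)%:E < e2%:E)%E ->
  (\int[mu]_(x in D) (`|f x - g x| * w x)%:E < (e1 + e2)%:E)%E.
Proof.
move=> mf mg mh ma mb le h1 h2; rewrite EFinD; apply: le_lt_trans (lteD h1 h2).
rewrite -ge0_integralD//; last 4 first.
- by move=> x _; rewrite lee_fin mulr_ge0.
- exact: measurable_err.
- by move=> x _; rewrite lee_fin mulr_ge0.
- exact: measurable_err.
apply: ge0_le_integral => //.
- by move=> x _; rewrite lee_fin mulr_ge0.
- exact: measurable_err.
- by apply: emeasurable_funD; exact: measurable_err.
by move=> x _; rewrite -EFinD lee_fin -mulrDl ler_wpM2r.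
Qed.

Lemma approximableC A E : function_algebra A -> approximable A E ->
  approximable A (~` E).
Proof.
move=> [Am Ac AD AM] [mE h]; split; first exact: measurableC.
move=> e /h[p [Ap p01 pe]]; exists (fun x => 1 + -1 * p x); split.
- by apply: AD; [exact: Ac|apply: AM => //; exact: Ac].
- by move=> x; have /andP[? ?] := p01 x; rewrite mulN1r subr_ge0 lerBlDr lerDl; apply/andP.
rewrite (eq_integral (fun x => (`|\1_E x - p x| * w x)%:E))// => x _.
rewrite !indicE in_setC mulN1r -normrN; congr ((_ * _)%:E); congr `|_|.
by case: (x \in E) => /=; ring.
Qed.

Lemma approximableI A E F : function_algebra A -> approximable A E ->
  approximable A F -> approximable A (E `&` F).
Proof.
move=> [Am Ac AD AM] [mE hE] [mF hF]; split; first exact: measurableI.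
move=> e e0; have e20 : 0 < e / 2 by rewrite divr_gt0.
have [p [Ap p01 pe]] := hE _ e20; have [q [Aq q01 qe]] := hF _ e20.
have mi X : measurable X -> measurable_fun setT (\1_X : T -> R).
  by move=> mX; exact: measurable_indic.
exists (fun x => p x * q x); split; first exact: AM.
  move=> x; have /andP[p0 p1] := p01 x; have /andP[q0 q1] := q01 x.
  by rewrite mulr_ge0//= mulr_ile1.
rewrite [e]splitr.
apply: (@integral_err_triangle _ _ (fun x => \1_F x * p x) (\1_F) q) => //.
- exact/mi/measurableI.
- by apply: measurable_funM; exact: Am.
- by apply: measurable_funM; [exact: mi|exact: Am].
- exact: Am.
- move=> x; have /andP[p0 p1] := p01 x.
  apply: (@le_trans _ _ (`|\1_(E `&` F) x - \1_F x * p x| + `|p x * (\1_F x - q x)|)).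
    by apply: le_trans (ler_normD _ _); rewrite le_eqVlt; apply/orP; left; apply/eqP; congr `|_|; ring.
  by rewrite lerD2l normrM (ger0_norm p0) ler_piMl.
- apply: le_lt_trans pe; apply: ge0_le_integral => //.
  + by move=> x _; rewrite lee_fin mulr_ge0.
  + apply: measurable_err; first exact/mi/measurableI.
    by apply: measurable_funM; [exact: mi|exact: Am].
  + by apply: measurable_err; [exact: mi|exact: Am].
  move=> x _; rewrite lee_fin ler_wpM2r// !indicE in_setI.
  by case: (x \in F); rewrite ?andbT ?andbF ?mul1r// mul0r subrr normr0.
Qed.

(** Complements come from 1 - p and intersections from p q; a countable union is
approximated by its finite subunions, by dominated convergence against w. *)
Lemma sigma_algebra_approximable A : function_algebra A ->
  sigma_algebra setT (approximable A).
Proof.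
move=> alg; have [Am Ac AD AM] := alg.
have a0 : approximable A set0.
  split=> // e e0; exists (fun=> 0); split=> [|x|]; first exact: Ac.
    by rewrite lexx ler01.
  by rewrite integral0_eq// => x _; rewrite indic0 subrr normr0 mul0r.
split => //; first by move=> E hE; rewrite setTD; exact: approximableC.
move=> E hE.
have aU n : approximable A (\big[setU/set0]_(i < n) E i).
  elim: n => [|n IH]; first by rewrite big_ord0.
  rewrite big_ord_recr/= -[_ `|` _]setCK setCU.
  by apply: approximableC => //; apply: approximableI => //; exact: approximableC.
have mi X : measurable X -> measurable_fun setT (\1_X : T -> R).
  by move=> mX; exact: measurable_indic.
have mU : measurable (\bigcup_k E k) by apply: bigcupT_measurable => n; have [] := hE n.
have mUn n : measurable (\big[setU/set0]_(i < n) E i) by have [] := aU n.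
split => // e e0; have e20 : 0 < e / 2 by rewrite divr_gt0.
have [] := @weighted_bounded_lt (\1_(\bigcup_k E k))
    (fun n => \1_(\big[setU/set0]_(i < n) E i)) 1 (e / 2) (mi _ mU) (fun n => mi _ (mUn n)).
- move=> n x; rewrite !indicE.
  by do 2 case: (_ \in _); rewrite ?subrr ?normr0 ?subr0 ?sub0r ?normrN ?normr1.
- move=> x; rewrite indicE; case: (boolP (x \in _)) => [|xE].
    rewrite inE => -[k _ Ekx]; apply: cvg_near_cst; near=> n.
    rewrite indicE mem_set// -bigcup_mkord; exists k => //=; near: n.
    exact: nbhs_infty_gt.
  apply: cvg_near_cst; apply: nearW => n.
  rewrite indicE memNset// -bigcup_mkord => -[k _ Ekx]; move/negP: xE; apply.
  by rewrite inE; exists k.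
- by [].
move=> n hn; have [p [Ap p01 pe]] := (aU n).2 _ e20.
exists p; split=> //; rewrite [e]splitr.
apply: (integral_err_triangle (mi _ mU) (Am _ Ap) (mi _ (mUn n)) (mi _ (mUn n)) (Am _ Ap) _ hn pe).
by move=> x; apply: le_trans (ler_normD _ _); rewrite addrA subrK.
Unshelve. all: by end_near. Qed.

(** After an affine change that brings the values of q into [0, 1] and the level
to 1/2, the step polynomials of q converge to the indicator pointwise. *)
Lemma approximable_sublevel A q (c : R) : function_algebra A -> A q ->
  (forall x, `|q x| <= 1) -> `|c| <= 1 -> approximable A [set x | q x < c].
Proof.
move=> alg Aq q1 c1; have [Am Ac AD AM] := alg.
pose r x := (q x - c) / 4 + 2^-1.
have Ar : A r.
  rewrite (_ : r = fun x => (2^-1 - c / 4) + 4^-1 * q x); last first.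
    by apply/funext => x; rewrite /r; ring.
  by apply: (AD (fun=> _)); [exact: Ac|apply: (AM (fun=> _)) => //; exact: Ac].
have AX p n : A p -> A (fun x => p x ^+ n).
  move=> Ap; elim: n => [|n IH]; first by under eq_fun do rewrite expr0; exact: Ac.
  by under eq_fun do rewrite exprS; exact: AM.
have r01 x : 0 <= r x <= 1.
  have := q1 x; move: c1; rewrite !ler_norml /r => /andP[? ?] /andP[? ?].
  by apply/andP; split; lra.
have rE x : (q x < c) = (r x < 2^-1).
  by apply/idP/idP; rewrite /r; lra.
apply: (@approximable_cvg A _ (fun n x => step_poly n (r x))) => //.
- rewrite (_ : [set _ | _] = setT `&` (q @^-1` `]-oo, c[%classic)); last first.
    by rewrite setTI; apply/seteqP; split => x /=; rewrite in_itv.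
  exact: (Am _ Aq).
- move=> n; rewrite /step_poly; apply: (AX (fun x => 1 - r x ^+ (2 * n))).
  under eq_fun do rewrite -mulN1r.
  apply: (AD (fun=> 1)); first exact: Ac.
  by apply: (AM (fun=> -1)); [exact: Ac|exact: AX].
- by move=> n x; exact: step_poly01.
move=> x; rewrite indicE; have /andP[r0 r1] := r01 x.
have [xc|xc] := ltP (q x) c.
  by rewrite mem_set//=; apply: step_poly_lt => //; rewrite -rE.
rewrite memNset/=; last by apply/negP; rewrite -leNgt.
by apply: step_poly_ge; rewrite r1 andbT leNgt -rE -leNgt.
Qed.

End approximation_by_algebra.

(** * Trigonometric polynomials approximate Borel sets *)

Section trigonometric_polynomials.
Context {R : realType}.
Variable w : R.

Definition wave (k : int) (t : R) : R[i] := expi (k%:~R * w * t).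

(** Closure under sums and multiples keeps inductions short; the canonical form
is recovered in [trig_polyE]. *)
Inductive trig_poly : (R -> R[i]) -> Prop :=
| trig_wave k : trig_poly (wave k)
| trig_add p q : trig_poly p -> trig_poly q -> trig_poly (fun t => p t + q t)
| trig_scale c p : trig_poly p -> trig_poly (fun t => c * p t).

Definition real_trig_poly (p : R -> R) := trig_poly (fun t => (p t)%:C).

Lemma waveD k l t : wave (k + l) t = wave k t * wave l t.
Proof. by rewrite /wave -expiD; congr expi; rewrite intrD; ring. Qed.

Lemma wave0 t : wave 0 t = 1.
Proof. by rewrite /wave mul0r mul0r expi0. Qed.

Lemma conj_wave k t : (wave k t)^* = wave (- k) t.
Proof. by rewrite /wave conj_expi; congr expi; rewrite intrN; ring. Qed.

Lemma normc_wave k t : normc (wave k t) = 1.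
Proof. exact: normc_expi. Qed.

Lemma cmeasurable_wave k : cmeasurable_fun (wave k).
Proof. by apply: cmeasurable_expi; exact: mulrl_measurable. Qed.

Lemma trig_mul p q : trig_poly p -> trig_poly q -> trig_poly (fun t => p t * q t).
Proof.
move=> Tp; elim: Tp q => [k|p1 p2 _ IH1 _ IH2|c p1 _ IH] q Tq.
- elim: Tq => [l|q1 q2 _ IH1 _ IH2|c q1 _ IH].
  + by under eq_fun do rewrite -waveD; exact: trig_wave.
  + by under eq_fun do rewrite mulrDr; exact: trig_add.
  + by under eq_fun do rewrite mulrCA; exact: trig_scale.
- by under eq_fun do rewrite mulrDl; apply: trig_add; [exact: IH1|exact: IH2].
- by under eq_fun do rewrite -mulrA; apply: trig_scale; exact: IH.
Qed.

Lemma trig_cst c : trig_poly (fun=> c).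
Proof.
rewrite (_ : (fun=> c) = fun t => c * wave 0 t).
  by apply: trig_scale; exact: trig_wave.
by apply/funext => t; rewrite wave0 mulr1.
Qed.

Lemma cmeasurable_trig p : trig_poly p -> cmeasurable_fun p.
Proof.
elim=> [k|q r _ mq _ mr|c q _ mq]; first exact: cmeasurable_wave.
  exact: cmeasurableD.
by apply: cmeasurableM => //; exact: cmeasurable_cst.
Qed.

Lemma real_trig_algebra : @function_algebra _ (measurableTypeR R) R real_trig_poly.
Proof.
split=> [p /cmeasurable_trig[]//|c|p q Tp Tq|p q Tp Tq]; rewrite /real_trig_poly.
- exact: trig_cst.
- by under eq_fun do rewrite rmorphD; exact: trig_add.
- by under eq_fun do rewrite rmorphM; exact: trig_mul.
Qed.

Lemma real_trig_cos : real_trig_poly (fun t => cos (w * t)).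
Proof.
rewrite /real_trig_poly (_ : (fun _ => _) = fun t => 2^-1%:C * (wave 1 t + wave (-1) t)).
  by apply/trig_scale/trig_add; exact: trig_wave.
apply/funext => t; rewrite -conj_wave /wave mul1r /expi.
by apply: complex_eq; rewrite !ReImE /=; lra.
Qed.

Lemma real_trig_sin : real_trig_poly (fun t => sin (w * t)).
Proof.
rewrite /real_trig_poly (_ : (fun _ => _) = fun t => (0 -i* 2^-1) * (wave 1 t + -1 * wave (-1) t)).
  by apply/trig_scale/trig_add; [|apply: trig_scale]; exact: trig_wave.
apply/funext => t; rewrite -conj_wave /wave mul1r mulN1r /expi.
by apply: complex_eq; rewrite !ReImE /=; lra.
Qed.

Hypothesis w0 : 0 < w.

(** One period of e^(i w t); half-open so that the translates tile the line. *)
Definition period_itv : set R := `[- (pi / w), pi / w[%classic.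

Lemma measurable_period_itv : measurable period_itv.
Proof. exact: measurable_itv. Qed.

(** Half-lines are cut out on one period by sign conditions on sine and cosine,
to which [approximable_sublevel] applies. *)
Lemma gt_angle_ge0 (a x : R) : 0 <= a < pi -> - pi <= x < pi ->
  (a < x) = (0 < sin x) && (cos x < cos a).
Proof.
move=> /andP[a0 api] /andP[xpi xpi'].
have [x0|x0] := leP x 0.
  rewrite (le_gtF (le_trans x0 a0)) (_ : 0 < sin x = false)//; apply/negbTE.
  by rewrite -leNgt -oppr_ge0 -sinN; apply: sin_ge0_pi; rewrite oppr_ge0 x0 lerNl.
by rewrite sin_gt0_pi ?x0//= ltr_cos// in_itv/= ?a0 ?(ltW x0) ltW.
Qed.

Lemma gt_angle_lt0 (a x : R) : - pi <= a < 0 -> - pi <= x < pi ->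
  (a < x) = (0 < sin x) || (cos a < cos x).
Proof.
move=> /andP[api a0] /andP[xpi xpi'].
have [x0|x0] := leP x 0; last first.
  by rewrite sin_gt0_pi ?x0// (lt_trans a0 x0).
rewrite (_ : 0 < sin x = false) ?orFb//; last first.
  apply/negbTE.
  by rewrite -leNgt -oppr_ge0 -sinN; apply: sin_ge0_pi; rewrite oppr_ge0 x0 lerNl.
rewrite -(cosN a) -(cosN x) ltr_cos ?ltrN2// in_itv/= oppr_ge0 ?x0 ?(ltW a0)/= lerNl//.
Qed.

(** Borel sets are generated by the half-lines ]a, +oo[, and only the part of
such a half-line inside the period matters, where it is described by sublevel
sets of sine and cosine. *)
Lemma trig_approximable (g : R -> R) (E : set R) : (forall x, 0 <= g x) ->
  lebesgue_measure.-integrable period_itv (EFin \o g) -> measurable E ->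
  approximable lebesgue_measure period_itv g real_trig_poly E.
Proof.
move=> g0 ig.
have sig := @sigma_algebra_approximable _ (measurableTypeR R) R lebesgue_measure period_itv g measurable_period_itv g0 ig _ real_trig_algebra.
have sub q c := @approximable_sublevel _ (measurableTypeR R) R lebesgue_measure period_itv g measurable_period_itv g0 ig _ q c real_trig_algebra.
have [S0 SC SU] := sig.
have SI A B : approximable lebesgue_measure period_itv g real_trig_poly A ->
    approximable lebesgue_measure period_itv g real_trig_poly B ->
    approximable lebesgue_measure period_itv g real_trig_poly (A `&` B).
  exact: (@approximableI _ (measurableTypeR R) R lebesgue_measure period_itv g measurable_period_itv g0 ig _ _ _ real_trig_algebra).
have SN A : approximable lebesgue_measure period_itv g real_trig_poly A ->
    approximable lebesgue_measure period_itv g real_trig_poly (~` A).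
  by rewrite -setTD; exact: SC.
have loc A B : approximable lebesgue_measure period_itv g real_trig_poly A ->
    measurable B -> (forall x, period_itv x -> A x <-> B x) ->
    approximable lebesgue_measure period_itv g real_trig_poly B.
  move=> [mA hA] mB AB; split=> // e e0; have [p [Tp p01 pe]] := hA _ e0.
  exists p; split=> //; rewrite (eq_integral (fun x => (`|\1_A x - p x| * g x)%:E))// => x.
  rewrite inE => Dx; congr (`|_ - _| * _)%:E; rewrite !indicE; congr (nat_of_bool _)%:R.
  by apply/idP/idP; rewrite !inE; apply AB.
have [Am Ac AD AM] := real_trig_algebra.
have sinp : approximable lebesgue_measure period_itv g real_trig_poly [set x | 0 < sin (w * x)].
  apply: (loc [set x | -1 * sin (w * x) < 0]).
  - apply: sub; rewrite ?normr0//; last by move=> x; rewrite mulN1r normrN sin_max.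
    by apply: (AM (fun=> -1)); [exact: Ac|exact: real_trig_sin].
  - rewrite (_ : [set _ | _] = setT `&` ((fun x => sin (w * x)) @^-1` `]0, +oo[%classic)); last first.
      by rewrite setTI; apply/seteqP; split => x /=; rewrite in_itv/= andbT.
    exact: (Am _ real_trig_sin).
  - by move=> x _ /=; rewrite mulN1r oppr_lt0.
have cosl c : `|c| <= 1 -> approximable lebesgue_measure period_itv g real_trig_poly [set x | cos (w * x) < c].
  by move=> c1; apply: sub => //; [exact: real_trig_cos|move=> x; exact: cos_max].
have cosg c : `|c| <= 1 -> approximable lebesgue_measure period_itv g real_trig_poly [set x | c < cos (w * x)].
  move=> c1; apply: (loc [set x | -1 * cos (w * x) < - c]).
  - apply: sub; rewrite ?normrN//; last by move=> x; rewrite mulN1r normrN cos_max.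
    by apply: (AM (fun=> -1)); [exact: Ac|exact: real_trig_cos].
  - rewrite (_ : [set _ | _] = setT `&` ((fun x => cos (w * x)) @^-1` `]c, +oo[%classic)); last first.
      by rewrite setTI; apply/seteqP; split => x /=; rewrite in_itv/= andbT.
    exact: (Am _ real_trig_cos).
  - by move=> x _ /=; rewrite mulN1r ltrN2.
have wx x : period_itv x -> - pi <= w * x < pi.
  by rewrite /period_itv/= in_itv/= -mulNr ler_pdivrMr// ltr_pdivlMr// [x * w]mulrC.
suff G : @RGenOInfty.G R `<=` approximable lebesgue_measure period_itv g real_trig_poly.
  move=> mE; have := mE; rewrite [X in X E -> _](RGenOInfty.measurableE R).
  by move: E {mE}; apply: smallest_sub.
move=> _ [a ->].
have mI : measurable (`]a, +oo[%classic : set R) by exact: measurable_itv.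
have wlt x : (a < x) = (w * a < w * x) by rewrite ltr_pM2l.
have [api|api] := leP pi (w * a).
  apply: (loc set0) => // x /wx /andP[_ xpi]; split => //=.
  by rewrite in_itv/= andbT wlt => /lt_trans/(_ xpi)/(le_lt_trans api); rewrite ltxx.
have [api'|api'] := ltP (w * a) (- pi).
  apply: (loc (~` set0)) => //; first exact: SN.
  by move=> x /wx /andP[xpi _]; split; [move=> _ /=; rewrite in_itv/= andbT wlt (lt_le_trans api')|move=> _ []].
have [a0|a0] := leP 0 (w * a).
  apply: (loc ([set x | 0 < sin (w * x)] `&` [set x | cos (w * x) < cos (w * a)])) => //.
    by apply: SI => //; apply: cosl; exact: cos_max.
  move=> x /wx xpi /=; rewrite in_itv/= andbT wlt (@gt_angle_ge0 (w * a))// ?a0//.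
  by split => [[-> ->]//|/andP].
apply: (loc (~` (~` [set x | 0 < sin (w * x)] `&` ~` [set x | cos (w * a) < cos (w * x)]))) => //.
  by apply/SN/SI; apply/SN => //; apply: cosg; exact: cos_max.
move=> x /wx xpi /=; rewrite in_itv/= andbT wlt (@gt_angle_lt0 (w * a))// ?api'//.
split=> [/not_andP[/contrapT ->//|/contrapT ->]|/orP h [h1 h2]]; first by rewrite orbT.
by case: h.
Qed.

End trigonometric_polynomials.

(** * Complex integrals and uniqueness of Fourier coefficients *)

Section complex_integral.
Context {R : realType}.
Implicit Types (D : set R) (f g : R -> R[i]).
Local Notation mu := (@lebesgue_measure R).

Definition cintegrable D f :=
  mu.-integrable D (fun x => (Re (f x))%:E) /\
  mu.-integrable D (fun x => (Im (f x))%:E).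

Lemma eq_integralC D f g : (forall x, D x -> f x = g x) ->
  integralC D f = integralC D g.
Proof.
by move=> fg; rewrite /integralC; congr (_ +i* _); apply: eq_Rintegral => x /set_mem Dx;
  rewrite fg.
Qed.

Lemma cintegrable_le D f (g : R -> R) : measurable D -> cmeasurable_fun f ->
  mu.-integrable D (EFin \o g) -> (forall x, D x -> normc (f x) <= g x) ->
  cintegrable D f.
Proof.
move=> mD [rf jf] ig fg; split; apply: (@le_integrable _ _ _ mu D mD _ (EFin \o g)) => //.
- by apply/measurable_EFinP; exact: measurable_funTS.
- move=> x Dx /=; rewrite lee_fin (le_trans (normc_Re _))// (le_trans (fg _ Dx))//.
  exact: ler_norm.
- by apply/measurable_EFinP; exact: measurable_funTS.
- move=> x Dx /=; rewrite lee_fin (le_trans (normc_Im _))// (le_trans (fg _ Dx))//.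
  exact: ler_norm.
Qed.

Section linearity.
Variables (D : set R) (mD : measurable D).

Lemma cintegrableD f g : cintegrable D f -> cintegrable D g ->
  cintegrable D (fun x => f x + g x).
Proof.
move=> [rf jf] [rg jg]; split.
  by under eq_fun do rewrite Re_addc EFinD; exact: integrableD.
by under eq_fun do rewrite Im_addc EFinD; exact: integrableD.
Qed.

Lemma integralCD f g : cintegrable D f -> cintegrable D g ->
  integralC D (fun x => f x + g x) = integralC D f + integralC D g.
Proof.
move=> [rf jf] [rg jg]; apply: complex_eq; rewrite !ReImE /=.
  by under eq_Rintegral do rewrite Re_addc; rewrite RintegralD.
by under eq_Rintegral do rewrite Im_addc; rewrite RintegralD.
Qed.

Lemma cintegrableZ (c : R[i]) f : cintegrable D f -> cintegrable D (fun x => c * f x).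
Proof.
move=> [rf jf]; split.
  under eq_fun do rewrite Re_mulc EFinB !EFinM.
  by apply: integrableB => //; exact: integrableZl.
under eq_fun do rewrite Im_mulc EFinD !EFinM.
by apply: integrableD => //; exact: integrableZl.
Qed.

Lemma integralCZ (c : R[i]) f : cintegrable D f ->
  integralC D (fun x => c * f x) = c * integralC D f.
Proof.
move=> [rf jf].
have ir (a : R) : mu.-integrable D (EFin \o (fun x => a * Re (f x))).
  apply: (@eq_integrable _ _ _ mu D mD (fun x => a%:E * (Re (f x))%:E)%E) => //.
  exact: integrableZl.
have ij (a : R) : mu.-integrable D (EFin \o (fun x => a * Im (f x))).
  apply: (@eq_integrable _ _ _ mu D mD (fun x => a%:E * (Im (f x))%:E)%E) => //.
  exact: integrableZl.
apply: complex_eq; rewrite !ReImE /=.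
  under eq_Rintegral do rewrite Re_mulc.
  by rewrite RintegralB// ?RintegralZl.
under eq_Rintegral do rewrite Im_mulc.
by rewrite RintegralD// ?RintegralZl.
Qed.

Lemma cintegrableN f : cintegrable D f -> cintegrable D (fun x => - f x).
Proof. by move=> fi; under eq_fun do rewrite -mulN1r; exact: cintegrableZ. Qed.

Lemma cintegrableB f g : cintegrable D f -> cintegrable D g ->
  cintegrable D (fun x => f x - g x).
Proof. by move=> fi gi; apply: cintegrableD => //; exact: cintegrableN. Qed.

Lemma integralCB f g : cintegrable D f -> cintegrable D g ->
  integralC D (fun x => f x - g x) = integralC D f - integralC D g.
Proof.
move=> fi gi; rewrite integralCD//; last exact: cintegrableN.
congr (_ + _); under eq_integralC do rewrite -mulN1r.
by rewrite integralCZ// mulN1r.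
Qed.

End linearity.

Lemma integralC_mkcond D f : integralC D f = integralC setT (fun x => (\1_D x)%:C * f x).
Proof.
rewrite /integralC; congr (_ +i* _); rewrite Rintegral_mkcond; apply: eq_Rintegral => x _;
  rewrite ReImE /= patchE indicE; case: ifPn => _ /=;
  by rewrite ?mul1r ?mul0r ?subr0 ?addr0.
Qed.

End complex_integral.

Lemma ae_lebesgueS2 {R : realType} (P Q S : R -> Prop) :
  (forall x, P x -> Q x -> S x) ->
  {ae @lebesgue_measure R, forall x, P x} -> {ae @lebesgue_measure R, forall x, Q x} ->
  {ae @lebesgue_measure R, forall x, S x}.
Proof. exact: (@filterS2 _ _ (@ae_filter_ringOfSetsType _ (measurableTypeR R) R lebesgue_measure)). Qed.

Section fourier_uniqueness.
Context {R : realType}.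
Variable w : R.
Hypothesis w0 : 0 < w.
Local Notation mu := (@lebesgue_measure R).
Local Notation D := (period_itv w).
Let mD : measurable D := measurable_period_itv w.

(** The integral of f over a Borel set E is the limit of integrals of f against
trigonometric polynomials that approximate the indicator of E in the mean
weighted by the absolute value of f, so it vanishes for every E. *)
Lemma real_fourier_uniqueness (f : R -> R) :
  mu.-integrable D (EFin \o f) ->
  (forall p, real_trig_poly w p -> \int[mu]_(x in D) (f x * p x) = 0) ->
  {ae mu, forall x, D x -> f x = 0}.
Proof.
move=> fi fp.
have mf : measurable_fun D f by apply/measurable_EFinP; exact: (measurable_int mu fi).
have fp_int (p : R -> R) : measurable_fun setT p -> (exists C, forall x, `|p x| <= C) ->
    mu.-integrable D (fun x => (f x * p x)%:E).
  move=> mp [C pC]; apply: (@le_integrable _ _ _ mu D mD _ (fun x => (C%:E * (`|f x|)%:E)%E)).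
  - by apply/measurable_EFinP/measurable_funM => //; exact: measurable_funTS.
  - move=> x Dx; rewrite -EFinM !abse_EFin lee_fin normrM normrM normr_id.
    by rewrite mulrC ler_wpM2r// (le_trans (pC x))// ler_norm.
  - by apply: integrableZl => //; exact: integrable_norm.
(* A function whose integrals over all Borel sets vanish is null. *)
suff h E : measurable E -> \int[mu]_(x in D) (f x * \1_E x) = 0.
  have : ae_eq mu D (EFin \o f) (cst 0%E).
    apply: integral_ae_eq => // E ED mE; rewrite integral0.
    have fE : mu.-integrable E (EFin \o f) by exact: integrableS ED fi.
    rewrite -[LHS]fineK; last exact: integrable_fin_num.
    congr EFin; rewrite -(h _ mE) -/(Rintegral mu E f).
    rewrite [LHS]Rintegral_mkcond [RHS]Rintegral_mkcond; apply: eq_Rintegral => x _.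
    rewrite /= !patchE indicE; case: (boolP (x \in E)) => [xE|_].
      by rewrite mem_set ?mulr1//; apply: ED; exact: set_mem.
    by rewrite mulr0 if_same.
  by apply: filterS => x /= h' /h' [].
move=> mE; apply/eqP; rewrite -normr_le0; apply/ler_addgt0Pl => e e0; rewrite addr0.
have in_ : mu.-integrable D (EFin \o (fun x => `|f x|)) by exact: integrable_norm.
have [_ /(_ _ e0)[p [Tp p01 pe]]] := trig_approximable w0 (fun x => normr_ge0 (f x)) in_ mE.
have mp : measurable_fun setT p by have [] := cmeasurable_trig Tp.
have mi : measurable_fun setT (\1_E : R -> R) by exact: measurable_indic.
have b1 : exists C : R, forall x, `|p x| <= C.
  by exists 1 => x; have /andP[? ?] := p01 x; rewrite ger0_norm.
have b2 : exists C : R, forall x : R, `|\1_E x| <= C.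
  by exists 1 => x; rewrite indicE; case: (_ \in _); rewrite ?normr1 ?normr0.
have b3 : exists C : R, forall x : R, `|\1_E x - p x| <= C.
  have [C1 h1] := b1; have [C2 h2] := b2; exists (C2 + C1) => x.
  by rewrite (le_trans (ler_normB _ _))// lerD.
have mB : measurable_fun setT (fun x => \1_E x - p x) by exact: measurable_funB.
rewrite -[X in `|X|]subr0 -(fp _ Tp) -RintegralB//; [|exact: fp_int|exact: fp_int].
under eq_Rintegral do rewrite -mulrBr.
have i3 := fp_int _ mB b3.
have := @le_normr_Rintegral _ (measurableTypeR R) R mu D _ mD i3.
move/le_trans; apply.
rewrite -lee_fin /Rintegral fineK; last first.
  by apply: integrable_fin_num => //; exact: (integrable_norm i3).
apply: (le_trans _ (ltW pe)); rewrite le_eqVlt; apply/orP; left; apply/eqP.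
by apply: eq_integral => x _; rewrite normrM mulrC.
Qed.

(** The hypothesis extends by linearity to all trigonometric polynomials; testing
against those with real values separates real and imaginary parts. *)
Lemma fourier_uniqueness (F : R -> R[i]) : cmeasurable_fun F -> cintegrable D F ->
  (forall k, integralC D (fun x => F x * wave w k x) = 0) ->
  {ae mu, forall x, D x -> F x = 0}.
Proof.
move=> mF iF Fw.
have iFp p : trig_poly w p -> cintegrable D (fun x => F x * p x) /\
    integralC D (fun x => F x * p x) = 0.
  elim=> [k|q r _ [iq q0] _ [ir r0]|c q _ [iq q0]].
  - split => //; have inF : mu.-integrable D (EFin \o (fun x => `|Re (F x)| + `|Im (F x)|)).
      have [h1 h2] := iF; under [X in integrable _ _ X]eq_fun do rewrite /= EFinD.
      by apply: integrableD => //; exact: integrable_norm.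
    apply: (cintegrable_le mD _ inF); first by apply: cmeasurableM => //; exact: cmeasurable_wave.
    by move=> x _; rewrite Normc.normcM normc_wave mulr1 normc_le_ReIm.
  - under eq_fun do rewrite mulrDr; split; first exact: cintegrableD.
    by rewrite integralCD// q0 r0 addr0.
  - under eq_fun do rewrite mulrCA; split; first exact: cintegrableZ.
    by rewrite integralCZ// q0 mulr0.
have [ir ij] := iF.
have hr : {ae mu, forall x, D x -> Re (F x) = 0}.
  apply: real_fourier_uniqueness => // p /iFp[_ [+ _]].
  by move=> <-; apply: eq_Rintegral => x _; rewrite Re_mulc /= mulr0 subr0.
have hj : {ae mu, forall x, D x -> Im (F x) = 0}.
  apply: real_fourier_uniqueness => // p /iFp[_ [_ +]].
  by move=> <-; apply: eq_Rintegral => x _; rewrite Im_mulc /= mulr0 add0r.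
by apply: (ae_lebesgueS2 _ hr hj) => x h1 h2 Dx; apply: complex_eq; [rewrite h1|rewrite h2].
Qed.

End fourier_uniqueness.

(** * Density of trigonometric polynomials in L2 *)

Section trigonometric_density.
Context {R : realType}.
Variable w : R.
Hypothesis w0 : 0 < w.
Local Notation mu := (@lebesgue_measure R).
Local Notation D := (period_itv w).
Let mD : measurable D := measurable_period_itv w.

Lemma lebesgue_measure_period_itv : mu D = (2 * (pi / w))%:E.
Proof.
have p0 : 0 < pi / w by rewrite divr_gt0// pi_gt0.
rewrite /period_itv lebesgue_measure_itv/= lte_fin gtrN// -EFinB; congr EFin; ring.
Qed.

Lemma integrable_period_cst (c : R) : mu.-integrable D (EFin \o (fun=> c)).
Proof.
apply/integrableP; split; first exact: measurable_cst.
rewrite (_ : (fun _ => _) = cst `|c%:E|%E)//.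
by rewrite integral_cst// [X in (_ * X)%E]lebesgue_measure_period_itv -EFinM ltry.
Qed.

Let sqint (f : R -> R) : \bar R := (\int[mu]_(x in D) (f x ^+ 2)%:E)%E.

Let msq (f : R -> R) : measurable_fun setT f ->
  measurable_fun D (fun x => (f x ^+ 2)%:E).
Proof. by move=> mf; apply/measurable_EFinP/measurable_funX; exact: measurable_funTS. Qed.

Let sqint_add_lt (u a b : R -> R) (e1 e2 : R) :
  measurable_fun setT u -> measurable_fun setT a -> measurable_fun setT b ->
  (forall x, u x = a x + b x) ->
  (sqint a < e1%:E)%E -> (sqint b < e2%:E)%E -> (sqint u < (2 * e1 + 2 * e2)%:E)%E.
Proof.
move=> mu_ ma mb uab h1 h2.
have sc (c : R -> R) (e : R) : measurable_fun setT c -> (sqint c < e%:E)%E ->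
    (\int[mu]_(x in D) (2%:E * (c x ^+ 2)%:E) < (2 * e)%:E)%E.
  move=> mc h; rewrite ge0_integralZl//; last 2 first.
  - exact: msq.
  - by move=> x _; rewrite lee_fin sqr_ge0.
  by rewrite EFinM lte_pmul2l.
rewrite EFinD; apply: le_lt_trans (lteD (sc _ _ ma h1) (sc _ _ mb h2)).
rewrite -ge0_integralD//; last 4 first.
- by move=> x _; rewrite -EFinM lee_fin mulr_ge0// sqr_ge0.
- by apply: measurable_funeM; exact: msq.
- by move=> x _; rewrite -EFinM lee_fin mulr_ge0// sqr_ge0.
- by apply: measurable_funeM; exact: msq.
apply: ge0_le_integral => //.
- by move=> x _; rewrite lee_fin sqr_ge0.
- exact: msq.
- by apply: emeasurable_funD; apply: measurable_funeM; exact: msq.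
move=> x _; rewrite -!EFinM -EFinD lee_fin uab -subr_ge0.
by rewrite (_ : _ - _ = (a x - b x) ^+ 2) ?sqr_ge0//; ring.
Qed.

Let real_approx (f : R -> R) := measurable_fun setT f /\
  forall e : R, 0 < e -> exists2 p, real_trig_poly w p & (sqint (fun x => f x - p x)%R < e%:E)%E.

Let mtrig p : real_trig_poly w p -> measurable_fun setT p.
Proof. by move=> /cmeasurable_trig[]. Qed.

Let real_approxD f g : real_approx f -> real_approx g -> real_approx (fun x => f x + g x).
Proof.
move=> [mf hf] [mg hg]; split=> [|e e0]; first exact: measurable_funD.
have e4 : 0 < e / 4 by rewrite divr_gt0.
have [p Tp pe] := hf _ e4; have [q Tq qe] := hg _ e4.
have [_ _ AD _] := real_trig_algebra w.
exists (fun x => p x + q x); first exact: AD.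
rewrite (_ : e = 2 * (e / 4) + 2 * (e / 4)); last by field.
have mp := mtrig Tp; have mq := mtrig Tq.
apply: sqint_add_lt pe qe => [| | |x]; last by ring.
- by apply: measurable_funB; exact: measurable_funD.
- exact: measurable_funB.
- exact: measurable_funB.
Qed.

Let real_approxZ c f : real_approx f -> real_approx (fun x => c * f x).
Proof.
move=> [mf hf]; split=> [|e e0]; first exact: measurable_funM.
have c0 : 0 < c ^+ 2 + 1 by rewrite ltr_wpDl// sqr_ge0.
have ec : 0 < e / (c ^+ 2 + 1) by rewrite divr_gt0.
have [p Tp pe] := hf _ ec; have [_ Ac _ AM] := real_trig_algebra w.
exists (fun x => c * p x); first by apply: (AM (fun=> c)).
have mp := mtrig Tp.
have mfp : measurable_fun setT (fun x => f x - p x) by exact: measurable_funB.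
apply: (@le_lt_trans _ _ ((c ^+ 2)%:E * sqint (fun x => f x - p x)%R)%E).
  rewrite -ge0_integralZl ?lee_fin ?sqr_ge0//.
  - apply: ge0_le_integral => //.
    + by move=> x _; rewrite lee_fin sqr_ge0.
    + apply: msq; apply: measurable_funB; exact: measurable_funM.
    + by apply: measurable_funeM; exact: msq.
    by move=> x _; rewrite -EFinM lee_fin -mulrBr exprMn.
  - exact: msq.
  - by move=> x _; rewrite lee_fin sqr_ge0.
have s0 : (0 <= sqint (fun x => f x - p x)%R)%E.
  by apply: integral_ge0 => x _; rewrite lee_fin sqr_ge0.
have fs : sqint (fun x => f x - p x)%R \is a fin_num.
  by rewrite ge0_fin_numE// (lt_trans pe)// ltry.
move: pe s0; rewrite -(fineK fs) -EFinM !lte_fin lee_fin; set s := fine _ => pe s0.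
move: pe; rewrite ltr_pdivlMr// => pe; apply: le_lt_trans pe.
by rewrite mulrC ler_wpM2l// lerDl.
Qed.

Let real_approx_indic E : measurable E -> real_approx (\1_E).
Proof.
move=> mE; split=> [|e e0]; first exact: measurable_indic.
have i1 : mu.-integrable D (EFin \o (fun=> 1 : R)).
  exact: integrable_period_cst.
have [_ /(_ _ e0)[p [Tp p01 pe]]] := trig_approximable w0 (fun=> ler01) i1 mE.
exists p => //; apply: le_lt_trans pe; apply: ge0_le_integral => //.
- by move=> x _; rewrite lee_fin sqr_ge0.
- apply: msq; apply: measurable_funB => //; last exact: mtrig.
- apply/measurable_EFinP; apply: measurable_funM => //; apply: measurableT_comp => //.
  by apply: measurable_funB; [exact: measurable_indic|apply: measurable_funTS; exact: mtrig].
move=> x _; rewrite lee_fin mulr1 -[leLHS]real_normK ?num_real// expr2 ler_piMl//.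
have /andP[p0 p1] := p01 x; rewrite indicE; case: (x \in E) => /=.
  by rewrite ger0_norm ?subr_ge0// lerBlDr lerDl.
by rewrite sub0r normrN ger0_norm.
Qed.

Import HBNNSimple.

Let real_approx_nnsfun (s : {nnsfun measurableTypeR R >-> R}) : real_approx s.
Proof.
rewrite (_ : (s : R -> R) = (fun x => \sum_(y \in range s) y * \1_(s @^-1` [set y]) x)); last first.
  by apply/funext => x; rewrite fimfunE.
under eq_fun do rewrite fsbig_finite//.
move: (finmap.enum_fset _) => r; elim: r => [|y r IH].
  under eq_fun do rewrite big_nil.
  have := @real_approxZ 0 _ (real_approx_indic measurable0).
  by under eq_fun do rewrite mul0r.
under eq_fun do rewrite big_cons.
apply: real_approxD => //; apply: real_approxZ; apply: real_approx_indic.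
rewrite -[X in measurable X]setTI; exact: (measurable_funP s).
Qed.

Let real_approx_ge0 (f : R -> R) : measurable_fun setT f -> (forall x, 0 <= f x) ->
  mu.-integrable D (fun x => (f x ^+ 2)%:E) -> real_approx f.
Proof.
move=> mf f0 if2; split=> // e e0.
have mfe : measurable_fun setT (EFin \o f) by exact/measurable_EFinP.
pose s := @nnsfun_approx _ (measurableTypeR R) R setT measurableT (EFin \o f) mfe.
have ms n : measurable_fun setT (s n : R -> R) by exact: (measurable_funP (s n)).
have sf n x : 0 <= s n x <= f x.
  apply/andP; split; first exact: fun_ge0.
  rewrite /s nnsfun_approxE -lee_fin.
  by have /= := @le_approx _ (measurableTypeR R) R setT (EFin \o f) n x (fun x _ => f0 x) I.
have : (sqint (fun x => f x - s n x)%R @[n --> \oo] --> 0)%E.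
  have [|||||_ _] := @dominated_convergence _ _ _ mu D mD
     (fun n x => ((f x - s n x) ^+ 2)%:E) (cst 0%E) (fun x => (f x ^+ 2)%:E).
  - by move=> n; apply: msq; exact: measurable_funB.
  - exact: measurable_cst.
  - apply: aeW => x Dx.
    have sx : s n x @[n --> \oo] --> f x.
      have := @cvg_nnsfun_approx _ (measurableTypeR R) R setT measurableT (EFin \o f) mfe _ x I.
      by move=> /(_ (fun x _ => f0 x)) /fine_cvgP[].
    apply: cvg_EFin; first exact: nearW.
    rewrite [X in X @ _ --> _](_ : _ = (fun n => (f x - s n x) * (f x - s n x))) //.
    rewrite -[X in _ --> X](mul0r 0) -(subrr (f x)).
    by apply: cvgM; apply: cvgB => //; exact: cvg_cst.
  - exact: if2.
  - apply: aeW => x n Dx; have /andP[s0 s1] := sf n x; rewrite abse_EFin lee_fin ger0_norm ?sqr_ge0//.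
    by rewrite ler_pXn2r ?nnegrE ?subr_ge0// lerBlDr lerDl.
  by rewrite integral0.
have e4 : 0 < e / 4 by rewrite divr_gt0.
move=> /fine_cvgP[fin /cvgrPdist_lt /(_ _ e4) h].
near \oo => n.
have fn : (sqint (fun x => f x - s n x)%R) \is a fin_num by near: n.
have sn : (sqint (fun x => f x - s n x)%R < (e / 4)%:E)%E.
  rewrite -(fineK fn) lte_fin.
  have : `|0 - fine (sqint (fun x => f x - s n x)%R)| < e / 4 by near: n.
  rewrite sub0r normrN ger0_norm// fine_ge0// integral_ge0// => x _.
  by rewrite lee_fin sqr_ge0.
have [_ /(_ _ e4)[p Tp pe]] := real_approx_nnsfun (s n).
exists p => //; rewrite (_ : e = 2 * (e / 4) + 2 * (e / 4)); last by field.
have mp := mtrig Tp.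
apply: sqint_add_lt sn pe => [| | |x]; last by ring.
- exact: measurable_funB.
- exact: measurable_funB.
- exact: measurable_funB.
Unshelve. all: by end_near. Qed.

Let real_approx_sqint (f : R -> R) : measurable_fun setT f ->
  mu.-integrable D (fun x => (f x ^+ 2)%:E) -> real_approx f.
Proof.
move=> mf if2.
rewrite (_ : f = fun x => f^\+ x + -1 * f^\- x); last first.
  by apply/funext => x; rewrite mulN1r -{1}[f]funrposBneg.
have pn (g : R -> R) : measurable_fun setT g -> (forall x, 0 <= g x <= `|f x|) -> real_approx g.
  move=> mg gf; apply: real_approx_ge0 => //; first by move=> x; have /andP[] := gf x.
  apply: (@le_integrable _ _ _ mu D mD _ (fun x => (f x ^+ 2)%:E)) => //; first exact: msq.
  move=> x _; have /andP[g0 g1] := gf x; rewrite !abse_EFin lee_fin !ger0_norm ?sqr_ge0//.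
  by rewrite -[leRHS]real_normK ?num_real// ler_pXn2r ?nnegrE.
apply: real_approxD; last apply: real_approxZ; apply: pn.
- exact: measurable_funrpos.
- move=> x; rewrite /funrpos le_max lexx orbT/= ge_max normr_ge0 andbT; exact: ler_norm.
- exact: measurable_funrneg.
- move=> x; rewrite /funrneg le_max lexx orbT/= ge_max normr_ge0 andbT -normrN; exact: ler_norm.
Qed.

(** Indicators are approximable, hence simple functions, hence square integrable
ones. *)
Lemma trig_dense (F : R -> R[i]) (e : R) : cmeasurable_fun F ->
  mu.-integrable D (fun x => (normc (F x) ^+ 2)%:E) -> 0 < e ->
  exists2 p, trig_poly w p & (\int[mu]_(x in D) (normc (F x - p x) ^+ 2)%:E < e%:E)%E.
Proof.
move=> [rF jF] iF e0; have e2 : 0 < e / 2 by rewrite divr_gt0.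
have part (g : R -> R) : measurable_fun setT g -> (forall x, `|g x| <= normc (F x)) -> real_approx g.
  move=> mg gF; apply: real_approx_sqint => //.
  apply: (@le_integrable _ _ _ mu D mD _ (fun x => (normc (F x) ^+ 2)%:E)) => //; first exact: msq.
  move=> x _; rewrite !abse_EFin lee_fin !ger0_norm ?sqr_ge0//.
  by rewrite -[leLHS]real_normK ?num_real// ler_pXn2r ?nnegrE ?normc_ge0.
have [_ /(_ _ e2)[p Tp pe]] := part _ rF (fun x => normc_Re _).
have [_ /(_ _ e2)[q Tq qe]] := part _ jF (fun x => normc_Im _).
exists (fun x => (p x)%:C + 'i%C * (q x)%:C).
  by apply: trig_add => //; exact: trig_scale.
have mp := mtrig Tp; have mq := mtrig Tq.
rewrite [e]splitr EFinD; apply: le_lt_trans (lteD pe qe).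
rewrite -ge0_integralD//; last 4 first.
- by move=> x _; rewrite lee_fin sqr_ge0.
- by apply: msq; exact: measurable_funB.
- by move=> x _; rewrite lee_fin sqr_ge0.
- by apply: msq; exact: measurable_funB.
rewrite le_eqVlt; apply/orP; left; apply/eqP; apply: eq_integral => x _.
rewrite -EFinD; congr EFin; rewrite sqr_normcE !ReImE /=; ring.
Qed.

End trigonometric_density.

(** * Parseval's identity *)

Section symmetric_range.

(** A list of integers rather than a shifted range, so that partial sums can be
compared through membership. *)
Definition zrange (n : nat) : seq int := [seq (i%:Z - n%:Z)%R | i <- iota 0 n.*2.+1].

Lemma uniq_zrange n : uniq (zrange n).
Proof. by rewrite map_inj_uniq ?iota_uniq// => i j /(addIr _) []. Qed.

Lemma mem_zrange n k : (k \in zrange n) = (`|k| <= n)%N.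
Proof.
apply/mapP/idP => [[j] | kn].
  by rewrite mem_iota add0n => /andP[_ j2n] ->; lia.
exists (absz (k + n%:Z)); last by lia.
by rewrite mem_iota add0n /=; lia.
Qed.

Lemma big_zrange (V : nmodType) (u : int -> V) n :
  \sum_(k < n.*2.+1) u (k%:Z - n%:Z) = \sum_(k <- zrange n) u k.
Proof. by rewrite big_map -[iota 0 _]/(index_iota 0 n.*2.+1) big_mkord. Qed.

Lemma zrange_widen (V : nmodType) (u : int -> V) m n : (m <= n)%N ->
  \sum_(k <- zrange m) u k = \sum_(k <- zrange n | k \in zrange m) u k.
Proof.
move=> mn; rewrite -[RHS]big_filter; apply: perm_big; apply: uniq_perm.
- exact: uniq_zrange.
- by rewrite filter_uniq// uniq_zrange.
- move=> k; rewrite mem_filter !mem_zrange; lia.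
Qed.

Lemma zrange_sum_le (R : numDomainType) (u : int -> R) m n :
  (forall k, 0 <= u k) -> (m <= n)%N ->
  \sum_(k <- zrange m) u k <= \sum_(k <- zrange n) u k.
Proof.
move=> u0 mn; rewrite (zrange_widen _ mn) [leRHS](bigID (mem (zrange m)))/= lerDl.
by apply: sumr_ge0.
Qed.

End symmetric_range.

Section parseval.
Context {R : realType}.
Variable w : R.
Hypothesis w0 : 0 < w.
Local Notation mu := (@lebesgue_measure R).
Local Notation D := (period_itv w).
Local Notation L := (2 * (pi / w)).
Let mD : measurable D := measurable_period_itv w.

Lemma period_gt0 : 0 < L.
Proof. by rewrite mulr_gt0// divr_gt0// pi_gt0. Qed.

(** For sines and cosines, whose primitives are periodic. *)
Lemma integral_derivative_periodic (f F : R -> R) : continuous f ->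
  (forall x, is_derive x (1 : R) F (f x)) -> F (- (pi / w)) = F (pi / w) ->
  \int[mu]_(x in D) f x = 0.
Proof.
move=> cf dF FF; rewrite /period_itv.
have ab : - (pi / w) < pi / w by rewrite gtrN// divr_gt0// pi_gt0.
rewrite Rintegral_itv_bndo_bndc; last first.
  apply: (@integrableS _ _ _ mu `[- (pi / w), pi / w]) => //.
    by apply: subset_itvl; rewrite bnd_simp.
  apply: continuous_compact_integrable; first exact: segment_compact.
  exact: continuous_subspaceT.
rewrite /Rintegral (@continuous_FTC2 _ f F)//.
- by rewrite FF subee.
- exact: continuous_subspaceT.
- have cF : continuous F.
    by move=> x; apply: differentiable_continuous; apply/derivable1_diffP; have [] := dF x.
  split => [x _||].
  + by have [] := dF x.
  + by apply: cvg_at_right_filter; exact: cF.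
  + by apply: cvg_at_left_filter; exact: cF.
- by move=> x _; rewrite derive1E; have [] := dF x.
Qed.

Lemma integral_wave k : integralC D (wave w k) = (if k == 0 then L else 0)%:C.
Proof.
have [->|k0] := eqVneq k 0.
  rewrite (@eq_integralC _ _ _ (fun=> 1)); last by move=> x _; rewrite wave0.
  apply: complex_eq => /=; rewrite Rintegral_cst// ?mul0r//.
  by rewrite mul1r [X in fine X](lebesgue_measure_period_itv w0).
pose c := k%:~R * w; have c0 : c != 0 by rewrite mulf_neq0 ?intr_eq0// gt_eqF.
have cb : c * (pi / w) = k%:~R * pi by rewrite /c mulrCA -mulrA divff ?mulr1 ?gt_eqF//; ring.
have s0 : sin (k%:~R * pi) = 0 :> R.
  have := @expi_2pi R k; rewrite (_ : 2 * _ * pi = k%:~R * pi *+ 2); last by ring.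
  rewrite /expi => -[+ _]; rewrite cos_mulr2n => h.
  have c1 : cos (k%:~R * pi) ^+ 2 = 1 :> R by move: h; rewrite mulr2n; lra.
  by apply/eqP; rewrite -sqrf_eq0 sin2cos2 c1 subrr.
have ccos : continuous (fun t => cos (c * t)).
  move=> x; apply: continuous_comp; first by apply: cvgM; [exact: cvg_cst|exact: cvg_id].
  exact: continuous_cos.
have csin : continuous (fun t => sin (c * t)).
  move=> x; apply: continuous_comp; first by apply: cvgM; [exact: cvg_cst|exact: cvg_id].
  exact: continuous_sin.
apply: complex_eq => /=.
- apply: (@integral_derivative_periodic _ (fun t => c^-1 * sin (c * t))) => //.
    move=> x; apply: is_derive_eq.
    by rewrite /GRing.scale/= mulr1 -/c; field.
  by rewrite mulrN sinN cb s0 oppr0.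
- apply: (@integral_derivative_periodic _ (fun t => - c^-1 * cos (c * t))) => //.
    move=> x; apply: is_derive_eq.
    by rewrite /GRing.scale/= mulr1 -/c; field.
  by rewrite mulrN cosN.
Qed.

Definition square_integrable (F : R -> R[i]) :=
  cmeasurable_fun F /\ mu.-integrable D (fun t => (normc (F t) ^+ 2)%:E).

Definition coef (F : R -> R[i]) (k : int) : R[i] :=
  integralC D (fun t => F t * wave w (- k) t).

Definition sqnorm (F : R -> R[i]) : R := \int[mu]_(t in D) (normc (F t) ^+ 2).

Lemma square_integrable_mul F (g : R -> R[i]) : square_integrable F ->
  cmeasurable_fun g -> (forall t, normc (g t) = 1) -> cintegrable D (fun t => F t * g t).
Proof.
move=> [mF iF] mg g1.
apply: (@cintegrable_le _ _ _ (fun t => 1 + normc (F t) ^+ 2)) => //.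
- exact: cmeasurableM.
- under [X in integrable _ _ X]eq_fun do rewrite /= EFinD.
  by apply: integrableD => //; exact: integrable_period_cst.
- move=> t _; rewrite Normc.normcM g1 mulr1 -subr_ge0.
  rewrite (_ : _ - _ = (normc (F t) - 2^-1) ^+ 2 + 3 / 4); last by field.
  by rewrite addr_ge0 ?sqr_ge0// divr_ge0.
Qed.

Lemma cintegrable_coef F k : square_integrable F ->
  cintegrable D (fun t => F t * wave w k t).
Proof.
move=> iF; apply: square_integrable_mul => //; first exact: cmeasurable_wave.
by move=> t; exact: normc_wave.
Qed.

Lemma square_integrable_wave (a : R[i]) k : square_integrable (fun t => a * wave w k t).
Proof.
split; first by apply: cmeasurableM; [exact: cmeasurable_cst|exact: cmeasurable_wave].
under eq_fun do rewrite Normc.normcM normc_wave mulr1.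
exact: integrable_period_cst.
Qed.

Lemma square_integrableB F G : square_integrable F -> square_integrable G ->
  square_integrable (fun t => F t - G t).
Proof.
move=> [mF iF] [mG iG]; split; first exact: cmeasurableB.
apply: (@le_integrable _ _ _ mu D mD _
  (fun t => (2 * normc (F t) ^+ 2)%:E + (2 * normc (G t) ^+ 2)%:E)%E).
- apply/measurable_EFinP; apply: measurable_funTS; apply: measurable_sqr_normc.
  exact: cmeasurableB.
- move=> t _; rewrite -EFinD !abse_EFin lee_fin !ger0_norm ?sqr_ge0//; last first.
    by rewrite addr_ge0// mulr_ge0// sqr_ge0.
  rewrite !sqr_normcE !ReImE -subr_ge0.
  rewrite (_ : _ - _ = (Re (F t) + Re (G t)) ^+ 2 + (Im (F t) + Im (G t)) ^+ 2); last by ring.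
  by rewrite addr_ge0 ?sqr_ge0.
- under eq_fun do rewrite !EFinM.
  by apply: integrableD => //; exact: integrableZl.
Qed.

Lemma coef_subr_wave F (a : R[i]) k j : square_integrable F ->
  coef (fun t => F t - a * wave w k t) j = coef F j - a * (if k == j then L else 0)%:C.
Proof.
move=> iF; rewrite /coef.
transitivity (integralC D (fun t => F t * wave w (- j) t - a * wave w (k - j) t)).
  by apply: eq_integralC => t _; rewrite mulrBl -mulrA -waveD.
have iw l : cintegrable D (fun t => wave w l t).
  have := cintegrable_coef l (square_integrable_wave 1 0).
  by under eq_fun do rewrite mul1r -waveD add0r.
rewrite integralCB//; [|exact: cintegrable_coef|exact: cintegrableZ].
by rewrite integralCZ// integral_wave subr_eq0.
Qed.

(** Completing the square in a: the error is smallest when a is the Fourier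
coefficient divided by the length of the period. *)
Lemma sqnorm_subr_wave F (a : R[i]) k : square_integrable F ->
  sqnorm (fun t => F t - a * wave w k t) =
  sqnorm F - L^-1 * normc (coef F k) ^+ 2 + L * normc (a - coef F k / L%:C) ^+ 2.
Proof.
move=> iF; have [mF iF2] := iF; have L0 := period_gt0.
transitivity (\int[mu]_(t in D) (normc (F t) ^+ 2 -
    2 * Re (a^* * (F t * wave w (- k) t)) + normc a ^+ 2)).
  apply: eq_Rintegral => t _; rewrite -conj_wave.
  have := normc_wave w k t; move/(congr1 (fun x => x ^+ 2)).
  rewrite expr1n !sqr_normcE !ReImE => w1.
  rewrite [X in _ = _ + X](_ : _ = (Re (wave w k t) ^+ 2 + Im (wave w k t) ^+ 2) *
    (Re a ^+ 2 + Im a ^+ 2)); last by rewrite w1 mul1r.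
  ring.
have [i1 _] := cintegrableZ mD a^* (cintegrable_coef (- k) iF).
have i2 : mu.-integrable D (EFin \o (fun t => 2 * Re (a^* * (F t * wave w (- k) t)))).
  apply: (@eq_integrable _ _ _ mu D mD (fun t => 2%:E * (Re (a^* * (F t * wave w (- k) t)))%:E)%E) => //.
  exact: integrableZl.
have i3 : mu.-integrable D (EFin \o (fun t => normc (F t) ^+ 2 - 2 * Re (a^* * (F t * wave w (- k) t)))).
  apply: (@eq_integrable _ _ _ mu D mD (fun t => (normc (F t) ^+ 2)%:E - (2 * Re (a^* * (F t * wave w (- k) t)))%:E)%E) => //.
  exact: integrableB.
rewrite RintegralD//; last exact: integrable_period_cst.
rewrite RintegralB// RintegralZl// Rintegral_cst// [X in fine X](lebesgue_measure_period_itv w0).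
have -> : \int[mu]_(t in D) Re (a^* * (F t * wave w (- k) t)) = Re (a^* * coef F k).
  by rewrite /coef -integralCZ//; exact: cintegrable_coef.
rewrite -/(sqnorm F) /fine !sqr_normcE -fmorphV !ReImE /=.
set u := (\int[mu]_(x in D) Re (F x * wave w (- k) x)).
set v := (\int[mu]_(x in D) Im (F x * wave w (- k) x)).
have L00 : L != 0 by rewrite gt_eqF.
move: L00; move: (L) => l l0; field.
exact: l0.
Qed.

(** Induction on the frequencies: subtracting one wave changes only the
coefficient at its own frequency. *)
Lemma bessel_identity (s : seq int) (a : int -> R[i]) F : uniq s -> square_integrable F ->
  sqnorm (fun t => F t - \sum_(k <- s) a k * wave w k t) =
  sqnorm F - L^-1 * (\sum_(k <- s) normc (coef F k) ^+ 2) +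
  L * (\sum_(k <- s) normc (a k - coef F k / L%:C) ^+ 2).
Proof.
elim: s F => [|k s IH] F /=.
  move=> _ _; rewrite !big_nil !mulr0 subr0 addr0; apply: eq_Rintegral => t _.
  by rewrite big_nil subr0.
move=> /andP[ks us] iF.
have iF' : square_integrable (fun t => F t - a k * wave w k t).
  by apply: square_integrableB => //; exact: square_integrable_wave.
have cF' j : j \in s -> coef (fun t => F t - a k * wave w k t) j = coef F j.
  move=> js; rewrite coef_subr_wave// ifN ?mulr0 ?subr0//.
  by apply: contraNN ks => /eqP ->.
transitivity (sqnorm (fun t => (F t - a k * wave w k t) - \sum_(j <- s) a j * wave w j t)).
  by apply: eq_Rintegral => t _; rewrite big_cons opprD addrA.
rewrite IH// sqnorm_subr_wave// !big_cons !mulrDr.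
rewrite (eq_big_seq (fun j => normc (coef F j) ^+ 2)); last by move=> j js; rewrite cF'.
rewrite [X in _ + L * X = _](eq_big_seq (fun j => normc (a j - coef F j / L%:C) ^+ 2)).
  move: (L^-1) (L) => l' l; move: (sqnorm F) (normc _ ^+ 2) (normc _ ^+ 2) => A b c.
  by move: (\sum_(i <- s) _) (\sum_(i <- s) _) => S T; ring.
by move=> j js; rewrite cF'.
Qed.

Lemma trig_polyE p : trig_poly w p ->
  exists n a, p = fun t => \sum_(k <- zrange n) a k * wave w k t.
Proof.
have widen m n (a : int -> R[i]) : (m <= n)%N -> exists b, forall t,
    \sum_(k <- zrange m) a k * wave w k t = \sum_(k <- zrange n) b k * wave w k t.
  move=> mn; exists (fun k => if k \in zrange m then a k else 0) => t.
  rewrite (zrange_widen _ mn) big_mkcond; apply: eq_bigr => k _.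
  by case: ifP => //; rewrite mul0r.
elim=> [k|q r _ [m [a ->]] _ [n [b ->]]|c q _ [n [a ->]]].
- exists `|k|%N, (fun j => (j == k)%:R); apply/funext => t.
  rewrite (bigD1_seq k) ?uniq_zrange ?mem_zrange//= eqxx mul1r big1 ?addr0// => j /negbTE ->.
  by rewrite mul0r.
- have [a' ha] := widen _ (maxn m n) a (leq_maxl _ _).
  have [b' hb] := widen _ (maxn m n) b (leq_maxr _ _).
  exists (maxn m n), (fun k => a' k + b' k); apply/funext => t.
  by rewrite ha hb -big_split; apply: eq_bigr => k _; rewrite mulrDl.
- exists n, (fun k => c * a k); apply/funext => t; rewrite mulr_sumr.
  by apply: eq_bigr => k _; rewrite mulrA.
Qed.

(** The partial sums are bounded by Bessel's inequality, the error of the best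
approximation being nonnegative.  A trigonometric polynomial close to F shows
that they come arbitrarily near the bound. *)
Lemma parseval F : square_integrable F ->
  (\sum_(k <- zrange n) normc (coef F k) ^+ 2) @[n --> \oo] --> L * sqnorm F.
Proof.
move=> iF; have L0 := period_gt0; have [mF iF2] := iF.
have ge0 n (a : int -> R[i]) : 0 <= \sum_(k <- zrange n) normc (a k) ^+ 2.
  by apply: sumr_ge0 => k _; exact: sqr_ge0.
(* Bessel's inequality, with the optimal coefficients. *)
have ub n : \sum_(k <- zrange n) normc (coef F k) ^+ 2 <= L * sqnorm F.
  have := bessel_identity (fun k => coef F k / L%:C) (uniq_zrange n) iF.
  rewrite [X in _ + L * X]big1 ?mulr0 ?addr0; last first.
    by move=> k _; rewrite subrr sqr_normcE expr0n addr0.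
  move=> h; rewrite -ler_pdivrMl// -subr_ge0 -h.
  by apply: Rintegral_ge0 => t _; exact: sqr_ge0.
apply/cvgrPdist_le => e e0.
have eL : 0 < e / L by rewrite divr_gt0.
have [p /trig_polyE[m [a ->]] pe] := trig_dense w0 mF iF2 eL.
have := bessel_identity a (uniq_zrange m) iF => h.
have lb : L * sqnorm F - e <= \sum_(k <- zrange m) normc (coef F k) ^+ 2.
  have : sqnorm (fun t => F t - \sum_(k <- zrange m) a k * wave w k t) <= e / L.
    rewrite -lee_fin /sqnorm /Rintegral fineK; first exact: ltW pe.
    rewrite ge0_fin_numE; first by rewrite (lt_trans pe)// ltry.
    by apply: integral_ge0 => t _; rewrite lee_fin sqr_ge0.
  rewrite h => {}h.
  have {h} : sqnorm F - L^-1 * (\sum_(k <- zrange m) normc (coef F k) ^+ 2) <= e / L.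
    apply: le_trans h; rewrite lerDl mulr_ge0// ltW//.
  set S := \sum_(k <- _) _.
  rewrite -(ler_pM2l L0) mulrBr.
  rewrite (mulVKf (lt0r_neq0 L0)) [_ * (e / _)]mulrC (divfK (lt0r_neq0 L0)).
  lra.
near=> n; rewrite ger0_norm ?subr_ge0//.
rewrite lerBlDr addrC -lerBlDr; apply: (le_trans lb); apply: zrange_sum_le.
  by move=> k; exact: sqr_ge0.
by near: n; exact: nbhs_infty_ge.
Unshelve. all: by end_near. Qed.

End parseval.

(** * Cutting the line into periods *)

Section null_sets.
Context {R : realType}.
Local Notation mu := (@lebesgue_measure R).

Lemma ae_lebesgueS (P Q : R -> Prop) : (forall x, P x -> Q x) ->
  {ae mu, forall x, P x} -> {ae mu, forall x, Q x}.
Proof. exact: (@filterS _ _ (@ae_filter_ringOfSetsType _ (measurableTypeR R) R mu)). Qed.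

Lemma ae_shift (P : R -> Prop) (a : R) : {ae mu, forall x, P x} ->
  {ae mu, forall x, P (x + a)}.
Proof.
move=> [N [mN N0 PN]]; exists ((fun x => x + a) @^-1` N); split.
- by rewrite -[X in measurable X]setTI; exact: (measurable_shift a).
- by have := lebesgue_measure_shift a mN; rewrite /pushforward N0.
- by move=> x /= nP; exact: (PN (x + a)).
Qed.

Lemma ae_scale (P : R -> Prop) (a : R) : 0 < a -> {ae mu, forall x, P x} ->
  {ae mu, forall x, P (a * x)}.
Proof.
move=> a0 [N [mN N0 PN]]; exists ((fun x => a * x) @^-1` N); split.
- by rewrite -[X in measurable X]setTI; exact: (measurable_mulr a).
- have := @lebesgue_measure_scale R (NngNum (ltW a0)) N a0 mN.
  rewrite N0 /= => /eqP; rewrite mule_eq0 => /orP[|/eqP//].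
  by rewrite eqe gt_eqF.
- by move=> x /= nP; exact: (PN (a * x)).
Qed.

Lemma ae_forall_int (P : int -> R -> Prop) :
  (forall k, {ae mu, forall x, P k x}) -> {ae mu, forall x, forall k, P k x}.
Proof.
move=> h; have hn (n : nat) : {ae mu, forall x, P n%:Z x /\ P (- n%:Z) x}.
  by apply: (ae_lebesgueS2 _ (h n%:Z) (h (- n%:Z))).
have := ae_foralln hn; apply: filterS => x Px k.
by case: (intP k) => [|n|n]; [have [] := Px 0|have [] := Px n.+1|have [] := Px n.+1].
Qed.

End null_sets.

Section periodization.
Context {R : realType}.
Variable v : R.
Hypothesis v0 : 0 < v.
Local Notation mu := (@lebesgue_measure R).
Local Notation D := (period_itv v).
Local Notation L := (2 * (pi / v)).
Let mD : measurable D := measurable_period_itv v.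
Let L0 : 0 < L := period_gt0 v0.

(** The shift by 1/2 accounts for a period that starts at minus half its length. *)
Definition cell (y : R) : int := Num.floor (y / L + 2^-1).

Lemma cellE y k : D (y - k%:~R * L) <-> k = cell y.
Proof.
rewrite /period_itv/= in_itv/= /cell lerBrDr ltrBlDr.
have h2 : pi / v = L / 2 by field; rewrite gt_eqF.
have := L0; move: h2; set l := L => -> l0.
have -> : (- (l / 2) + k%:~R * l <= y) = (k%:~R <= y / l + 2^-1).
  rewrite -[RHS](ler_pM2r l0) mulrDl divfK ?gt_eqF//; apply/idP/idP; lra.
have -> : (y < l / 2 + k%:~R * l) = (y / l + 2^-1 < (k + 1)%:~R).
  rewrite -[RHS](ltr_pM2r l0) intrD !mulrDl divfK ?gt_eqF//; apply/idP/idP; lra.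
split=> [h|->]; first by apply/esym/floor_def.
by rewrite floor_le_tmp floorD1_gt.
Qed.

(** Countably many translates of the period cover the line. *)
Lemma ae_period_itv (P : R -> Prop) : (forall x k, P x -> P (x + k%:~R * L)) ->
  {ae mu, forall x, D x -> P x} -> {ae mu, forall x, P x}.
Proof.
move=> Pper hP.
have : {ae mu, forall x, forall k : int, D (x + - (k%:~R * L)) -> P (x + - (k%:~R * L))}.
  by apply: ae_forall_int => k; exact: (ae_shift (- (k%:~R * L)) hP).
apply: ae_lebesgueS => x /(_ (cell x)) h; rewrite -(subrK ((cell x)%:~R * L) x).
by apply: Pper; apply: h; apply/cellE.
Qed.

(** Since the translates of the period tile the line, exactly one term of the sum
can be nonzero; it is present as soon as n reaches its index. *)
Lemma cell_sum (g : R -> R) (n : nat) y :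
  \sum_(k <- zrange n) (g y * \1_D (y - k%:~R * L)) =
  if (`|cell y| <= n)%N then g y else 0.
Proof.
have E k : (\1_D (y - k%:~R * L) : R) = (k == cell y)%:R.
  rewrite indicE; congr (nat_of_bool _)%:R; apply/idP/eqP.
    by rewrite inE => /cellE.
  by move=> /cellE; rewrite inE.
under eq_bigr do rewrite E.
case: ifPn => [cn|cn].
  rewrite (bigD1_seq (cell y)) ?uniq_zrange ?mem_zrange//= eqxx mulr1 big1 ?addr0//.
  by move=> k /negbTE ->; rewrite mulr0.
rewrite big1_seq// => k /andP[_]; rewrite mem_zrange => kn.
by case: eqP => [kE|]; rewrite ?mulr0//; move: cn; rewrite -kE kn.
Qed.

Lemma measurable_cell_term (g : R -> R) k : measurable_fun setT g ->
  measurable_fun setT (fun y => g y * \1_D (y - k%:~R * L)).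
Proof.
move=> mg; apply: measurable_funM => //.
have mi : measurable_fun setT (\1_D : R -> R) by exact: measurable_indic.
exact: (measurableT_comp mi (measurable_shift (- (k%:~R * L)))).
Qed.

Lemma integral_cell (g : R -> R) (k : int) : measurable_fun setT g ->
  (\int[mu]_(x in D) (g (x + k%:~R * L))%:E =
   \int[mu]_y (g y * \1_D (y - k%:~R * L))%:E)%E.
Proof.
move=> mg; rewrite -(integral_shift (k%:~R * L)); last first.
  by apply/measurable_EFinP; exact: measurable_cell_term.
rewrite integral_mkcond; apply: eq_integral => x _.
by rewrite addrK patchE indicE; case: ifPn => _; rewrite ?mulr1 ?mulr0.
Qed.

(** Moving each translate back to its place on the line turns the left-hand side
into integrals of g over growing unions of cells. *)
Lemma integral_cells_cvg (g : R -> R) : measurable_fun setT g ->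
  mu.-integrable setT (EFin \o g) ->
  (\int[mu]_(x in D) (\sum_(k <- zrange n) g (x + k%:~R * L))%:E)%E @[n --> \oo] -->
  (\int[mu]_x (g x)%:E)%E.
Proof.
move=> mg ig.
have ic k : mu.-integrable setT (fun y => (g y * \1_D (y - k%:~R * L))%:E).
  apply: (@le_integrable _ _ _ mu _ measurableT _ (EFin \o g)) => //.
    by apply/measurable_EFinP; exact: measurable_cell_term.
  move=> y _; rewrite !abse_EFin lee_fin normrM ler_piMr// indicE.
  by case: (_ \in _); rewrite ?normr1 ?normr0.
have icD k : mu.-integrable D (fun x => (g (x + k%:~R * L))%:E).
  apply/integrableP; split.
    apply/measurable_EFinP; apply: measurable_funTS.
    exact: (measurableT_comp mg (measurable_shift _)).
  have := @integral_cell (fun x => `|g x|) k; rewrite /= => -> //; last first.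
    exact: measurableT_comp.
  have /integrableP[_] := ic k; congr (_ < _)%E; apply: eq_integral => y _.
  rewrite abse_EFin normrM [`|\1_D _|]ger0_norm//.
have step n : (\int[mu]_(x in D) (\sum_(k <- zrange n) g (x + k%:~R * L))%:E)%E =
   (\int[mu]_y (if (`|cell y| <= n)%N then g y else 0)%:E)%E.
  under eq_integral do rewrite -sumEFin.
  rewrite integral_sum//.
  transitivity (\sum_(k <- zrange n) \int[mu]_y (g y * \1_D (y - k%:~R * L))%:E)%E.
    by apply: eq_bigr => k _; rewrite integral_cell.
  rewrite -integral_sum//; apply: eq_integral => y _.
  by rewrite sumEFin cell_sum.
under eq_fun do rewrite step.
have [|||||_ _] := @dominated_convergence _ _ _ mu setT measurableT
     (fun n y => (if (`|cell y| <= n)%N then g y else 0)%:E) (EFin \o g) (EFin \o (fun x => `|g x|)).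
- move=> n; rewrite (_ : (fun _ => _) = (fun y => (\sum_(k <- zrange n) (g y * \1_D (y - k%:~R * L)))%:E)).
    by apply/measurable_EFinP; apply: measurable_sum => k; exact: measurable_cell_term.
  by apply/funext => y; rewrite cell_sum.
- exact/measurable_EFinP.
- apply: aeW => y _; apply: cvg_near_cst; near=> n; rewrite /= ifT//.
  by near: n; exact: nbhs_infty_ge.
- exact: integrable_norm.
- apply: aeW => y n _; rewrite /= lee_fin; case: ifP => // _.
  by rewrite normr0.
by [].
Unshelve. all: by end_near. Qed.

End periodization.

(** * Periodization of an integrable function *)

Section summation_over_int.
Context {R : realType}.

Lemma zrange_esum (a : int -> R) : (forall k, 0 <= a k) ->
  ((\sum_(k <- zrange n) a k)%:E @[n --> \oo] --> \esum_(k in [set: int]) (a k)%:E)%E.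
Proof.
move=> a0; set S := fun n => (\sum_(k <- zrange n) a k)%:E.
have ndS : nondecreasing_seq S by move=> m n mn; rewrite lee_fin; exact: zrange_sum_le.
suff <- : ereal_sup (range S) = \esum_(k in [set: int]) (a k)%:E.
  exact: ereal_nondecreasing_cvgn.
apply/eqP; rewrite eq_le; apply/andP; split; apply: ge_ereal_sup.
  move=> _ [n _ <-]; apply: esum_ge; exists [set` zrange n].
    by split => //; exact: finite_seq.
  by rewrite -fsbig_seq ?uniq_zrange// sumEFin.
move=> _ [A [finA _] <-].
pose n := \max_(k <- finmap.enum_fset (fset_set A)) `|k|%N.
apply: (@le_trans _ _ (S n)); last by apply: ereal_sup_ubound; exists n.
rewrite /S -sumEFin [X in (_ <= X)%E]fsbig_seq ?uniq_zrange//.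
apply: lee_fsum_nneg_subset => //.
  move=> k kA; rewrite inE/= mem_zrange.
  by apply: (@leq_bigmax_seq _ _ xpredT (fun k : int => `|k|%N)) => //; rewrite in_fset_set.
by move=> k _; rewrite lee_fin.
Qed.

Lemma summable_shift (a : int -> R) (j : int) :
  summable [set: int] (fun k => (a k)%:E) ->
  summable [set: int] (fun k => (a (k + j))%:E).
Proof.
rewrite /summable => h.
rewrite -(@reindex_esum R int int setT setT (fun k => k + j) (fun k => `|(a k)%:E|%E))//.
split=> //.
- by move=> k l _ _ /addIr.
- by move=> k _; exists (k - j) => //=; rewrite subrK.
Qed.

End summation_over_int.

Section periodized_integrals.
Context {R : realType}.
Variable v : R.
Hypothesis v0 : 0 < v.
Local Notation mu := (@lebesgue_measure R).
Local Notation D := (period_itv v).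
Local Notation L := (2 * (pi / v)).
Let mD : measurable D := measurable_period_itv v.

Let morbit (g : R -> R) n : measurable_fun setT g ->
  measurable_fun setT (fun x : R => \sum_(k <- zrange n) g (x + k%:~R * L)).
Proof.
move=> mg; apply: measurable_sum => k.
exact: (measurableT_comp mg (measurable_shift (k%:~R * L))).
Qed.

Lemma measurable_orbit_esum (g : R -> R) : measurable_fun setT g -> (forall x, 0 <= g x) ->
  measurable_fun setT (fun x : R => \esum_(k in [set: int]) (g (x + k%:~R * L))%:E).
Proof.
move=> mg g0.
apply: (@emeasurable_fun_cvg _ (measurableTypeR R) R setT
  (fun n x => (\sum_(k <- zrange n) g (x + k%:~R * L))%:E)).
  by move=> n; apply/measurable_EFinP; exact: morbit.
by move=> x _; exact: (@zrange_esum R (fun k => g (x + k%:~R * L))).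
Qed.

(** Monotone convergence.  This version serves Plancherel, where finiteness is part
of the conclusion. *)
Lemma ge0_periodization (g : R -> R) : measurable_fun setT g -> (forall x, 0 <= g x) ->
  (\int[mu]_(x in D) (\esum_(k in [set: int]) (g (x + k%:~R * L))%:E) = \int[mu]_x (g x)%:E)%E.
Proof.
move=> mg g0.
pose cut n (y : R) := if (`|cell v y| <= n)%N then g y else 0.
have mterm k := measurable_cell_term v k mg.
have step n : (\int[mu]_(x in D) (\sum_(k <- zrange n) g (x + k%:~R * L))%:E)%E =
   (\int[mu]_y (cut n y)%:E)%E.
  under eq_integral do rewrite -sumEFin.
  rewrite ge0_integral_sum//; last 2 first.
  - move=> k; apply/measurable_EFinP; apply: measurable_funTS.
    exact: (measurableT_comp mg (measurable_shift (k%:~R * L))).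
  - by move=> k x _; rewrite lee_fin.
  transitivity (\sum_(k <- zrange n) \int[mu]_y (g y * \1_D (y - k%:~R * L))%:E)%E.
    by apply: eq_bigr => k _; rewrite integral_cell.
  rewrite -ge0_integral_sum//.
  - by apply: eq_integral => y _; rewrite sumEFin cell_sum.
  - by move=> k; apply/measurable_EFinP; exact: mterm.
  - by move=> k y _; rewrite lee_fin mulr_ge0// indicE.
transitivity (limn (fun n => \int[mu]_(x in D) (\sum_(k <- zrange n) g (x + k%:~R * L))%:E)%E).
  rewrite -monotone_convergence//.
  - apply: eq_integral => x _; apply/esym/cvg_lim => //.
    exact: (@zrange_esum R (fun k => g (x + k%:~R * L))).
  - by move=> n; apply/measurable_EFinP; apply: measurable_funTS; exact: morbit.
  - by move=> n x _; rewrite lee_fin sumr_ge0.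
  - by move=> x _ m n mn; rewrite lee_fin; exact: zrange_sum_le.
under eq_fun do rewrite step.
rewrite -monotone_convergence//.
- apply: eq_integral => y _; apply/cvg_lim => //; apply: cvg_near_cst; near=> n.
  by rewrite /cut ifT//; near: n; exact: nbhs_infty_ge.
- move=> n; rewrite (_ : (fun _ => _) = (fun y => (\sum_(k <- zrange n) (g y * \1_D (y - k%:~R * L)))%:E)).
    by apply/measurable_EFinP; apply: measurable_sum => k; exact: mterm.
  by apply/funext => y; rewrite cell_sum.
- by move=> n y _; rewrite lee_fin /cut; case: ifP.
- move=> y _ m n mn; rewrite lee_fin /cut; case: ifPn => [cm|_].
    by rewrite (leq_trans cm mn).
  by case: ifP.
Unshelve. all: by end_near. Qed.

Let integrable_orbit (g : R -> R) : measurable_fun setT g ->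
  mu.-integrable setT (EFin \o g) ->
  mu.-integrable D (fun x => \esum_(k in [set: int]) `|g (x + k%:~R * L)|%:E).
Proof.
move=> mg ig.
have mn : measurable_fun setT (fun x => `|g x|) by exact: measurableT_comp.
have h := ge0_periodization mn (fun x => normr_ge0 (g x)).
apply/integrableP; split; first by apply: measurable_funTS; exact: (measurable_orbit_esum mn).
have /integrableP[_] := ig; rewrite -[X in (X < _)%E -> _]h; congr (_ < _)%E.
apply: eq_integral.
by move=> x _; rewrite gee0_abs// esum_ge0// => k _; rewrite lee_fin.
Qed.

(** The sum of the absolute values has a finite integral over a period, hence is
finite almost everywhere. *)
Lemma ae_summable_orbit (g : R -> R) : measurable_fun setT g ->
  mu.-integrable setT (EFin \o g) ->
  {ae mu, forall x, summable [set: int] (fun k => (g (x + k%:~R * L))%:E)}.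
Proof.
move=> mg ig; apply: (ae_period_itv v0).
  move=> x j /(summable_shift j); rewrite /summable.
  by congr (_ < _)%E; apply: eq_esum => k _; rewrite intrD mulrDl addrA addrAC.
have iE := integrable_orbit mg ig.
have := @integrable_ae _ (measurableTypeR R) R mu D mD _ iE; apply: ae_lebesgueS => x /[apply].
by rewrite /summable ge0_fin_numE//; apply: esum_ge0 => k _; rewrite lee_fin.
Qed.

(** Dominated convergence on a period; the dominating function is the sum of the
absolute values. *)
Lemma periodization_integral (u f : R -> R) : measurable_fun setT u ->
  mu.-integrable setT (EFin \o u) -> measurable_fun D f ->
  {ae mu, forall x, \sum_(k <- zrange n) u (x + k%:~R * L) @[n --> \oo] --> f x} ->
  mu.-integrable D (EFin \o f) /\ \int[mu]_(x in D) f x = \int[mu]_x u x.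
Proof.
move=> mg ig mf uf.
have iE := integrable_orbit mg ig.
have [|||||intf _ cf] := @dominated_convergence _ _ _ mu D mD
     (fun n x => (\sum_(k <- zrange n) u (x + k%:~R * L))%:E) (EFin \o f)
     (fun x => \esum_(k in [set: int]) `|u (x + k%:~R * L)|%:E).
- by move=> n; apply/measurable_EFinP; apply: measurable_funTS; exact: morbit.
- exact/measurable_EFinP.
- by apply: ae_lebesgueS uf => x ux _; apply: cvg_EFin => //; exact: nearW.
- exact: iE.
- apply: aeW => x n _; apply: (@le_trans _ _ (\sum_(k <- zrange n) `|u (x + k%:~R * L)|)%:E).
    by rewrite abse_EFin lee_fin ler_norm_sum.
  rewrite -sumEFin fsbig_seq ?uniq_zrange//.
  by apply: ereal_sup_ubound; exists [set` zrange n] => //; split => //; exact: finite_seq.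
split; first exact: intf.
by rewrite /Rintegral; congr fine; exact: (cvg_unique _ cf (integral_cells_cvg v0 mg ig)).
Qed.

End periodized_integrals.

(** * Plancherel's formula for compactly supported functions *)

Section plancherel_compact_support.
Context {R : realType}.
Local Notation mu := (@lebesgue_measure R).
Implicit Types f g : R -> R[i].

Definition fourier_integral f (x : R) : R[i] :=
  integralC setT (fun t => f t * expi (- (t * x))).

Definition compactly_supported f := exists M : R, forall t, M < `|t| -> f t = 0.

Lemma support_period f : compactly_supported f ->
  exists2 w : R, 0 < w & forall t, ~ period_itv w t -> f t = 0.
Proof.
move=> [M fM]; pose N := `|M| + 1.
have N0 : 0 < N by rewrite ltr_wpDl.
(* The period of frequency pi / N is [-N, N[. *)
exists (pi / N); first by rewrite divr_gt0// pi_gt0.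
move=> t; rewrite /period_itv/= in_itv/= invf_div mulrC divfK ?gt_eqF ?pi_gt0// => h.
apply: fM; rewrite ltNge; apply/negP => tM; apply: h.
have : `|t| < N by rewrite (le_lt_trans tM)// (le_lt_trans (ler_norm _))// ltrDl.
by rewrite ltr_norml => /andP[/ltW -> ->].
Qed.

Section one_period.
Variables (w : R) (f : R -> R[i]).
Hypotheses (w0 : 0 < w) (Lf : L2 f) (fD : forall t, ~ period_itv w t -> f t = 0).
Local Notation D := (period_itv w).
Let mD : measurable D := measurable_period_itv w.

Let sqf : square_integrable w f.
Proof.
have [mf ef] := (L2P f).1 Lf; split => //.
apply/integrableP; split.
  by apply/measurable_EFinP; apply: measurable_funTS; exact: measurable_sqr_normc.
apply: le_lt_trans ef; rewrite /energy.
under eq_integral do rewrite gee0_abs ?lee_fin ?sqr_ge0//.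
apply: ge0_subset_integral => //.
- by apply/measurable_EFinP; exact: measurable_sqr_normc.
- by move=> x _; rewrite lee_fin sqr_ge0.
Qed.

Lemma fourier_integral_period x :
  fourier_integral f x = integralC D (fun t => f t * expi (- (t * x))).
Proof.
rewrite integralC_mkcond; apply: eq_integralC => t _; rewrite indicE.
have [tD|tD] := boolP (t \in D); first by rewrite mul1r.
by rewrite fD ?mul0r ?mulr0// => Dt; move/negP: tD; apply; rewrite inE.
Qed.

Lemma energy_period : energy f = (sqnorm w f)%:E.
Proof.
have [mf if2] := sqf.
rewrite /sqnorm /Rintegral fineK; last exact: (@integrable_fin_num _ (measurableTypeR R) R mu D mD _ if2).
rewrite /energy [RHS]integral_mkcond; apply: eq_integral => t _; rewrite patchE.
have [tD|tD] := boolP (t \in D); first by [].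
rewrite fD; first by rewrite sqr_normcE expr0n addr0.
by move=> Dt; move/negP: tD; apply; rewrite inE.
Qed.

(** The Fourier integral is continuous, by dominated convergence under the
integral sign. *)
Lemma cmeasurable_fourier_integral : cmeasurable_fun (fourier_integral f).
Proof.
have [mf if2] := sqf.
have i1 x : cintegrable D (fun t => f t * expi (- (t * x))).
  by apply: square_integrable_mul => // t; exact: normc_expi.
have inF : mu.-integrable D (EFin \o (fun t => normc (f t))).
  apply: (@le_integrable _ _ _ mu D mD _ (fun t => 1%:E + (normc (f t) ^+ 2)%:E)%E).
  - by apply/measurable_EFinP; apply: measurable_funTS; exact: measurable_normc.
  - move=> t _; rewrite -EFinD !abse_EFin lee_fin ger0_norm ?normc_ge0// ger0_norm ?addr_ge0 ?sqr_ge0//.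
    rewrite -subr_ge0 (_ : _ - _ = (normc (f t) - 2^-1) ^+ 2 + 3 / 4); last by field.
    by rewrite addr_ge0 ?sqr_ge0// divr_ge0.
  - by apply: integrableD => //; exact: integrable_period_cst.
have cont (F : R -> R -> R) : (forall x, mu.-integrable D (EFin \o F x)) ->
    (forall t, continuous (F ^~ t)) -> (forall x t, `|F x t| <= normc (f t)) ->
    measurable_fun setT (fun x => \int[mu]_(t in D) F x t).
  move=> iF cF bF; apply: continuous_measurable_fun => a.
  have aI : a \in (`]a - 1, a + 1[%classic : set R).
    by rewrite inE/= in_itv/= ltrBlDr ltrDl ltr01.
  have cae : {ae mu, forall t, D t -> {in (`]a - 1, a + 1[%classic : set R), continuous (F ^~ t)}}.
    by apply: aeW => t _ x _; exact: cF.
  have bae x : (`]a - 1, a + 1[%classic : set R) x -> {ae mu, forall t, D t -> `|F x t| <= normc (f t)}.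
    by move=> _; apply: aeW => t _; exact: bF.
  exact: (@continuity_under_integral R _ (measurableTypeR R) mu F D mD (a - 1) (a + 1)
    (fun x _ => iF x) cae (fun t => normc (f t)) inF bae a aI).
have mul_cont (c : R) (h : R -> R) : continuous h -> continuous (fun x => c * h x).
  by move=> ch x; apply: cvgM; [exact: cvg_cst|exact: ch].
have lin_cont (t : R) : continuous (fun x => - (t * x) : R).
  move=> x; apply: cvgN; apply: cvgM; [exact: cvg_cst|exact: cvg_id].
have ccos (t : R) : continuous (fun x : R => cos (- (t * x))).
  by move=> x; apply: continuous_comp; [exact: lin_cont|exact: continuous_cos].
have csin (t : R) : continuous (fun x : R => sin (- (t * x))).
  by move=> x; apply: continuous_comp; [exact: lin_cont|exact: continuous_sin].
split.
- under eq_fun do rewrite fourier_integral_period.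
  apply: (cont (fun x t => Re (f t * expi (- (t * x))))).
  + by move=> x; have [] := i1 x.
  + move=> t x; under eq_fun do rewrite Re_mulc/=.
    by apply: cvgB; exact: mul_cont.
  + move=> x t; apply: (le_trans (normc_Re _)).
    by rewrite Normc.normcM normc_expi mulr1.
- under eq_fun do rewrite fourier_integral_period.
  apply: (cont (fun x t => Im (f t * expi (- (t * x))))).
  + by move=> x; have [] := i1 x.
  + move=> t x; under eq_fun do rewrite Im_mulc/=.
    by apply: cvgD; exact: mul_cont.
  + move=> x t; apply: (le_trans (normc_Im _)).
    by rewrite Normc.normcM normc_expi mulr1.
Qed.

(** The values of the Fourier integral along s + w k are the Fourier coefficients
of f modulated by e^(- i s t), so this is Parseval's identity. *)
Lemma fiber_energy (s : R) :
  (\esum_(k in [set: int]) (normc (fourier_integral f (s + k%:~R * w)) ^+ 2)%:E =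
   (2 * (pi / w) * sqnorm w f)%:E)%E.
Proof.
pose F t := f t * expi (- (t * s)).
have [mf if2] := sqf.
have nF t : normc (F t) = normc (f t) by rewrite Normc.normcM normc_expi mulr1.
have sqF : square_integrable w F.
  by split; [exact: cmeasurableM|under eq_fun do rewrite nF].
have cF k : coef w F k = fourier_integral f (s + k%:~R * w).
  rewrite fourier_integral_period; apply: eq_integralC => t _.
  by rewrite /F /wave -mulrA -expiD; congr (_ * expi _); rewrite intrN; ring.
have sF : sqnorm w F = sqnorm w f by apply: eq_Rintegral => t _; rewrite nF.
have := parseval w0 sqF; rewrite sF => h.
have h2 := @zrange_esum R (fun k => normc (fourier_integral f (s + k%:~R * w)) ^+ 2) (fun k => sqr_ge0 _).
apply: (cvg_unique _ h2) => //; apply: cvg_EFin; first exact: nearW.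
rewrite [X in X @ _ --> _](_ : _ = (fun n => \sum_(k <- zrange n) normc (coef w F k) ^+ 2)) //.
by apply/funext => n; apply: eq_bigr => k _; rewrite cF.
Qed.

(** Periodize the energy of the Fourier integral with period w, which is the
progression of [fiber_energy]; the integrand over a period is then constant. *)
Lemma plancherel_period : energy (fourier_integral f) = ((2 * pi)%:E * energy f)%E.
Proof.
(* The frequency whose period is w. *)
pose v := 2 * pi / w.
have v0 : 0 < v by rewrite divr_gt0// mulr_gt0// pi_gt0.
have p0 : (pi : R) != 0 by rewrite gt_eqF// pi_gt0.
have w1 : w != 0 by rewrite gt_eqF.
have Lv : 2 * (pi / v) = w by rewrite /v; move: (pi : R) p0 => p q0; field; rewrite q0 w1.
have mF := measurable_sqr_normc cmeasurable_fourier_integral.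
rewrite {1}/energy -(ge0_periodization v0 mF (fun x => sqr_ge0 _)) Lv.
under eq_integral do rewrite fiber_energy.
rewrite integral_cst; last exact: measurable_period_itv.
rewrite [X in (_ * X)%E](lebesgue_measure_period_itv v0) Lv energy_period -!EFinM.
by congr EFin; field; rewrite gt_eqF.
Qed.

End one_period.

Lemma plancherel_compact f : L2 f -> compactly_supported f ->
  L2 (fourier_integral f) /\ energy (fourier_integral f) = ((2 * pi)%:E * energy f)%E.
Proof.
move=> Lf /support_period[w w0 fD].
have E := plancherel_period w0 Lf fD; split => //.
apply/L2P; split; first exact: (cmeasurable_fourier_integral w0 Lf fD).
rewrite E lte_mul_pinfty ?lee_fin ?mulr_ge0 ?pi_ge0//.
by have [_] := (L2P f).1 Lf.
Qed.

End plancherel_compact_support.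

(** * The Fourier transform on L2 *)

Section transform_pairs.
Context {R : realType}.
Local Notation mu := (@lebesgue_measure R).
Implicit Types f g psi : R -> R[i].

Definition L2_limit (u : nat -> R -> R[i]) f :=
  (L2norm (fun x => f x - u n x)%R @[n --> \oo] --> 0)%E.

Lemma L2_limit_le (u : nat -> R -> R[i]) f (b : nat -> \bar R) :
  (forall n, L2norm (fun x => f x - u n x)%R <= b n)%E -> (b n @[n --> \oo] --> 0)%E ->
  L2_limit u f.
Proof.
move=> ub b0; rewrite /L2_limit; apply: (@squeeze_cvge _ _ _ _ (fun=> 0%E) _ b); [|exact: cvg_cst|exact: b0].
by apply: nearW => n; rewrite L2norm_ge0 ub.
Qed.

Lemma L2_limitD (u1 u2 : nat -> R -> R[i]) f1 f2 : L2 f1 -> L2 f2 ->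
  (forall n, L2 (u1 n)) -> (forall n, L2 (u2 n)) ->
  L2_limit u1 f1 -> L2_limit u2 f2 ->
  L2_limit (fun n x => u1 n x + u2 n x) (fun x => f1 x + f2 x).
Proof.
move=> Lf1 Lf2 Lu1 Lu2 l1 l2.
apply: (@L2_limit_le _ _ (fun n => L2norm (fun x => f1 x - u1 n x)%R + L2norm (fun x => f2 x - u2 n x)%R)%E).
  move=> n; have [m1 _] := L2B Lf1 (Lu1 n); have [m2 _] := L2B Lf2 (Lu2 n).
  apply: le_trans (L2normD m1 m2).
  by rewrite (@L2norm_ext _ _ (fun x => f1 x - u1 n x + (f2 x - u2 n x)))// => x; rewrite addrACA opprD.
by rewrite -[X in _ --> X]adde0; apply: cvgeD.
Qed.

Lemma L2_limitZ (c : R[i]) (u : nat -> R -> R[i]) f : L2 f -> (forall n, L2 (u n)) ->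
  L2_limit u f -> L2_limit (fun n x => c * u n x) (fun x => c * f x).
Proof.
move=> Lf Lu l; apply: (@L2_limit_le _ _ (fun n => (normc c)%:E * L2norm (fun x => f x - u n x)%R)%E).
  move=> n; have [m _] := L2B Lf (Lu n); rewrite -L2normZ//.
  by rewrite (@L2norm_ext _ _ (fun x => c * (f x - u n x)))// => x; rewrite mulrBr.
by rewrite -[X in _ --> X](mule0 (normc c)%:E); apply: cvgeZl.
Qed.

Lemma L2_limit_norm (u : nat -> R -> R[i]) f : L2 f -> (forall n, L2 (u n)) ->
  L2_limit u f -> (L2norm (u n) @[n --> \oo] --> L2norm f)%E.
Proof.
move=> Lf Lu l; have [mf _] := Lf; have d n : cmeasurable_fun (fun x => f x - u n x).
  by have [] := L2B Lf (Lu n).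
apply: (@squeeze_cvge _ _ _ _ (fun n => L2norm f - L2norm (fun x => f x - u n x)%R)%E _
   (fun n => L2norm f + L2norm (fun x => f x - u n x)%R)%E).
- apply: nearW => n; have [mu_ fu] := Lu n; apply/andP; split.
    rewrite leeBlDr; last first.
      by rewrite ge0_fin_numE ?L2norm_ge0//; have [_] := L2B Lf (Lu n).
    apply: le_trans (L2normD mu_ (d n)).
    by rewrite (@L2norm_ext _ f (fun x => u n x + (f x - u n x)))// => x; rewrite addrC subrK.
  apply: le_trans (L2normB mf (d n)).
  by rewrite (@L2norm_ext _ (u n) (fun x => f x - (f x - u n x)))// => x; rewrite subKr.
- rewrite -[X in _ --> X]sube0; apply: cvgeB => //; last exact: cvg_cst.
  by rewrite fin_num_adde_defl.
- rewrite -[X in _ --> X]adde0; apply: cvgeD => //; last exact: cvg_cst.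
  by rewrite fin_num_adde_defl.
Qed.

Definition test_function f := L2 f /\ compactly_supported f.

(** Membership in the graph of the Fourier transform, witnessed by any approximating
test functions.  In contrast to truncations, arbitrary test functions are stable
under translation, dilation and addition. *)
Definition transform_pair psi g := [/\ L2 psi, L2 g &
  exists2 u : nat -> R -> R[i], (forall n, test_function (u n)) &
    L2_limit u psi /\ L2_limit (fun n => fourier_integral (u n)) g].

Lemma cintegrable_test f (g : R -> R[i]) : test_function f -> cmeasurable_fun g ->
  (forall t, normc (g t) = 1) -> cintegrable setT (fun t => f t * g t).
Proof.
move=> [Lf sf] mg g1; have [mf ef] := (L2P f).1 Lf.
have [w w0 fD] := support_period sf.
have mD := measurable_period_itv w.
apply: (@cintegrable_le _ _ _ (fun t => \1_(period_itv w) t + normc (f t) ^+ 2)) => //.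
- exact: cmeasurableM.
- apply: (@eq_integrable _ _ _ mu setT measurableT
    (fun t => (\1_(period_itv w) t)%:E + (normc (f t) ^+ 2)%:E)%E) => //.
  apply: integrableD => //.
    apply: (@eq_integrable _ _ _ mu setT measurableT ((EFin \o (fun=> 1 : R)) \_ (period_itv w))).
      by move=> t _; rewrite patchE indicE; case: ifP.
    by rewrite -integrable_mkcond//; exact: integrable_period_cst.
  apply/integrableP; split; first by apply/measurable_EFinP; exact: measurable_sqr_normc.
  by under eq_integral do rewrite gee0_abs ?lee_fin ?sqr_ge0//.
- move=> t _; rewrite Normc.normcM g1 mulr1 indicE.
  have [tD|tD] := boolP (t \in period_itv w).
    rewrite /= -subr_ge0 (_ : _ - _ = (normc (f t) - 2^-1) ^+ 2 + 3 / 4); last by field.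
    by rewrite addr_ge0 ?sqr_ge0// divr_ge0.
  rewrite fD ?Normc.normc0 ?expr0n ?addr0//=.
  by move=> Dt; move/negP: tD; apply; rewrite inE.
Qed.

Lemma test_functionD f g : test_function f -> test_function g ->
  test_function (fun x => f x + g x).
Proof.
move=> [Lf [M fM]] [Lg [K gK]]; split; first exact: L2D.
by exists (Num.max M K) => t; rewrite gt_max => /andP[tM tK]; rewrite fM// gK// addr0.
Qed.

Lemma test_functionZ (c : R[i]) f : test_function f -> test_function (fun x => c * f x).
Proof.
move=> [Lf [M fM]]; split; first exact: L2Z.
by exists M => t tM; rewrite fM// mulr0.
Qed.

Lemma fourier_integralD f g x : test_function f -> test_function g ->
  fourier_integral (fun t => f t + g t) x = fourier_integral f x + fourier_integral g x.
Proof.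
move=> Tf Tg; rewrite /fourier_integral -integralCD//.
- by apply: eq_integralC => t _; rewrite mulrDl.
- by apply: cintegrable_test => // t; exact: normc_expi.
- by apply: cintegrable_test => // t; exact: normc_expi.
Qed.

Lemma fourier_integralZ (c : R[i]) f x : test_function f ->
  fourier_integral (fun t => c * f t) x = c * fourier_integral f x.
Proof.
move=> Tf; rewrite /fourier_integral -integralCZ//.
- by apply: eq_integralC => t _; rewrite mulrA.
- by apply: cintegrable_test => // t; exact: normc_expi.
Qed.

Lemma L2_fourier_integral f : test_function f -> L2 (fourier_integral f).
Proof. by move=> [Lf sf]; have [] := plancherel_compact Lf sf. Qed.

Lemma transform_pairD psi1 g1 psi2 g2 : transform_pair psi1 g1 -> transform_pair psi2 g2 ->
  transform_pair (fun x => psi1 x + psi2 x) (fun x => g1 x + g2 x).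
Proof.
move=> [Lp1 Lg1 [u1 Tu1 [l1 k1]]] [Lp2 Lg2 [u2 Tu2 [l2 k2]]].
split; [exact: L2D|exact: L2D|].
exists (fun n x => u1 n x + u2 n x); first by move=> n; exact: test_functionD.
split.
  by apply: L2_limitD => // n; [have [] := Tu1 n|have [] := Tu2 n].
rewrite (_ : (fun n => _) = (fun n x => fourier_integral (u1 n) x + fourier_integral (u2 n) x)).
  by apply: L2_limitD => // n; exact: L2_fourier_integral.
by apply/funext => n; apply/funext => x; exact: fourier_integralD.
Qed.

Lemma transform_pairZ (c : R[i]) psi g : transform_pair psi g ->
  transform_pair (fun x => c * psi x) (fun x => c * g x).
Proof.
move=> [Lp Lg [u Tu [l k]]]; split; [exact: L2Z|exact: L2Z|].
exists (fun n x => c * u n x); first by move=> n; exact: test_functionZ.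
split; first by apply: L2_limitZ => // n; have [] := Tu n.
rewrite (_ : (fun n => _) = (fun n x => c * fourier_integral (u n) x)).
  by apply: L2_limitZ => // n; exact: L2_fourier_integral.
by apply/funext => n; apply/funext => x; exact: fourier_integralZ.
Qed.

Lemma transform_pair_energy psi g : transform_pair psi g ->
  energy g = ((2 * pi)%:E * energy psi)%E.
Proof.
move=> [Lp Lg [u Tu [l k]]].
have h1 := L2_limit_norm Lp (fun n => (Tu n).1) l.
have h2 := L2_limit_norm Lg (fun n => L2_fourier_integral (Tu n)) k.
have E n : (L2norm (fourier_integral (u n)) = (2 * pi)%:E `^ 2^-1 * L2norm (u n))%E.
  have [Lu su] := Tu n; have [_ e] := plancherel_compact Lu su.
  by rewrite !L2normE e poweRM ?energy_ge0// lee_fin mulr_ge0// pi_ge0.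
have p0 : (0 <= 2 * pi :> R) by rewrite mulr_ge0// pi_ge0.
have h3 : (L2norm (fourier_integral (u n)) @[n --> \oo] --> (2 * pi)%:E `^ 2^-1 * L2norm psi)%E.
  by under eq_fun do rewrite E; apply: cvgeZl.
have := cvg_unique _ h2 h3; rewrite !energyE => -> //.
rewrite poweRM ?L2norm_ge0 ?poweR_ge0// -poweRrM mulVf// poweRe1//.
Qed.

(** Plancherel applied to the difference of the two pairs. *)
Lemma transform_pair_unique psi g1 g2 : transform_pair psi g1 -> transform_pair psi g2 ->
  {ae mu, forall x, g1 x = g2 x}.
Proof.
move=> P1 P2; have := transform_pairD P1 (transform_pairZ (-1) P2) => P.
have [_ [mg _] _] := P; have := transform_pair_energy P.
rewrite (_ : energy (fun x => psi x + -1 * psi x)%R = 0%E); last first.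
  rewrite /energy integral0_eq// => x _; rewrite mulN1r subrr.
  by rewrite Normc.normc0 expr0n.
rewrite mule0 => e0.
have : L2norm (fun x => g1 x + -1 * g2 x)%R = 0%E by rewrite L2normE e0 poweR0r.
move/(L2norm0_ae mg); apply: ae_lebesgueS => x.
by rewrite mulN1r => /eqP; rewrite subr_eq0 => /eqP.
Qed.

End transform_pairs.

Section transform_pair_operations.
Context {R : realType}.
Local Notation mu := (@lebesgue_measure R).
Implicit Types f g psi : R -> R[i].

Lemma integralC_shift (a : R) f : cmeasurable_fun f ->
  integralC setT (fun t => f (t + a)) = integralC setT f.
Proof.
move=> [rf jf]; rewrite /integralC /Rintegral; congr (fine _ +i* fine _).
  by apply: (@integral_shift _ a (fun t => (Re (f t))%:E)); exact/measurable_EFinP.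
by apply: (@integral_shift _ a (fun t => (Im (f t))%:E)); exact/measurable_EFinP.
Qed.

Lemma integralC_scale (a : R) f : 0 < a -> cmeasurable_fun f ->
  a%:C * integralC setT (fun t => f (a * t)) = integralC setT f.
Proof.
move=> a0 [rf jf].
have fineZ (x : \bar R) : a * fine x = fine (a%:E * x)%E.
  by case: x => [r| |]//=; rewrite ?mulr0 ?gt0_muley ?gt0_muleNy.
apply: complex_eq; rewrite !ReImE /= mul0r ?subr0 ?addr0 /Rintegral fineZ; congr fine.
  by apply: (@integral_scale _ a (fun t => (Re (f t))%:E)) => //; exact/measurable_EFinP.
by apply: (@integral_scale _ a (fun t => (Im (f t))%:E)) => //; exact/measurable_EFinP.
Qed.

Lemma energy_shift (a : R) f : cmeasurable_fun f -> energy (fun t => f (t + a)) = energy f.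
Proof.
move=> mf; apply: (@ge0_integral_shift _ a (fun t => (normc (f t) ^+ 2)%:E)).
  by apply/measurable_EFinP; exact: measurable_sqr_normc.
by move=> x; rewrite lee_fin sqr_ge0.
Qed.

Lemma L2norm_shift (a : R) f : cmeasurable_fun f -> L2norm (fun t => f (t + a)) = L2norm f.
Proof. by move=> mf; rewrite !L2normE energy_shift. Qed.

Lemma energy_scale (a : R) f : 0 < a -> cmeasurable_fun f ->
  energy (fun t => f (a * t)) = ((a^-1)%:E * energy f)%E.
Proof.
move=> a0 mf; rewrite /energy -[in RHS](@ge0_integral_scale _ a)//.
- by rewrite muleA -EFinM mulVf ?mul1e// gt_eqF.
- by apply/measurable_EFinP; exact: measurable_sqr_normc.
- by move=> x; rewrite lee_fin sqr_ge0.
Qed.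

Lemma L2norm_scale (a : R) f : 0 < a -> cmeasurable_fun f ->
  L2norm (fun t => f (a * t)) = ((a^-1)%:E `^ 2^-1 * L2norm f)%E.
Proof.
move=> a0 mf; rewrite !L2normE energy_scale// poweRM ?energy_ge0// lee_fin.
by rewrite invr_ge0 ltW.
Qed.

Lemma L2_shift (a : R) f : L2 f -> L2 (fun t => f (t + a)).
Proof.
move=> [mf ff]; split; last by rewrite -/(L2norm _) L2norm_shift.
exact: (cmeasurable_comp (measurable_shift a)).
Qed.

Lemma L2_scale (a : R) f : 0 < a -> L2 f -> L2 (fun t => f (a * t)).
Proof.
move=> a0 Lf; have [mf ef] := (L2P f).1 Lf; apply/L2P; split.
  exact: (cmeasurable_comp (measurable_mulr a)).
by rewrite energy_scale// lte_mul_pinfty// lee_fin invr_ge0 ltW.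
Qed.

Lemma L2_unimodular (e : R -> R[i]) f : cmeasurable_fun e -> (forall x, normc (e x) = 1) ->
  L2 f -> L2 (fun x => e x * f x).
Proof.
move=> me e1 [mf ff]; split; first exact: cmeasurableM.
rewrite -/(L2norm _) (@L2norm_ext _ _ f)// => x.
by rewrite Normc.normcM e1 mul1r.
Qed.

Lemma fourier_integral_shift (a : R) f x : test_function f ->
  fourier_integral (fun t => f (t - a)) x = expi (- (a * x)) * fourier_integral f x.
Proof.
move=> Tf; have [[mf _] _] := Tf; rewrite /fourier_integral.
rewrite -(@integralC_shift a (fun t => f (t - a) * expi (- (t * x)))); last first.
  apply: cmeasurableM => //; exact: (cmeasurable_comp (measurable_shift (- a))).
rewrite -integralCZ//; last by apply: cintegrable_test => // t; exact: normc_expi.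
by apply: eq_integralC => t _; rewrite addrK mulrCA -expiD; congr (_ * expi _); ring.
Qed.

Lemma fourier_integral_scale (a : R) f x : 0 < a -> cmeasurable_fun f ->
  fourier_integral (fun t => f (a * t)) x = a^-1%:C * fourier_integral f (a^-1 * x).
Proof.
move=> a0 mf; have ac : a%:C != 0 by rewrite -(rmorph0 (real_complex R)) (inj_eq (@complexI R)) gt_eqF.
apply: (mulfI ac); rewrite mulrA -rmorphM mulfV ?gt_eqF// rmorph1 mul1r.
rewrite /fourier_integral.
rewrite -(@integralC_scale a (fun t => f t * expi (- (t * (a^-1 * x)))))//; last exact: cmeasurableM.
congr (_ * _); apply: eq_integralC => t _; congr (_ * expi _); field.
by rewrite gt_eqF.
Qed.

Lemma transform_pair_shift (a : R) psi g : transform_pair psi g ->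
  transform_pair (fun x => psi (x - a)) (fun x => expi (- (a * x)) * g x).
Proof.
move=> [Lp Lg [u Tu [l k]]].
have me := cmeasurable_modulation a.
have e1 x : normc (expi (- (a * x)) : R[i]) = 1 by exact: normc_expi.
split; [exact: L2_shift|exact: L2_unimodular|].
exists (fun n x => u n (x - a)).
  move=> n; have [Lu [M uM]] := Tu n; split; first exact: L2_shift.
  exists (M + `|a|) => t h; apply: uM; rewrite -(ltrD2r `|a|); apply: (lt_le_trans h).
  by rewrite -{1}(subrK a t) ler_normD.
split.
  apply: (@L2_limit_le _ _ _ (fun n => L2norm (fun x => psi x - u n x)%R)) => // n.
  have [m _] := L2B Lp (Tu n).1.
  by rewrite -(@L2norm_shift (- a) _ m).
apply: (@L2_limit_le _ _ _ (fun n => L2norm (fun x => g x - fourier_integral (u n) x)%R)) => // n.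
rewrite (@L2norm_ext _ _ (fun x => g x - fourier_integral (u n) x))// => x.
by rewrite fourier_integral_shift// -mulrBr Normc.normcM e1 mul1r.
Qed.

Lemma transform_pair_scale (a : R) psi g : 0 < a -> transform_pair psi g ->
  transform_pair (fun x => psi (a * x)) (fun x => a^-1%:C * g (a^-1 * x)).
Proof.
move=> a0 [Lp Lg [u Tu [l k]]]; have a1 : 0 < a^-1 by rewrite invr_gt0.
split; [exact: L2_scale|by apply: L2Z; exact: L2_scale|].
exists (fun n x => u n (a * x)).
  move=> n; have [Lu [M uM]] := Tu n; split; first exact: L2_scale.
  by exists (M / a) => t h; apply: uM; rewrite normrM (gtr0_norm a0) mulrC -ltr_pdivrMr.
split.
  apply: (@L2_limit_le _ _ _ (fun n => (a^-1)%:E `^ 2^-1 * L2norm (fun x => psi x - u n x)%R)%E).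
    move=> n; have [m _] := L2B Lp (Tu n).1.
    by rewrite -(@L2norm_scale a _ a0 m).
  rewrite -[X in _ --> X](mule0 ((a^-1)%:E `^ 2^-1)%E).
  by apply: cvgeZl => //; rewrite poweR_EFin.
apply: (@L2_limit_le _ _ _ (fun n => (normc a^-1%:C)%:E * ((a^-1^-1)%:E `^ 2^-1 *
    L2norm (fun x => g x - fourier_integral (u n) x)%R))%E).
  move=> n; have [m _] := L2B Lg (L2_fourier_integral (Tu n)).
  rewrite -(@L2norm_scale a^-1 _ a1 m) -L2normZ; last exact: (cmeasurable_comp (measurable_mulr a^-1) m).
  rewrite le_eqVlt; apply/orP; left; apply/eqP; apply: L2norm_ext => x.
  by rewrite fourier_integral_scale ?mulrBr//; have [[]] := Tu n.
rewrite -[X in _ --> X](mule0 (normc a^-1%:C)%:E).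
apply: cvgeZl => //; rewrite -[X in _ --> X](mule0 ((a^-1^-1)%:E `^ 2^-1)%E).
by apply: cvgeZl => //; rewrite poweR_EFin.
Qed.

Lemma L2normE_sqrt f : L2 f -> L2norm f = (Num.sqrt (fine (energy f)))%:E.
Proof.
move=> /L2P[mf ef]; rewrite L2normE -{1}(@fineK _ (energy f)); last first.
  by rewrite ge0_fin_numE ?energy_ge0.
by rewrite poweR_EFin powR12_sqrt// fine_ge0 ?energy_ge0.
Qed.

(** The truncations of psi are test functions whose Fourier integrals are those in
the definition; they converge to psi by dominated convergence. *)
Lemma transform_pair_of_fourier psi g : is_fourier psi g -> transform_pair psi g.
Proof.
move=> [Lp Lg lim]; split=> //.
pose u (n : nat) t : R[i] := (\1_(`[- n%:R, n%:R]%classic : set R) t)%:C * psi t.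
have [mp ep] := (L2P psi).1 Lp.
have mu_ n : cmeasurable_fun (u n).
  by apply: cmeasurableM => //; apply: cmeasurable_real; exact: measurable_indic.
have ule n t : normc (u n t) <= normc (psi t).
  rewrite /u indicE; case: (_ \in _); first by rewrite mul1r.
  by rewrite mul0r Normc.normc0 normc_ge0.
have Tu n : test_function (u n).
  split.
    split=> //; apply: le_lt_trans (Lp.2); apply: L2norm_le => //.
  exists n%:R => t nt; rewrite /u indicE memNset ?mul0r//= in_itv/= -ler_norml.
  by apply/negP; rewrite -ltNge.
exists u => //; split; last first.
  have E n : L2norm (fun x => g x - fourier_integral (u n) x) =
      L2norm (fun x => g x - fourier_trunc n psi x).
    congr L2norm; apply/funext => x; congr (_ - _).
    rewrite /fourier_trunc integralC_mkcond; apply: eq_integralC => t _.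
    by rewrite mulrA.
  by rewrite /L2_limit; under eq_fun do rewrite E.
have dn n t : normc (psi t - u n t) <= normc (psi t).
  rewrite /u indicE; case: (_ \in _); last by rewrite mul0r subr0.
  by rewrite mul1r subrr Normc.normc0 normc_ge0.
have md n : cmeasurable_fun (fun t => psi t - u n t) by exact: cmeasurableB.
have ip : mu.-integrable setT (fun t => (normc (psi t) ^+ 2)%:E).
  apply/integrableP; split; first by apply/measurable_EFinP; exact: measurable_sqr_normc.
  by under eq_integral do rewrite gee0_abs ?lee_fin ?sqr_ge0//.
have : (energy (fun t => psi t - u n t)%R @[n --> \oo] --> 0)%E.
  have [|||||_ _] := @dominated_convergence _ _ _ mu setT measurableT
    (fun n t => (normc (psi t - u n t) ^+ 2)%:E) (cst 0%E) (fun t => (normc (psi t) ^+ 2)%:E).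
  - by move=> n; apply/measurable_EFinP; exact: measurable_sqr_normc.
  - exact: measurable_cst.
  - apply: aeW => t _; apply: cvg_near_cst; near=> n.
    rewrite /u indicE mem_set ?mul1r ?subrr ?Normc.normc0 ?expr0n//=.
    rewrite in_itv/= -ler_norml; near: n; exact: nbhs_infty_ger.
  - exact: ip.
  - apply: aeW => t n _; rewrite abse_EFin lee_fin ger0_norm ?sqr_ge0//.
    by rewrite ler_pXn2r ?nnegrE ?normc_ge0.
  by rewrite integral0.
move=> /fine_cvgP[_ ec]; rewrite /L2_limit.
under eq_fun => n do rewrite (L2normE_sqrt (L2B Lp (Tu n).1)).
apply: cvg_EFin; first exact: nearW.
rewrite -[X in _ --> X]sqrtr0; apply: (@cvg_comp _ _ _ _ Num.sqrt _ _ _ ec).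
exact: sqrt_continuous.
Unshelve. all: by end_near. Qed.

(** Expresses inner products by energies, so that Plancherel for energies gives
Plancherel for inner products. *)
Lemma inner_polarization f g : L2 f -> L2 g -> inner f g =
  (4^-1 * (fine (energy (fun x => f x + g x)) - fine (energy (fun x => f x + -1 * g x)))) +i*
  (4^-1 * (fine (energy (fun x => f x + - 'i%C * g x)) - fine (energy (fun x => f x + 'i%C * g x)))).
Proof.
move=> Lf Lg.
have ie h : L2 h -> mu.-integrable setT (EFin \o (fun t => normc (h t) ^+ 2)).
  move=> /L2P[mh eh]; apply/integrableP; split.
    by apply/measurable_EFinP; exact: measurable_sqr_normc.
  by under eq_integral do rewrite gee0_abs ?lee_fin ?sqr_ge0//.
have Ld (c : R[i]) : L2 (fun x => f x + c * g x) by apply: L2D => //; exact: L2Z.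
have half (F : R -> R) h1 h2 : L2 h1 -> L2 h2 ->
    (forall x, F x = 4^-1 * (normc (h1 x) ^+ 2 - normc (h2 x) ^+ 2)) ->
    \int[mu]_(x in setT) F x = 4^-1 * (fine (energy h1) - fine (energy h2)).
  move=> L1 L2_ FE; under eq_Rintegral do rewrite FE.
  have i1 := ie _ L1; have i2 := ie _ L2_.
  rewrite RintegralZl//; last first.
    apply: (@eq_integrable _ _ _ mu setT measurableT (fun x => (normc (h1 x) ^+ 2)%:E - (normc (h2 x) ^+ 2)%:E)%E) => //.
    exact: integrableB.
  by rewrite RintegralB.
rewrite /inner /integralC; congr (_ +i* _); apply: half => //.
- exact: L2D.
- by move=> x; rewrite !sqr_normcE !ReImE /=; field.
- by move=> x; rewrite !sqr_normcE !ReImE /=; field.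
Qed.

Lemma transform_pair_inner psi1 g1 psi2 g2 : transform_pair psi1 g1 -> transform_pair psi2 g2 ->
  inner g1 g2 = (2 * pi)%:C * inner psi1 psi2.
Proof.
move=> P1 P2; have [L1 K1 _] := P1; have [L2_ K2_ _] := P2.
have E (c : R[i]) : fine (energy (fun x => g1 x + c * g2 x)) =
    2 * pi * fine (energy (fun x => psi1 x + c * psi2 x)).
  rewrite (transform_pair_energy (transform_pairD P1 (transform_pairZ c P2))) fineM//.
  by rewrite ge0_fin_numE ?energy_ge0//; have [_] := (L2P _).1 (L2D L1 (L2Z c L2_)).
have E1 : fine (energy (fun x => g1 x + g2 x)) =
    2 * pi * fine (energy (fun x => psi1 x + psi2 x)).
  have := E 1; under eq_fun do rewrite mul1r.
  by move=> ->; under eq_fun do rewrite mul1r.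
have scale (a b c d : R) :
    (4^-1 * (2 * pi * a - 2 * pi * b)) +i* (4^-1 * (2 * pi * c - 2 * pi * d)) =
    (2 * pi)%:C * ((4^-1 * (a - b)) +i* (4^-1 * (c - d))).
  move: (2 * pi : R) => q; apply: complex_eq; rewrite !ReImE /= mul0r ?subr0 ?addr0;
    by rewrite -!mulrBr mulrCA.
rewrite (inner_polarization K1 K2_) (inner_polarization L1 L2_) (E (-1)) (E (- 'i%C)) (E 'i%C) E1.
exact: scale.
Qed.

End transform_pair_operations.

(** * Absolutely convergent complex sums over the integers *)

Section complex_sums.
Context {R : realType}.
Implicit Types a b : int -> R[i].

Definition csummable a := summable [set: int] (fun k => (normc (a k))%:E).

(** The value is meaningful for summable u only.  Defining it from the positive and
negative parts makes it a measurable function of parameters. *)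
Definition rsum (u : int -> R) : R :=
  fine (\esum_(k in [set: int]) (u^\+ k)%:E) - fine (\esum_(k in [set: int]) (u^\- k)%:E).

Definition csum a : R[i] := rsum (fun k => Re (a k)) +i* rsum (fun k => Im (a k)).

Lemma summable_le (u v : int -> R) : (forall k, `|u k| <= `|v k|) ->
  summable [set: int] (fun k => (v k)%:E) -> summable [set: int] (fun k => (u k)%:E).
Proof.
by move=> uv; apply: le_lt_trans; apply: le_esum => k _; rewrite !abse_EFin lee_fin.
Qed.

Lemma csummable_Re a : csummable a -> summable [set: int] (fun k => (Re (a k))%:E).
Proof.
by apply: summable_le => k; rewrite (ger0_norm (normc_ge0 _)) normc_Re.
Qed.

Lemma csummable_Im a : csummable a -> summable [set: int] (fun k => (Im (a k))%:E).
Proof.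
by apply: summable_le => k; rewrite (ger0_norm (normc_ge0 _)) normc_Im.
Qed.

Lemma csummable_ReIm a : summable [set: int] (fun k => (Re (a k))%:E) ->
  summable [set: int] (fun k => (Im (a k))%:E) -> csummable a.
Proof.
move=> h1 h2; have := summableD h1 h2.
rewrite /csummable /summable => _; move: h1 h2; rewrite /summable => h1 h2.
have := lte_add_pinfty h1 h2; rewrite -esumD//; apply: le_lt_trans; apply: le_esum => k _.
by rewrite !abse_EFin -EFinD lee_fin (ger0_norm (normc_ge0 _)) normc_le_ReIm.
Qed.

Lemma rsum_cvg (u : int -> R) : summable [set: int] (fun k => (u k)%:E) ->
  \sum_(k <- zrange n) u k @[n --> \oo] --> rsum u.
Proof.
move=> su.
have part (v : int -> R) : (forall k, 0 <= v k <= `|u k|) ->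
    \sum_(k <- zrange n) v k @[n --> \oo] --> fine (\esum_(k in [set: int]) (v k)%:E).
  move=> vu; have v0 k : 0 <= v k by have /andP[] := vu k.
  have := zrange_esum v0.
  have fe : (\esum_(k in [set: int]) (v k)%:E \is a fin_num)%E.
    rewrite ge0_fin_numE; last by apply: esum_ge0 => k _; rewrite lee_fin.
    by apply: le_lt_trans su; apply: le_esum => k _; rewrite abse_EFin lee_fin; have /andP[] := vu k.
  by rewrite -{1}(fineK fe) => /fine_cvgP[].
rewrite (_ : (fun n => _) = (fun n => \sum_(k <- zrange n) u^\+ k - \sum_(k <- zrange n) u^\- k)); last first.
  by apply/funext => n; rewrite -sumrB; apply: eq_bigr => k _; rewrite -{1}[u]funrposBneg.
apply: cvgB; apply: part => k.
  by rewrite /funrpos le_max lexx orbT/= ge_max normr_ge0 andbT ler_norm.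
by rewrite /funrneg le_max lexx orbT/= ge_max normr_ge0 andbT -normrN ler_norm.
Qed.

(** Componentwise, so that the real convergence lemmas apply; it agrees with
convergence in the complex plane by [ccvgP]. *)
Definition ccvg (s : nat -> R[i]) (l : R[i]) :=
  (Re (s n) @[n --> \oo] --> Re l) /\ (Im (s n) @[n --> \oo] --> Im l).

Lemma ccvg_unique (s : nat -> R[i]) l l' : ccvg s l -> ccvg s l' -> l = l'.
Proof.
move=> [r1 j1] [r2 j2]; apply: complex_eq.
  exact: (cvg_unique _ r1 r2).
exact: (cvg_unique _ j1 j2).
Qed.

Lemma ccvgP (s : nat -> R[i]) (l : R[i]) :
  ccvg s l <-> ((s n : R[i]^o) @[n --> \oo] --> (l : R[i]^o)).
Proof.
split=> [[rl jl]|/cvgrPdist_lt h].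
  apply/cvgrPdist_lt => e; rewrite ltcE => /andP[/eqP/= e1 e2].
  have e3 : 0 < Re e / 2 by rewrite divr_gt0.
  move/cvgrPdist_lt : rl => /(_ _ e3) rl; move/cvgrPdist_lt : jl => /(_ _ e3) jl.
  near=> n; rewrite normr_normc ltcE/= e1 eqxx/=.
  apply: (le_lt_trans (normc_le_ReIm _)); rewrite Re_subc Im_subc [ltRHS]splitr.
  by apply: ltrD; near: n.
split; apply/cvgrPdist_lt => e e0; have ec : 0 < e%:C by rewrite ltcE/= eqxx.
  have := h _ ec; apply: filterS => n; rewrite normr_normc ltcE/= eqxx/= -Re_subc.
  exact: le_lt_trans (normc_Re _).
have := h _ ec; apply: filterS => n; rewrite normr_normc ltcE/= eqxx/= -Im_subc.
exact: le_lt_trans (normc_Im _).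
Unshelve. all: by end_near. Qed.

Lemma Re_sum (I : Type) (r : seq I) (F : I -> R[i]) :
  Re (\sum_(k <- r) F k) = \sum_(k <- r) Re (F k).
Proof. by elim: r => [|k r IH]; rewrite ?big_nil// !big_cons Re_addc IH. Qed.

Lemma Im_sum (I : Type) (r : seq I) (F : I -> R[i]) :
  Im (\sum_(k <- r) F k) = \sum_(k <- r) Im (F k).
Proof. by elim: r => [|k r IH]; rewrite ?big_nil// !big_cons Im_addc IH. Qed.

Lemma csum_cvg a : csummable a -> ccvg (fun n => \sum_(k <- zrange n) a k) (csum a).
Proof.
move=> sa; split.
  by under eq_fun do rewrite Re_sum; apply: rsum_cvg; exact: csummable_Re.
by under eq_fun do rewrite Im_sum; apply: rsum_cvg; exact: csummable_Im.
Qed.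

Lemma csum_unique a l : csummable a -> ccvg (fun n => \sum_(k <- zrange n) a k) l -> csum a = l.
Proof. by move=> sa; apply: ccvg_unique; exact: csum_cvg. Qed.

Lemma csum_shift a (j : int) : csum (fun k => a (k + j)) = csum a.
Proof.
have E (v : int -> R) : (\esum_(k in [set: int]) (v (k + j))%:E = \esum_(k in [set: int]) (v k)%:E)%E.
  rewrite [RHS](@reindex_esum R int int setT setT (fun k => k + j))//; split=> //.
  - by move=> k l _ _ /addIr.
  - by move=> k _; exists (k - j) => //=; rewrite subrK.
have Er (v : int -> R) : rsum (fun k => v (k + j)) = rsum v.
  by congr (fine _ - fine _); [exact: (E v^\+) | exact: (E v^\-)].
by rewrite /csum (Er (fun k => Re (a k))) (Er (fun k => Im (a k))).
Qed.

Lemma csummableZ (c : R[i]) a : csummable a -> csummable (fun k => c * a k).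
Proof.
rewrite /csummable /summable => sa.
apply: (@le_lt_trans _ _ ((normc c)%:E * \esum_(k in [set: int]) `|(normc (a k))%:E|)%E).
  apply: ge_ereal_sup => _ [X [finX _] <-].
  under eq_fsbigr do rewrite Normc.normcM abse_EFin normrM (ger0_norm (normc_ge0 c)) EFinM.
  rewrite -ge0_mule_fsumr//; apply: lee_wpmul2l; first by rewrite lee_fin normc_ge0.
  by apply: ereal_sup_ubound; exists X.
by rewrite lte_mul_pinfty// lee_fin normc_ge0.
Qed.

Lemma ccvgZ (c : R[i]) (s : nat -> R[i]) l : ccvg s l -> ccvg (fun n => c * s n) (c * l).
Proof.
move=> [rl jl]; split; rewrite !ReImE.
  under eq_fun do rewrite Re_mulc.
  by apply: cvgB; apply: cvgM => //; exact: cvg_cst.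
under eq_fun do rewrite Im_mulc.
by apply: cvgD; apply: cvgM => //; exact: cvg_cst.
Qed.

Lemma csumZ (c : R[i]) a : csummable a -> csum (fun k => c * a k) = c * csum a.
Proof.
move=> sa; apply: csum_unique; first exact: csummableZ.
under eq_fun do rewrite -mulr_sumr.
exact: ccvgZ (csum_cvg sa).
Qed.

Lemma fsbig_finType (V : Type) (idx : V) (op : Monoid.com_law idx) (T : finType) (F : T -> V) :
  \big[op/idx]_(i \in [set: T]) F i = \big[op/idx]_i F i.
Proof.
have -> : [set: T] = [set` index_enum T].
  by apply/seteqP; split => // i _ /=; rewrite mem_index_enum.
by rewrite -fsbig_seq// index_enum_uniq.
Qed.

(** Division with remainder identifies the integers with pairs of a residue and a
quotient. *)
Lemma esum_residues (u : int -> R) (N : nat) : (0 < N)%N -> (forall k, 0 <= u k) ->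
  (\esum_(k in [set: int]) (u k)%:E =
   \sum_(j < N) \esum_(l in [set: int]) (u (j%:Z + N%:Z * l))%:E)%E.
Proof.
move=> N0 u0.
have bij : set_bij ([set: 'I_N] `*` [set: int]) [set: int] (fun p => (p.1 : nat)%:Z + N%:Z * p.2).
  split => //.
    move=> [j l] [j' l'] _ _ /= h.
    have hj := ltn_ord j; have hj' := ltn_ord j'.
    have ll : l = l' by nia.
    by move: h; rewrite ll => /addIr [] /val_inj ->.
  move=> k _; have h : (absz (k %% N%:Z)%Z < N)%N.
    by have := @ltz_pmod k N%:Z; have := @modz_ge0 k N%:Z; lia.
  exists (Ordinal h, (k %/ N%:Z)%Z) => //=.
  have := divz_eq k N%:Z; have := @modz_ge0 k N%:Z; lia.
rewrite (reindex_esum _ _ _ _ bij).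
rewrite (_ : [set: 'I_N] `*` [set: int] = [set: 'I_N] `*`` (fun=> [set: int])); last first.
  by apply/seteqP; split => p.
rewrite -(@esum_esum R 'I_N int setT (fun=> setT) (fun j l => (u ((j : nat)%:Z + N%:Z * l))%:E)); last first.
  by move=> j l _ _; rewrite lee_fin.
rewrite esum_fset; [|exact: finite_finset|by move=> j _; apply: esum_ge0 => l _; rewrite lee_fin].
exact: fsbig_finType.
Qed.

Lemma csum_residues a (N : nat) : (0 < N)%N ->
  (forall j : 'I_N, csummable (fun l => a (j%:Z + N%:Z * l))) ->
  csummable a /\ csum a = \sum_(j < N) csum (fun l => a (j%:Z + N%:Z * l)).
Proof.
move=> N0 sa.
have sumfin (u : int -> R) : (forall k, 0 <= u k <= normc (a k)) ->
    (forall j : 'I_N, \esum_(l in [set: int]) (u (j%:Z + N%:Z * l))%:E \is a fin_num)%E.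
  move=> ua j; rewrite ge0_fin_numE; last first.
    by apply: esum_ge0 => l _; rewrite lee_fin; have /andP[] := ua (j%:Z + N%:Z * l).
  apply: le_lt_trans (sa j); apply: le_esum => l _.
  by rewrite abse_EFin lee_fin (ger0_norm (normc_ge0 _)); have /andP[] := ua (j%:Z + N%:Z * l).
have na k : 0 <= normc (a k) <= normc (a k) by rewrite normc_ge0 lexx.
have res (u : int -> R) : (forall k, 0 <= u k <= normc (a k)) ->
    fine (\esum_(k in [set: int]) (u k)%:E) =
    \sum_(j < N) fine (\esum_(l in [set: int]) (u (j%:Z + N%:Z * l))%:E).
  move=> ua; rewrite (esum_residues N0); last by move=> k; have /andP[] := ua k.
  by rewrite sum_fine// => j _; exact: sumfin.
have resr (u : int -> R) : (forall k, `|u k| <= normc (a k)) ->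
    rsum u = \sum_(j < N) rsum (fun l => u (j%:Z + N%:Z * l)).
  move=> ua; rewrite /rsum !res ?sumrB// => k.
  - by rewrite funrneg_ge0/= (le_trans _ (ua k))// /funrneg ge_max normr_ge0 andbT -normrN ler_norm.
  - by rewrite funrpos_ge0/= (le_trans _ (ua k))// /funrpos ge_max normr_ge0 andbT ler_norm.
split.
  rewrite /csummable /summable; under eq_esum do rewrite abse_EFin (ger0_norm (normc_ge0 _)).
  rewrite (esum_residues N0); last by move=> k; exact: normc_ge0.
  rewrite -ge0_fin_numE; last by apply: sume_ge0 => j _; apply: esum_ge0 => l _; rewrite lee_fin normc_ge0.
  by apply/sum_fin_numP => j _ _; exact: (sumfin _ na).
apply: complex_eq; rewrite /csum /=.
  by rewrite (resr _ (fun k => normc_Re (a k))) [RHS]Re_sum.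
by rewrite (resr _ (fun k => normc_Im (a k))) [RHS]Im_sum.
Qed.

End complex_sums.

(** * Periodization and biorthogonality *)

Section complex_periodization.
Context {R : realType}.
Variable v : R.
Hypothesis v0 : 0 < v.
Local Notation mu := (@lebesgue_measure R).
Local Notation D := (period_itv v).
Local Notation L := (2 * (pi / v)).
Let mD : measurable D := measurable_period_itv v.
Implicit Types P U : R -> R[i].

Definition orbit_sum P (x : R) : R[i] := csum (fun k => P (x + k%:~R * L)).

Lemma wave_period m x k : wave v m (x + k%:~R * L) = wave v m x.
Proof.
rewrite /wave mulrDr expiD (_ : m%:~R * v * (k%:~R * L) = 2 * (m * k)%:~R * pi).
  by rewrite expi_2pi mulr1.
by rewrite intrM; move: pi => p; field; rewrite gt_eqF.
Qed.

Lemma orbit_sum_period P x j : orbit_sum P (x + j%:~R * L) = orbit_sum P x.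
Proof.
rewrite /orbit_sum -[RHS](csum_shift _ j); congr csum; apply/funext => k.
by congr (P _); rewrite intrD (mulrDl k%:~R) addrA addrAC.
Qed.

Lemma ae_csummable_orbit P : cmeasurable_fun P -> cintegrable setT P ->
  {ae mu, forall x, csummable (fun k => P (x + k%:~R * L))}.
Proof.
move=> [mr mi] [ir ii].
apply: (ae_lebesgueS2 _ (ae_summable_orbit v0 mr ir) (ae_summable_orbit v0 mi ii)) => x.
exact: csummable_ReIm.
Qed.

Lemma cmeasurable_orbit_sum P : cmeasurable_fun P -> cmeasurable_fun (orbit_sum P).
Proof.
have part (g : R -> R) : measurable_fun setT g ->
    measurable_fun setT (fun x : R => rsum (fun k => g (x + k%:~R * L))).
  move=> mg; apply: measurable_funB; apply: measurableT_comp => //.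
    have mp : measurable_fun setT g^\+ by exact: measurable_funrpos.
    exact: (measurable_orbit_esum v mp (funrpos_ge0 g)).
  have mn : measurable_fun setT g^\- by exact: measurable_funrneg.
  exact: (measurable_orbit_esum v mn (funrneg_ge0 g)).
by move=> [mr mi]; split; [exact: (part _ mr)|exact: (part _ mi)].
Qed.

(** The sum U is a parameter because it is applied both to the periodization and to
its products with waves. *)
Lemma integral_periodization P U : cmeasurable_fun P -> cintegrable setT P ->
  cmeasurable_fun U ->
  {ae mu, forall x, ccvg (fun n => \sum_(k <- zrange n) P (x + k%:~R * L)) (U x)} ->
  cintegrable D U /\ integralC D U = integralC setT P.
Proof.
move=> [mr mi] [ir ii] [mur mui] cU.
have [] := periodization_integral v0 mr ir (measurable_funTS mur).
  by apply: ae_lebesgueS cU => x [+ _]; under eq_fun do rewrite Re_sum.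
move=> iUr eqr.
have [] := periodization_integral v0 mi ii (measurable_funTS mui).
  by apply: ae_lebesgueS cU => x [_]; under eq_fun do rewrite Im_sum.
by move=> iUi eqi; split; [split|rewrite /integralC eqr eqi].
Qed.

Lemma cintegrable_unimodular P (g : R -> R[i]) : cmeasurable_fun P -> cintegrable setT P ->
  cmeasurable_fun g -> (forall x, normc (g x) = 1) -> cintegrable setT (fun x => P x * g x).
Proof.
move=> mP [ir ii] mg g1.
apply: (@cintegrable_le _ _ _ (fun x => `|Re (P x)| + `|Im (P x)|)) => //.
- exact: cmeasurableM.
- apply: (@eq_integrable _ _ _ mu setT measurableT
    (fun x => `|(Re (P x))%:E| + `|(Im (P x))%:E|)%E) => //.
  by apply: integrableD => //; apply: integrable_abse.
- by move=> x _; rewrite Normc.normcM g1 mulr1 normc_le_ReIm.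
Qed.

(** The Fourier coefficients of the periodization are the integrals of P against
the waves over the line, because the waves are periodic.  They equal those of
the constant 1 exactly when the periodization is 1. *)
Lemma orbit_sum_eq1P P : cmeasurable_fun P -> cintegrable setT P ->
  {ae mu, forall x, orbit_sum P x = 1} <->
  (forall m, integralC setT (fun x => P x * wave v m x) = (if m == 0 then L else 0)%:C).
Proof.
move=> mP iP.
have mw m := @cmeasurable_wave R v m.
have iPw m := cintegrable_unimodular mP iP (mw m) (normc_wave v m).
have mPw m : cmeasurable_fun (fun x => P x * wave v m x) by exact: cmeasurableM.
have cw m : {ae mu, forall x, ccvg (fun n => \sum_(k <- zrange n)
    (P (x + k%:~R * L) * wave v m (x + k%:~R * L))) (orbit_sum P x * wave v m x)}.
  apply: ae_lebesgueS (ae_csummable_orbit mP iP) => x /csum_cvg/(ccvgZ (wave v m x)).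
  move=> h; rewrite [orbit_sum P x * _]mulrC.
  rewrite (_ : (fun n => _) = (fun n => wave v m x * \sum_(k <- zrange n) P (x + k%:~R * L)))//.
  apply/funext => n; rewrite mulr_sumr.
  by apply: eq_bigr => k _; rewrite wave_period mulrC.
split=> [U1 m|h].
  rewrite -integral_wave//; apply/esym; apply: (integral_periodization (mPw m) (iPw m) (mw m) _).2.
  by apply: (ae_lebesgueS2 _ U1 (cw m)) => x ->; rewrite mul1r.
have mU := cmeasurable_orbit_sum mP.
have mU1 : cmeasurable_fun (fun x => orbit_sum P x - 1).
  by apply: cmeasurableB => //; exact: cmeasurable_cst.
have iw m : cintegrable D (wave v m).
  apply: (@cintegrable_le _ _ _ (fun=> 1)) => //; first exact: integrable_period_cst.
  by move=> x _; rewrite normc_wave.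
have EU m := integral_periodization (mPw m) (iPw m) (cmeasurableM mU (mw m)) (cw m).
have iU : cintegrable D (orbit_sum P).
  have := (EU 0).1; congr (cintegrable _ _); apply/funext => x.
  by rewrite wave0 mulr1.
have i1 : cintegrable D (fun=> 1 : R[i]).
  by have := iw 0; congr (cintegrable _ _); apply/funext => x; rewrite wave0.
have : {ae mu, forall x, D x -> orbit_sum P x - 1 = 0}.
  apply: fourier_uniqueness => //; first exact: cintegrableB.
  move=> m; rewrite (@eq_integralC _ _ _ (fun x => orbit_sum P x * wave v m x - wave v m x)).
    rewrite integralCB//; last exact: (EU m).1.
    by rewrite (EU m).2 h integral_wave// subrr.
  by move=> x _; rewrite mulrBl mul1r.
move=> h1; have : {ae mu, forall x, orbit_sum P x - 1 = 0}.
  by apply: (ae_period_itv v0) h1 => x k; rewrite orbit_sum_period.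
by apply: ae_lebesgueS => x /subr0_eq.
Qed.

End complex_periodization.

Section biorthogonality.
Context {R : realType}.
Local Notation mu := (@lebesgue_measure R).

Lemma conj_modulation_mul (a b : R) (z w : R[i]) :
  (expi (- a) * z)^* * (expi (- b) * w) = z^* * w * expi (a - b).
Proof.
rewrite expiD; apply: complex_eq; rewrite !ReImE /expi /= !cosN !sinN;
  ring.
Qed.

Lemma sumZ_isP (u : int -> R[i]) s : csummable u -> sumZ_is u s <-> csum u = s.
Proof.
move=> su; rewrite /sumZ_is.
have -> : (fun n => \sum_(k < n.*2.+1) u (k%:Z - n%:Z) : R[i]^o) =
    (fun n => \sum_(k <- zrange n) u k).
  by apply/funext => n; exact: (big_zrange u).
split=> [[_ /ccvgP]|<-]; first exact: csum_unique.
by split=> //; apply/ccvgP; exact: csum_cvg.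
Qed.

Lemma cmeasurable_conj_mul (g g' : R -> R[i]) : L2 g -> L2 g' ->
  cmeasurable_fun (fun x => (g x)^* * g' x).
Proof.
by move=> /L2P[mg _] /L2P[mg' _]; apply: cmeasurableM => //; exact: cmeasurableJ.
Qed.

Lemma cintegrable_conj_mul (g g' : R -> R[i]) : L2 g -> L2 g' ->
  cintegrable setT (fun x => (g x)^* * g' x).
Proof.
move=> /L2P[mg eg] /L2P[mg' eg'].
have ie (h : R -> R[i]) : cmeasurable_fun h -> (energy h < +oo)%E ->
    mu.-integrable setT (fun t => (normc (h t) ^+ 2)%:E).
  move=> mh eh; apply/integrableP; split.
    by apply/measurable_EFinP; exact: measurable_sqr_normc.
  by under eq_integral do rewrite gee0_abs ?lee_fin ?sqr_ge0//.
apply: (@cintegrable_le _ _ _ (fun x => normc (g x) ^+ 2 + normc (g' x) ^+ 2)) => //.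
- by apply: cmeasurable_conj_mul; apply/L2P.
- apply: (@eq_integrable _ _ _ mu setT measurableT
    (fun x => (normc (g x) ^+ 2)%:E + (normc (g' x) ^+ 2)%:E)%E) => //.
  by apply: integrableD => //; exact: ie.
- move=> x _; rewrite Normc.normcM normc_conj.
  have := sqr_ge0 (normc (g x) - normc (g' x)).
  have := normc_ge0 (g x); have := normc_ge0 (g' x); nra.
Qed.

(** A translation by k becomes multiplication by e^(- i k x) on the Fourier side.
The period is written 2 * (pi / 1) as the case of frequency 1 of the general
period. *)
Lemma biorthogonalP phi phi' g g' : transform_pair phi g -> transform_pair phi' g' ->
  biorthogonal phi phi' <->
  (forall m, integralC setT (fun x => (g x)^* * g' x * wave 1 m x) =
     (if m == 0 then 2 * (pi / 1) else 0)%:C :> R[i]).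
Proof.
move=> T T'.
have E k l : (2 * pi)%:C * inner (translate k phi) (translate l phi') =
    integralC setT (fun x => (g x)^* * g' x * wave 1 (k - l) x).
  rewrite -(transform_pair_inner (transform_pair_shift k%:~R T) (transform_pair_shift l%:~R T')).
  apply: eq_integralC => x _; rewrite /wave mulr1 intrB mulrBl.
  exact: conj_modulation_mul.
have p0 : (2 * pi)%:C != 0 :> R[i].
  by rewrite eq_complex /= negb_and mulf_neq0 ?pnatr_eq0 // gt_eqF ?pi_gt0.
split=> [B m|h k l].
  have := E m 0; rewrite subr0 B => <-; rewrite divr1.
  by case: eqP => _; rewrite ?mulr1 ?mulr0.
apply: (mulfI p0); rewrite E h divr1 subr_eq0.
by case: eqP => _; rewrite ?mulr1 ?mulr0.
Qed.

Lemma biorthogonal_orbit_sum phi phi' g g' : transform_pair phi g -> transform_pair phi' g' ->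
  biorthogonal phi phi' <->
  {ae mu, forall x, orbit_sum 1 (fun x => (g x)^* * g' x) x = 1}.
Proof.
move=> T T'; have [_ Lg _] := T; have [_ Lg' _] := T'.
rewrite (biorthogonalP T T'); split; apply orbit_sum_eq1P => //.
- exact: cmeasurable_conj_mul.
- exact: cintegrable_conj_mul.
- exact: cmeasurable_conj_mul.
- exact: cintegrable_conj_mul.
Qed.

Lemma periodized_product_orbit_sum (g g' : R -> R[i]) : L2 g -> L2 g' ->
  periodized_product_is1 g g' <->
  {ae mu, forall x, orbit_sum 1 (fun x => (g x)^* * g' x) x = 1}.
Proof.
move=> Lg Lg'.
have mP := cmeasurable_conj_mul Lg Lg'.
have sP := ae_csummable_orbit ltr01 mP (cintegrable_conj_mul Lg Lg').
have E x k : x + 2 * k%:~R * pi = x + k%:~R * (2 * (pi / 1)) :> R by rewrite divr1; ring.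
rewrite /periodized_product_is1.
split; apply: (ae_lebesgueS2 _ sP) => x sx.
  by under eq_fun do rewrite E; move/(sumZ_isP _ sx).
by move=> Ox; under eq_fun do rewrite E; apply/(sumZ_isP _ sx).
Qed.

End biorthogonality.

(** * The transfer operator on the line *)

Section roots_on_the_circle.
Context {R : realType}.
Variable N : nat.
Hypothesis N0 : (0 < N)%N.
Implicit Types x t : R.

(** For 0 <= k < N these angles represent the N-th roots of the point with angle x. *)
Definition preimage_pt x (k : int) : R := N%:R^-1 * (x + k%:~R * (2 * (pi / 1))).

Lemma expiX t n : expi t ^+ n = expi (n%:R * t) :> R[i].
Proof.
elim: n => [|n IH]; first by rewrite mul0r expi0 expr0.
by rewrite exprS IH -expiD -[in RHS]natr1 mulrDl mul1r addrC.
Qed.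

(** From cos t = 1 - 2 sin^2 (t / 2), and t / 2 lies strictly between - pi and pi. *)
Lemma expi_eq1 t : `|t| < 2 * pi -> expi t = 1 -> t = 0.
Proof.
move=> tp [c1 _]; apply/eqP; apply: contraT => t0.
have s2 : sin (t / 2) = 0.
  apply/eqP; rewrite -sqrf_eq0; apply/eqP.
  move: c1; rewrite {1}[t]splitr cosD -!expr2.
  have := cos2Dsin2 (t / 2); nra.
have s2' : sin (`|t| / 2) = 0.
  by case: (ger0P t) => _ //; rewrite mulNr sinN s2 oppr0.
have := @sin_gt0_pi R (`|t| / 2); rewrite s2' ltxx => h; apply: h.
by rewrite divr_gt0 ?normr_gt0//= ltr_pdivrMr// mulrC.
Qed.

Lemma circ_preimage_exp x k : circ (preimage_pt x k) ^+ N = circ x.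
Proof.
rewrite /circ /preimage_pt expiX mulrN mulVKf ?pnatr_eq0 -?lt0n// divr1 opprD expiD.
rewrite (_ : - (k%:~R * (2 * pi)) = 2 * (- k)%:~R * pi) ?expi_2pi ?mulr1//.
by rewrite mulrNz; ring.
Qed.

Lemma circ_preimage_inj x (j j' : 'I_N) :
  circ (preimage_pt x j%:Z) = circ (preimage_pt x j'%:Z) -> j = j'.
Proof.
rewrite /circ => h.
have e1 : expi (preimage_pt x j%:Z - preimage_pt x j'%:Z) = 1.
  by rewrite expiD mulrC -h expiN.
have dE : preimage_pt x j%:Z - preimage_pt x j'%:Z = (j%:R - j'%:R) / N%:R * (2 * pi).
  by rewrite /preimage_pt divr1 -!pmulrn; move: pi => p; field; rewrite pnatr_eq0 -lt0n.
have N0' : 0 < N%:R :> R by rewrite ltr0n.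
have := expi_eq1 _ e1; rewrite dE => /(_ _)/eqP.
rewrite !mulf_eq0 invr_eq0 subr_eq0 eqr_nat (gt_eqF (pi_gt0 R)) pnatr_eq0 (gtn_eqF N0) !orbF /=.
rewrite (pnatr_eq0 R 2) orbF => h2; apply/val_inj/eqP/h2.
rewrite normrM (ger0_norm (_ : 0 <= 2 * pi)) ?mulr_ge0 ?pi_ge0//.
rewrite gtr_pMl ?mulr_gt0 ?pi_gt0//.
rewrite normrM normfV (ger0_norm (ltW N0')) ltr_pdivrMr// mul1r.
have hj : (j%:R : R) < N%:R by rewrite ltr_nat.
have hj' : (j'%:R : R) < N%:R by rewrite ltr_nat.
have j0 : 0 <= (j%:R : R) by []. have j0' : 0 <= (j'%:R : R) by [].
by rewrite ltr_norml; apply/andP; split; lra.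
Qed.

(** The N distinct roots already found exhaust the roots of X^N - z. *)
Lemma circ_preimage_onto x (w : R[i]) : w ^+ N = circ x ->
  exists j : 'I_N, circ (preimage_pt x j%:Z) = w.
Proof.
move=> wN; apply: contrapT => nw.
pose rs := [seq circ (preimage_pt x (j : 'I_N)%:Z) | j <- enum 'I_N].
pose p : {poly R[i]} := ('X^N - (circ x)%:P)%R.
have sp : size p = N.+1 by rewrite size_XnsubC.
have p0 : p != 0 by rewrite -size_poly_eq0 sp.
have rp u : u ^+ N = circ x -> root p u.
  by move=> uN; rewrite /root /p !hornerE uN subrr.
have := max_poly_roots (rs := w :: rs) p0.
rewrite sp /= size_map size_enum_ord ltnn => -/(_ _ _)/negP; apply => //.
  by rewrite rp//=; apply/allP => _ /mapP[j _ ->]; apply: rp; exact: circ_preimage_exp.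
apply/andP; split.
  by apply/negP => /mapP[j _ wE]; apply: nw; exists j.
rewrite map_inj_uniq ?enum_uniq// => j j'; exact: circ_preimage_inj.
Qed.

Lemma ruelle_circ (m0 m0' f : R[i] -> R[i]) x :
  ruelle N m0 m0' f (circ x) = N%:R^-1 * \sum_(j < N)
   ((m0 (circ (preimage_pt x j%:Z)))^* * m0' (circ (preimage_pt x j%:Z)) *
     f (circ (preimage_pt x j%:Z))).
Proof.
rewrite /ruelle; congr (_ * _).
rewrite (@reindex_fsbig _ _ _ 'I_N R[i] (fun j => circ (preimage_pt x j%:Z)) setT); last first.
  split.
  - by move=> j _ /=; exact: circ_preimage_exp.
  - by move=> j j' _ _; exact: circ_preimage_inj.
  - by move=> w /= /circ_preimage_onto[j <-]; exists j.
exact: fsbig_finType.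
Qed.

End roots_on_the_circle.

Section refinement.
Context {R : realType}.
Local Notation mu := (@lebesgue_measure R).
Local Notation L := (2 * (pi / 1)).

Lemma circ_period (x : R) (k : int) : circ (x + k%:~R * L) = circ x.
Proof.
rewrite /circ divr1 opprD expiD (_ : - (k%:~R * (2 * pi)) = 2 * (- k)%:~R * pi).
  by rewrite expi_2pi mulr1.
by rewrite mulrNz; ring.
Qed.

(** Dilation by N on one side is dilation by 1 / N on the other; the two
descriptions of the transform of the dilated function agree almost everywhere. *)
Lemma scaling_fourier (N : nat) (m : R[i] -> R[i]) (phi phihat : R -> R[i]) : (0 < N)%N ->
  is_fourier phi phihat -> mult_rep m phi (dilation N phi) ->
  {ae mu, forall w, (Num.sqrt N%:R)%:C * phihat (N%:R * w) = m (circ w) * phihat w}.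
Proof.
move=> N0 /transform_pair_of_fourier T [g /transform_pair_of_fourier Tg /transform_pair_of_fourier Td].
have Np : 0 < N%:R :> R by rewrite ltr0n.
have Ni : 0 < N%:R^-1 :> R by rewrite invr_gt0.
have := transform_pairZ ((Num.sqrt N%:R)^-1%:C) (transform_pair_scale Ni T).
have -> : (fun x => (Num.sqrt N%:R)^-1%:C * phi (N%:R^-1 * x)) = dilation N phi.
  by apply/funext => x; rewrite /dilation [x / _]mulrC.
move=> /transform_pair_unique/(_ Td) E1.
apply: (ae_lebesgueS2 _ (transform_pair_unique Tg T) E1) => w <-.
rewrite invrK => <-; rewrite mulrA; congr (_ * _).
rewrite -[RHS]rmorphM/=; congr (_%:C).
by rewrite -{3}(sqr_sqrtr (ltW Np)) expr2 mulKf// gt_eqF// sqrtr_gt0.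
Qed.

Lemma scaling_product (N : nat) (a a' : R[i]) (u u' p p' : R[i]) :
  (Num.sqrt N%:R)%:C * u = a * p -> (Num.sqrt N%:R)%:C * u' = a' * p' ->
  N%:R * (u^* * u') = a^* * a' * (p^* * p').
Proof.
move=> h h'.
have sN : N%:R = (Num.sqrt N%:R)%:C * (Num.sqrt N%:R)%:C :> R[i].
  by rewrite -rmorphM/= -expr2 sqr_sqrtr ?ler0n// rmorph_nat.
have hc : (Num.sqrt N%:R)%:C * u^* = a^* * p^*.
  by rewrite -[RHS]rmorphM/= -h; apply: complex_eq; rewrite !ReImE/=; ring.
by rewrite sN mulrACA hc h' mulrACA.
Qed.

(** With k = j + N l, the point (x + L k) / N is the j-th preimage translated by L l,
and the scaling relation replaces P(x + L k) by M P / N there.  M is periodic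
and comes out of the sum over l. *)
Lemma csum_refine (N : nat) (P M G E : R -> R[i]) : (0 < N)%N ->
  (forall w k, M (w + k%:~R * L) = M w) ->
  {ae mu, forall w, N%:R * P (N%:R * w) = M w * P w} ->
  {ae mu, forall y, csummable (fun k => P (y + k%:~R * L) * G (y + k%:~R * L)) /\
     csum (fun k => P (y + k%:~R * L) * G (y + k%:~R * L)) = E y} ->
  {ae mu, forall x, csummable (fun k => P (x + k%:~R * L) * G (N%:R^-1 * (x + k%:~R * L))) /\
     csum (fun k => P (x + k%:~R * L) * G (N%:R^-1 * (x + k%:~R * L))) =
       N%:R^-1 * \sum_(j < N) M (preimage_pt N x j%:Z) * E (preimage_pt N x j%:Z)}.
Proof.
move=> N0 Mper PM GE.
have Np : 0 < N%:R :> R by rewrite ltr0n.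
have Ni : 0 < N%:R^-1 :> R by rewrite invr_gt0.
have N0c : N%:R != 0 :> R[i] by rewrite pnatr_eq0 -lt0n.
have at_preimages (Q : R -> Prop) : {ae mu, forall y, Q y} ->
    {ae mu, forall x, forall k, Q (preimage_pt N x k)}.
  move=> aeQ; apply: ae_forall_int => k.
  exact: (ae_shift (k%:~R * L) (ae_scale Ni aeQ)).
apply: (ae_lebesgueS2 _ (at_preimages _ PM) (at_preimages _ GE)) => x PMx GEx.
set a := fun k => _.
have aE (j : 'I_N) l : a (j%:Z + N%:Z * l) =
    (N%:R^-1 * M (preimage_pt N x j%:Z)) *
    (P (preimage_pt N x j%:Z + l%:~R * L) * G (preimage_pt N x j%:Z + l%:~R * L)).
  have zE : preimage_pt N x (j%:Z + N%:Z * l) = preimage_pt N x j%:Z + l%:~R * L.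
    rewrite /preimage_pt intrD intrM -!pmulrn; move: (2 * (pi / 1)) => q.
    by field; rewrite gt_eqF.
  have := PMx (j%:Z + N%:Z * l); rewrite /a -/(preimage_pt N x (j%:Z + N%:Z * l)).
  rewrite {1}/preimage_pt mulVKf ?gt_eqF// zE Mper => h.
  by rewrite -[P (x + _)](mulKf N0c) h !mulrA.
have sa (j : 'I_N) : csummable (fun l => a (j%:Z + N%:Z * l)).
  by under eq_fun do rewrite aE; apply: csummableZ; exact: (GEx j%:Z).1.
have [s1 ->] := csum_residues N0 sa; split => //.
rewrite mulr_sumr; apply: eq_bigr => j _.
under eq_fun do rewrite aE.
have [sj Ej] := GEx j%:Z; rewrite -Ej [RHS]mulrA.
exact: (csumZ (N%:R^-1 * M (preimage_pt N x j%:Z)) sj).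
Qed.

End refinement.

(** * Fixed points are constant *)

Section dominated_sums.
Context {R : realType}.
Implicit Types a : int -> R[i].

Lemma normc_sum_le (s : seq int) a : normc (\sum_(k <- s) a k) <= \sum_(k <- s) normc (a k).
Proof.
elim: s => [|k s IH]; first by rewrite !big_nil Normc.normc0.
by rewrite !big_cons (le_trans (le_normcD _ _))// lerD2l.
Qed.

(** Real and imaginary parts are bounded separately, whence the factor 2. *)
Lemma csum_normc_le a (C : R) n0 : csummable a ->
  (forall m, (n0 <= m)%N -> normc (\sum_(k <- zrange m) a k) <= C) -> normc (csum a) <= C * 2.
Proof.
move=> sa aC; have [rl jl] := csum_cvg sa.
apply: (le_trans (normc_le_ReIm _)); rewrite mulr_natr mulr2n; apply: lerD.
  apply: (ler_cvg_to (cvg_norm rl) (cvg_cst C)).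
  by exists n0 => // m /= nm; apply: le_trans (aC _ nm); exact: normc_Re.
apply: (ler_cvg_to (cvg_norm jl) (cvg_cst C)).
by exists n0 => // m /= nm; apply: le_trans (aC _ nm); exact: normc_Im.
Qed.

(** Splits off the terms beyond n, where d is only known to be bounded. *)
Lemma sum_normc_tail a (d : int -> R[i]) (B : R) n m : (n <= m)%N ->
  (forall k, normc (d k) <= B) ->
  \sum_(k <- zrange m) normc (a k * d k) <=
  \sum_(k <- zrange n) normc (a k * d k) +
  B * (\sum_(k <- zrange m) normc (a k) - \sum_(k <- zrange n) normc (a k)).
Proof.
move=> nm dB; rewrite !(zrange_widen _ nm).
rewrite [in leLHS](bigID [pred k | k \in zrange n])/= lerD2l.
rewrite [\sum_(k <- zrange m) normc (a k)](bigID [pred k | k \in zrange n])/= addrAC subrr add0r mulr_sumr.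
by apply: ler_sum => k _; rewrite Normc.normcM mulrC ler_wpM2r ?normc_ge0.
Qed.

(** Tannery's theorem, for sums that do not depend on n: the limit may be taken
term by term because the terms are dominated by B times an absolutely
convergent series. *)
Lemma csum_tannery a (b : nat -> int -> R[i]) (B : R) (beta s : R[i]) :
  csummable a -> (forall n k, normc (b n k) <= B) ->
  (forall k, normc (b n k - beta) @[n --> \oo] --> (0 : R)) ->
  (forall n, csummable (fun k => a k * b n k) /\ csum (fun k => a k * b n k) = s) ->
  s = beta * csum a.
Proof.
move=> sa bB bcvg sE.
pose d n k := b n k - beta; pose B' := B + normc beta.
have dB n k : normc (d n k) <= B'.
  by rewrite (le_trans (le_normcD _ _))// normcN lerD2r.
have B'0 : 0 <= B' by apply: le_trans (dB 0 0); exact: normc_ge0.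
have sd n : csummable (fun k => a k * d n k) /\ csum (fun k => a k * d n k) = s - beta * csum a.
  have sad : csummable (fun k => a k * d n k).
    have -> : (fun k => a k * d n k) = (fun k => a k * b n k + - beta * a k).
      by apply/funext => k; rewrite /d; ring.
    have := csummableZ (- beta) sa; have := (sE n).1; rewrite /csummable => h1 h2.
    have := lte_add_pinfty h1 h2; rewrite -esumD//; apply: le_lt_trans; apply: le_esum => k _.
    by rewrite !abse_EFin -EFinD lee_fin !(ger0_norm (normc_ge0 _)) le_normcD.
  split=> //; apply: csum_unique => //.
  have [r1 j1] := csum_cvg (sE n).1; have [r2 j2] := ccvgZ beta (csum_cvg sa).
  have dsum m : \sum_(k <- zrange m) a k * d n k =
      \sum_(k <- zrange m) a k * b n k - beta * \sum_(k <- zrange m) a k.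
    by rewrite mulr_sumr -sumrB; apply: eq_bigr => k _; rewrite /d; ring.
  rewrite -(sE n).2; split.
    by under eq_fun do rewrite dsum Re_subc; rewrite Re_subc; exact: cvgB.
  by under eq_fun do rewrite dsum Im_subc; rewrite Im_subc; exact: cvgB.
apply/eqP; rewrite -subr_eq0; apply/eqP/Normc.eq0_normc/eqP.
rewrite eq_le normc_ge0 andbT; apply/ler_addgt0Pl => e e0; rewrite addr0.
have e4 : 0 < e / 4 by rewrite divr_gt0.
pose S n := \sum_(k <- zrange n) normc (a k).
pose T := fine (\esum_(k in [set: int]) (normc (a k))%:E).
have eT : (\esum_(k in [set: int]) (normc (a k))%:E = T%:E)%E.
  rewrite fineK// ge0_fin_numE; last by apply: esum_ge0 => k _; rewrite lee_fin normc_ge0.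
  by apply: le_lt_trans sa; apply: le_esum => k _; rewrite abse_EFin lee_fin ler_norm.
have ST : S n @[n --> \oo] --> T.
  by have := zrange_esum (fun k => normc_ge0 (a k)); rewrite eT => /fine_cvgP[].
have ST_le n : S n <= T.
  apply: (ler_cvg_to (cvg_cst (S n)) ST); exists n => // m /= nm.
  by apply: zrange_sum_le => // k; exact: normc_ge0.
have [n0 Tn0] : exists n0, B' * (T - S n0) <= e / 4.
  have : B' * (T - S n) @[n --> \oo] --> B' * (T - T).
    by apply: cvgM; [exact: cvg_cst|apply: cvgB => //; exact: cvg_cst].
  rewrite subrr mulr0 => /cvgrPdist_lt/(_ _ e4)[n0 _ /(_ n0 (leqnn _))/=].
  by rewrite sub0r normrN => h; exists n0; apply: ltW; apply: le_lt_trans h; exact: ler_norm.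
have [n hn] : exists n, \sum_(k <- zrange n0) normc (a k * d n k) <= e / 4.
  have : \sum_(k <- zrange n0) normc (a k * d n k) @[n --> \oo] --> (0 : R).
    elim: (zrange n0) => [|k r IH].
      by under eq_fun do rewrite big_nil; exact: cvg_cst.
    under eq_fun do rewrite big_cons Normc.normcM.
    have : normc (a k) * normc (d n k) + \sum_(j <- r) normc (a j * d n j) @[n --> \oo] -->
        normc (a k) * 0 + 0.
      by apply: cvgD => //; apply: cvgM; [exact: cvg_cst|exact: bcvg].
    by rewrite mulr0 addr0.
  move=> /cvgrPdist_lt/(_ _ e4)[n _ /(_ n (leqnn _))/=].
  by rewrite sub0r normrN => h; exists n; apply: ltW; apply: le_lt_trans h; exact: ler_norm.
rewrite -(sd n).2.
have -> : e = (e / 4 + e / 4) * 2 by field.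
apply: (csum_normc_le (n0 := n0)); first exact: (sd n).1.
move=> m nm; apply: (le_trans (normc_sum_le _ _)); apply: (le_trans (sum_normc_tail a nm (dB n))).
apply: lerD => //; apply: le_trans Tn0; rewrite ler_wpM2l// lerD2r.
exact: ST_le.
Qed.

End dominated_sums.

Section fixed_points.
Context {R : realType}.
Local Notation mu := (@lebesgue_measure R).
Local Notation L := (2 * (pi / 1)).

Lemma LinftyT_ae_bounded (h : R[i] -> R[i]) : LinftyT h ->
  exists B : R, {ae mu, forall w, normc (h (circ w)) <= B}.
Proof.
move=> [_]; rewrite /LnormC unlock.
have -> : (0 < mu [set: R])%E.
  apply: (@lt_le_trans _ _ (mu (period_itv 1))).
    by rewrite lebesgue_measure_period_itv// lte_fin period_gt0.
  by apply: le_measure => //; rewrite inE//; exact: measurable_period_itv.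
have := @ess_sup_ge _ (measurableTypeR R) R mu (abse \o (fun w => (normc (h (circ w)))%:E)).
set S := ess_sup _ _; case: S => [r| |] hS // _.
  exists r; apply: ae_lebesgueS hS => w /=; rewrite lee_fin; apply: le_trans; exact: ler_norm.
by exists 0; apply: ae_lebesgueS hS.
Qed.

Lemma LinftyT_cst (c : R[i]) : LinftyT (fun=> c).
Proof.
split; first exact: cmeasurable_cst.
rewrite /LnormC unlock; case: ifP => // _.
apply: (@le_lt_trans _ _ (normc c)%:E); last exact: ltry.
by apply/ess_supP/aeW => w /=; rewrite ger0_norm ?normc_ge0.
Qed.

Lemma ccvg_normc (s : nat -> R[i]) l : ccvg s l -> normc (s n - l) @[n --> \oo] --> (0 : R).
Proof.
move=> [rl jl].
have z : `|Re (s n) - Re l| + `|Im (s n) - Im l| @[n --> \oo] --> (0 : R).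
  rewrite -[X in _ --> X]addr0 -(normr0 R).
  apply: cvgD; apply: cvg_norm.
    by rewrite -(subrr (Re l)); apply: cvgB => //; exact: cvg_cst.
  by rewrite -(subrr (Im l)); apply: cvgB => //; exact: cvg_cst.
apply: (squeeze_cvgr _ (cvg_cst 0) z); apply: nearW => n.
by rewrite normc_ge0 -Re_subc -Im_subc normc_le_ReIm.
Qed.

Lemma circ_scaled_cvg (q y : R) : `|q| < 1 -> ccvg (fun n => circ (q ^+ n * y)) 1.
Proof.
move=> q1.
have z : - (q ^+ n * y) @[n --> \oo] --> (0 : R).
  rewrite -oppr0 -(mul0r y); apply: cvgN; apply: cvgM; last exact: cvg_cst.
  exact: cvg_expr.
rewrite /ccvg /circ /expi /=; split.
  have := @cvg_comp _ _ _ _ (@cos R) _ _ _ z (@continuous_cos R 0).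
  by rewrite cos0.
have := @cvg_comp _ _ _ _ (@sin R) _ _ _ z (@continuous_sin R 0).
by rewrite sin0.
Qed.

Lemma circle_cvg_normc (g : R[i]^o -> R[i]^o) (s : nat -> R[i]) :
  g z @[z --> within circle (nbhs (1 : R[i]^o))] --> g 1 ->
  (forall n, normc (s n) = 1) -> ccvg s 1 -> normc (g (s n) - g 1) @[n --> \oo] --> (0 : R).
Proof.
move=> gc s1 sc; apply: ccvg_normc; apply/ccvgP => A /gc wA.
have /ccvgP/(_ _ wA) := sc.
by apply: (@filterS _ _ _ [set n | circle (s n) -> A (g (s n))]) => n; apply; exact: s1.
Qed.

Variables (N : nat) (m0 m0' : R[i] -> R[i]) (P : R -> R[i]).
Hypothesis N2 : (2 <= N)%N.
Let M w := (m0 (circ w))^* * m0' (circ w).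
Hypothesis PM : {ae mu, forall w, N%:R * P (N%:R * w) = M w * P w}.
Hypothesis P1 : {ae mu, forall x, csummable (fun k => P (x + k%:~R * L)) /\
  orbit_sum 1 P x = 1}.
Let N0 : (0 < N)%N := ltnW N2.

Let Mper w k : M (w + k%:~R * L) = M w.
Proof. by rewrite /M circ_period. Qed.

Lemma ruelle1 : ae_eqT (ruelle N m0 m0' (fun=> 1)) (fun=> 1).
Proof.
have GE : {ae mu, forall x, csummable (fun k => P (x + k%:~R * L) * (fun=> 1) (x + k%:~R * L)) /\
    csum (fun k => P (x + k%:~R * L) * (fun=> 1) (x + k%:~R * L)) = (fun=> 1) x}.
  by apply: ae_lebesgueS P1 => x [sP eP]; under eq_fun do rewrite mulr1; split.
have h := csum_refine (G := fun=> 1) (E := fun=> 1) N0 Mper PM GE.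
by apply: (ae_lebesgueS2 _ GE h) => x [_ e1] [_ e2]; rewrite ruelle_circ// -e2 e1.
Qed.

(** Induction on n: one more contraction of the argument applies the operator to
the sum, by [csum_refine], and h is fixed by the operator. *)
Lemma csum_fixed_point (h : R[i] -> R[i]) : ae_eqT (ruelle N m0 m0' h) h -> forall n,
  {ae mu, forall x,
    csummable (fun k => P (x + k%:~R * L) * h (circ (N%:R^-1 ^+ n * (x + k%:~R * L)))) /\
    csum (fun k => P (x + k%:~R * L) * h (circ (N%:R^-1 ^+ n * (x + k%:~R * L)))) = h (circ x)}.
Proof.
move=> Rh; elim=> [|n IH].
  apply: ae_lebesgueS P1 => x [sP eP].
  have E : (fun k : int => P (x + k%:~R * L) * h (circ (N%:R^-1 ^+ 0 * (x + k%:~R * L)))) =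
      (fun k => h (circ x) * P (x + k%:~R * L)).
    by apply/funext => k; rewrite expr0 mul1r circ_period mulrC.
  rewrite E; split; first exact: csummableZ.
  by rewrite csumZ// [csum _]eP mulr1.
have := csum_refine (G := fun x => h (circ (N%:R^-1 ^+ n * x))) (E := fun x => h (circ x)) N0 Mper PM IH.
apply: (ae_lebesgueS2 _ Rh) => x; rewrite ruelle_circ// => <-.
by under eq_fun do rewrite [_ ^+ n * _]mulrA -exprSr.
Qed.

(** Almost every x is good for all the countably many points involved: there the
representative g that is continuous at 1 agrees with h, and h is bounded. *)
Lemma fixed_point_constant (h : R[i] -> R[i]) : ruelle_solution N m0 m0' h ->
  exists c : R[i], ae_eqT h (fun=> c * 1).
Proof.
move=> [hinf Rh [g [gh gc]]]; exists (g 1).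
have [B hB] := LinftyT_ae_bounded hinf.
have Nr : 0 < N%:R :> R by rewrite ltr0n.
have q0 : 0 < N%:R^-1 :> R by rewrite invr_gt0.
have q1 : `|N%:R^-1| < 1 :> R by rewrite gtr0_norm// invf_lt1// ltr1n.
have at_points (Q : R -> Prop) : {ae mu, forall y, Q y} ->
    {ae mu, forall x, forall n k, Q (N%:R^-1 ^+ n * (x + k%:~R * L))}.
  move=> aeQ; apply: (@ae_foralln _ (measurableTypeR R) R mu) => n; apply: ae_forall_int => k.
  exact: (ae_shift (k%:~R * L) (ae_scale (exprn_gt0 n q0) aeQ)).
have fix_all := @ae_foralln _ (measurableTypeR R) R mu _ (csum_fixed_point Rh).
have hg := ae_lebesgueS2 (fun x a b => conj a b) (at_points _ hB) (at_points _ gh).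
apply: (ae_lebesgueS2 _ (ae_lebesgueS2 (fun x a b => conj a b) fix_all P1) hg).
move=> x [Fx [sP eP]] [bx gx]; transitivity (g 1 * orbit_sum 1 P x); last by rewrite eP.
apply: (csum_tannery sP bx _ Fx) => k.
under eq_fun do rewrite -gx.
by apply: (circle_cvg_normc gc); [move=> n; rewrite normc_expi|exact: circ_scaled_cvg].
Qed.

End fixed_points.

Theorem theorem3p1 (R : realType) (N : nat) (m0 m0' : R[i] -> R[i])
    (phi phi' phihat phihat' : R -> R[i])
    (hN : (2 <= N)%N)
    (hm0 : LinftyT m0) (hm0' : LinftyT m0')
    (hm0_ns : nonsingular m0) (hm0'_ns : nonsingular m0')
    (hphi : L2 phi) (hphi' : L2 phi')
    (hcyc : cyclic_vector N phi) (hcyc' : cyclic_vector N phi')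
    (hscal : mult_rep m0 phi (dilation N phi))
    (hscal' : mult_rep m0' phi' (dilation N phi'))
    (* chosen representatives of the Fourier transforms *)
    (hhat : is_fourier phi phihat) (hhat' : is_fourier phi' phihat')
    (h_i : phihat 0 <> 0) (h_i' : phihat' 0 <> 0)
    (h_ii : riesz_translates phi) (h_ii' : riesz_translates phi')
    (h_iii : {for (0 : R), continuous (phihat : R -> R[i]^o)})
    (h_iii' : {for (0 : R), continuous (phihat' : R -> R[i]^o)})
    (h_iii_tail : vanishing_tails phihat)
    (h_iii_tail' : vanishing_tails phihat') :
  (biorthogonal phi phi' <-> periodized_product_is1 phihat phihat') /\
  (biorthogonal phi phi' ->
     ruelle_solution N m0 m0' (fun=> 1) /\
     (forall h : R[i] -> R[i], ruelle_solution N m0 m0' h ->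
        exists c : R[i], ae_eqT h (fun=> c * 1))).
Proof.
have N0 : (0 < N)%N := ltnW hN.
have T := transform_pair_of_fourier hhat; have T' := transform_pair_of_fourier hhat'.
have [_ Lh _] := T; have [_ Lh' _] := T'.
split; first by rewrite (biorthogonal_orbit_sum T T') (periodized_product_orbit_sum Lh Lh').
move=> /(biorthogonal_orbit_sum T T').1 P1.
pose P := fun x => (phihat x)^* * phihat' x.
have mP : cmeasurable_fun P := cmeasurable_conj_mul Lh Lh'.
have P1s := ae_lebesgueS2 (fun x a b => conj a b)
  (ae_csummable_orbit ltr01 mP (cintegrable_conj_mul Lh Lh')) P1.
have PM : {ae lebesgue_measure, forall w, N%:R * P (N%:R * w) =
    (m0 (circ w))^* * m0' (circ w) * P w}.
  apply: (ae_lebesgueS2 _ (scaling_fourier N0 hhat hscal) (scaling_fourier N0 hhat' hscal')) => w.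
  exact: scaling_product.
split; last by move=> h; exact: (fixed_point_constant hN PM P1s).
split; last by exists (fun=> 1); split; [exact: aeW | exact: cvg_cst].
  exact: LinftyT_cst.
exact: (ruelle1 hN PM P1s).
Qed.
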